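(* Let $(G,\Gamma,p,\pi)$ be a planar non-crossing periodic framework. If $H$ is a periodic lifting of $(G,\Gamma,p,\pi)$, then the stress induced by $H$ is a periodic stress. Conversely, any periodic stress $s$ of $(G,\Gamma,p,\pi)$ is induced by a periodic lifting, and this lifting is determined up to an arbitrary additive constant. The correspondence relates the stress signs to the mountain/valley types of the lifted edges: edges with negative stress correspond to mountain edges of the lifting, edges with positive stress correspond to valley edges, and edges with zero stress correspond to flat edges (the two adjacent faces are lifted to a common plane).
   Context: A planar periodic framework $(G,\Gamma,p,\pi)$ consists of: an infinite, simple, connected graph $G=(V,E)$ with unoriented edges; a periodicity group $\Gamma\subset \mathrm{Aut}(G)$ which is free Abelian of rank two, acts without fixed vertices or fixed edges (no non-identity element fixes a vertex or an edge), and has finitely many vertex orbits and edge orbits; a placement $p:V\to\mathbb{R}^2$ with $p(u)\ne p(v)$ whenever $\{u,v\}\in E$; and an injective homomorphism $\pi:\Gamma\to\mathcal{T}(\mathbb{R}^2)\cong\mathbb{R}^2$ whose image $\Lambda=\pi(\Gamma)$ is a rank-two lattice of translations, such that $p(\gamma v)=p(v)+\pi(\gamma)$ for all $\gamma\in\Gamma,v\in V$. The framework is non-crossing if any two edges give disjoint closed segments $[p(u),p(v)]$, except for the common endpoint when the edges are adjacent. Faces are the connected components of the complement in $\mathbb{R}^2$ of the union of all placed vertices and edge segments. Standing assumption: the boundary of each face is a simple finite polygon (so each edge lies on the boundary of exactly two faces). Lifting: a continuous function $H:\mathbb{R}^2\to\mathbb{R}$ whose restriction to each face is affine; write $H(q)=\nu_U\cdot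 q+C_U$ for $q$ in the face $U$, with $\nu_U\in\mathbb{R}^2$, $C_U\in\mathbb{R}$. It is periodic if $H(q+\lambda)=H(q)$ for all $q\in\mathbb{R}^2$, $\lambda\in\Lambda$. Induced stress: for an oriented edge $(u,v)$ with adjacent faces $U,V$ such that going from $p(u)$ to $p(v)$ goes counter-clockwise around $V$ and clockwise around $U$, the stress factor $s_{uv}$ is defined by $\nu_V-\nu_U=s_{uv}(p(v)-p(u))^{\perp}$, where $(x,y)^\perp=(-y,x)$. It does not depend on the orientation of the edge. A stress $s$ is induced by $H$ if its values are these factors. An equilibrium stress is a function $s:E\to\mathbb{R}$ such that $\sum_{e=\{u,v\}\in E}s_e(p(v)-p(u))=0$ for each fixed $u\in V$. It is $\Gamma$-invariant if it is constant on $\Gamma$-orbits of edges. Periodic stress: fix generators of $\Gamma$, with images $\lambda_1,\lambda_2$ forming the columns of a $2\times2$ matrix also denoted $\Lambda$, and fix representatives $v_1,\dots,v_n$ of $V/\Gamma$ with $x_i=p(v_i)$. Each edge orbit $\beta\in E/\Gamma$ has a representative starting at some $v_i$, $i=i(\beta)$, and ending at a $\Gamma$-translate of some $v_j$, $j=j(\beta)$, with edge vector $e_\beta=(x_j+\Lambda c_\beta)-x_i$, $c_\beta=(c_\beta^1,c_\beta^2)\in\mathbb{Z}^2$. A periodic stress is a $\Gamma$-invariant equilibrium stress $s$ satisfying $\sum_{\beta\in E/\Gamma}s_\beta c_\beta^j e_\beta=0$ for $j=1,2$. (This does not depend on the choices.) An edge of the lifting is a mountain edge if it is non-flat and $H$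 is concave in a neighborhood of (a relative interior point of) the edge, a valley edge if it is non-flat and $H$ is convex there, and flat if both adjacent faces are lifted to the same plane. *)

(* Defs.v *)
From mathcomp Require Import all_boot all_order all_algebra.
From mathcomp Require Import all_classical all_reals all_analysis.

Set Implicit Arguments.
Unset Strict Implicit.
Unset Printing Implicit Defensive.

Import Order.TTheory GRing.Theory Num.Theory.
Import numFieldNormedType.Exports.

Local Open Scope classical_set_scope.
Local Open Scope ring_scope.

Notation plane R := (R * R)%type (only parsing).

Section PlaneGeometry.
Variable R : realType.
Implicit Types (a b q x : plane R) (U : set (plane R)) (H : plane R -> R).

Definition dotp a b : R := a.1 * b.1 + a.2 * b.2.

Definition perp a : plane R := (- a.2, a.1).

Definition segment a b : set (plane R) :=
  [set a + t *: (b - a) | t in [set t : R | 0 <= t <= 1]].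

Definition open_segment a b : set (plane R) :=
  [set a + t *: (b - a) | t in [set t : R | 0 < t < 1]].

Definition boundary U : set (plane R) := closure U `\` interior U.

(* [B] is the point set of a simple closed polygon with [k.+3] vertices [w i];
   [ordS] is the cyclic successor, so the sides are [w i, w (i + 1)]. *)
Definition simple_polygon (B : set (plane R)) : Prop :=
  exists (k : nat) (w : 'I_k.+3 -> plane R),
    [/\ injective w,
        forall i j, i != j ->
          segment (w i) (w (ordS i)) `&` segment (w j) (w (ordS j)) =
          w @` ([set i; ordS i] `&` [set j; ordS j])
      & B = \bigcup_(i in setT) segment (w i) (w (ordS i))].

Definition rank2_lattice (L : set (plane R)) : Prop :=
  exists a b : plane R, a.1 * b.2 - a.2 * b.1 != 0 /\
    L = [set a *~ c.1 + b *~ c.2 | c in [set: int * int]].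

(* [H] restricted to [U] is the affine function q |-> nu . q + C. *)
Definition affine_on H U (nu : plane R) (C : R) : Prop :=
  forall q, U q -> H q = dotp nu q + C.

(* The balls of [R * R] are open squares, hence convex. *)
Definition convex_near H x : Prop :=
  exists2 e : R, 0 < e & convex_function (ball x e) H.

Definition concave_near H x : Prop :=
  exists2 e : R, 0 < e & convex_function (ball x e) (fun q => - H q).

End PlaneGeometry.

Definition is_Z2_basis (Gamma : zmodType) (g1 g2 : Gamma) : Prop :=
  bijective (fun c : int * int => g1 *~ c.1 + g2 *~ c.2).

(* The group Gamma of graph automorphisms is an additive group with a faithful
   action [fw_act] on the vertices. The type [V] carries the vertices; edges
   are the two-element sets [set u; v] with [fw_adj u v]. *)
Record periodic_framework (R : realType) (V : choiceType) (Gamma : zmodType) :=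
  PeriodicFramework {
  fw_adj : rel V;
  fw_act : Gamma -> V -> V;
  fw_p : V -> plane R;
  fw_pi : {additive Gamma -> plane R};
  fw_infinite : infinite_set [set: V];
  fw_irrefl : irreflexive fw_adj;
  fw_sym : symmetric fw_adj;
  fw_connected : forall u v : V, exists s : seq V,
    path fw_adj u s /\ last u s = v;
  fw_act0 : forall v, fw_act 0 v = v;
  fw_actD : forall g h v, fw_act (g + h) v = fw_act g (fw_act h v);
  fw_act_adj : forall g u v, fw_adj (fw_act g u) (fw_act g v) = fw_adj u v;
  fw_act_faithful : injective fw_act;
  fw_free_abelian2 : exists g1 g2 : Gamma, is_Z2_basis g1 g2;
  fw_no_fixed_vertex : forall g v, g != 0 -> fw_act g v <> v;
  fw_no_fixed_edge : forall g u v, g != 0 -> fw_adj u v ->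
    fw_act g @` [set u; v] <> [set u; v];
  fw_vertex_orbits : finite_set
    [set [set fw_act g v | g in [set: Gamma]] | v in [set: V]];
  fw_edge_orbits : finite_set
    [set [set fw_act g @` e | g in [set: Gamma]] |
      e in [set e | exists u v, fw_adj u v /\ e = [set u; v]]];
  fw_edge_nondeg : forall u v, fw_adj u v -> fw_p u <> fw_p v;
  fw_pi_inj : injective fw_pi;
  fw_lattice : rank2_lattice (range fw_pi);
  fw_equivariant : forall g v, fw_p (fw_act g v) = fw_p v + fw_pi g
}.

Section Framework.
Variables (R : realType) (V : choiceType) (Gamma : zmodType).
Variable F : periodic_framework R V Gamma.

Local Notation adj := (fw_adj F).
Local Notation act := (fw_act F).
Local Notation p := (fw_p F).
Local Notation pi := (fw_pi F).

Implicit Types (u v : V) (g : Gamma) (U W : set (plane R)).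
Implicit Types (H : plane R -> R) (s : set V -> R).

Definition edges : set (set V) :=
  [set e | exists u v, adj u v /\ e = [set u; v]].

Definition noncrossing : Prop :=
  forall u v u' v', adj u v -> adj u' v' -> [set u; v] <> [set u'; v'] ->
    segment (p u) (p v) `&` segment (p u') (p v') =
    p @` ([set u; v] `&` [set u'; v']).

Definition skeleton : set (plane R) :=
  [set q | (exists v, q = p v) \/
           (exists u v, adj u v /\ segment (p u) (p v) q)].

Definition faces : set (set (plane R)) :=
  [set connected_component (~` skeleton) q | q in ~` skeleton].

Definition polygonal_faces : Prop :=
  forall U, faces U -> simple_polygon (boundary U).

(* Going from [p u] to [p v] goes counter-clockwise around the face [W], i.e.
   [W] lies immediately to the left of the oriented edge [(u, v)]. It goes
   clockwise around [U] when [U] lies to the left of [(v, u)]. *)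
Definition left_face W u v : Prop :=
  faces W /\ forall x, open_segment (p u) (p v) x ->
    \forall t \near 0^'+, W (x + t *: perp (p v - p u)).

Definition is_lifting H : Prop :=
  continuous H /\ forall U, faces U -> exists nu C, affine_on H U nu C.

Definition periodic_lifting H : Prop :=
  is_lifting H /\ forall q g, H (q + pi g) = H q.

(* Stresses are functions of the unoriented edge; only their values on [edges]
   are ever used. *)
Definition induced_stress H s : Prop :=
  forall u v, adj u v -> exists W U nuW nuU CW CU,
    [/\ left_face W u v, left_face U v u,
        affine_on H W nuW CW, affine_on H U nuU CU
      & nuW - nuU = s [set u; v] *: perp (p v - p u)].

(* The sum ranges over the neighbours of [u], which are finitely many. *)
Definition equilibrium_stress s : Prop :=
  forall u, \sum_(v \in [set v | adj u v]) s [set u; v] *: (p v - p u) = 0.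

Definition invariant_stress s : Prop :=
  forall e g, edges e -> s (act g @` e) = s e.

(* The choices used to write down periodicity of a stress: generators of Gamma,
   representatives of the vertex orbits, and for each edge orbit [b] an edge
   from [fd_rep (fd_src b)] to the translate of [fd_rep (fd_tgt b)] by
   [fd_c b], in the coordinates given by the generators. *)
Record fundamental_data := FundamentalData {
  fd_g1 : Gamma;
  fd_g2 : Gamma;
  fd_gens : is_Z2_basis fd_g1 fd_g2;
  fd_n : nat;
  fd_rep : 'I_fd_n -> V;
  fd_repP : forall v, exists! i, exists g, v = act g (fd_rep i);
  fd_m : nat;
  fd_src : 'I_fd_m -> 'I_fd_n;
  fd_tgt : 'I_fd_m -> 'I_fd_n;
  fd_c : 'I_fd_m -> int * int;
  fd_end := fun b =>
    act (fd_g1 *~ (fd_c b).1 + fd_g2 *~ (fd_c b).2) (fd_rep (fd_tgt b));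
  fd_edge_adj : forall b, adj (fd_rep (fd_src b)) (fd_end b);
  fd_edgeP : forall e, edges e -> exists! b, exists g,
    e = act g @` [set fd_rep (fd_src b); fd_end b]
}.

Definition edge_vector (D : fundamental_data) (b : 'I_(fd_m D)) : plane R :=
  (p (fd_rep (fd_tgt b)) +
     (pi (fd_g1 D) *~ (fd_c b).1 + pi (fd_g2 D) *~ (fd_c b).2))
  - p (fd_rep (fd_src b)).

Definition orbit_stress (D : fundamental_data) s (b : 'I_(fd_m D)) : R :=
  s [set fd_rep (fd_src b); fd_end b].

Definition periodic_stress (D : fundamental_data) s : Prop :=
  [/\ equilibrium_stress s,
      invariant_stress s,
      \sum_(b < fd_m D) (orbit_stress s b * (fd_c b).1%:~R) *: edge_vector b = 0
    & \sum_(b < fd_m D) (orbit_stress s b * (fd_c b).2%:~R) *: edge_vector b = 0].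

Definition flat_edge H u v : Prop :=
  exists W U nu C, [/\ left_face W u v, left_face U v u,
    affine_on H W nu C & affine_on H U nu C].

Definition mountain_edge H u v : Prop :=
  ~ flat_edge H u v /\
  exists x, open_segment (p u) (p v) x /\ concave_near H x.

Definition valley_edge H u v : Prop :=
  ~ flat_edge H u v /\
  exists x, open_segment (p u) (p v) x /\ convex_near H x.

End Framework.

(* Main.v *)
Require Import Defs.
From mathcomp Require Import all_boot all_order all_algebra.
From mathcomp Require Import all_classical all_reals all_analysis.
From mathcomp Require Import finmap zify ring lra.
Import Order.TTheory GRing.Theory Num.Theory.
Import numFieldNormedType.Exports.
Local Open Scope classical_set_scope.
Local Open Scope ring_scope.

Set Implicit Arguments.
Unset Strict Implicit.
Unset Printing Implicit Defensive.

(** A lifting is described by the affine functions it agrees with on the faces.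
    Crossing an edge uv from right to left adds to this affine function the
    multiple s_uv of [orient (p u) (p v)], an affine function that vanishes on
    the line uv ([edge_jump]). Hence, for two points a and b off the skeleton,
    the affine functions at b and at a differ by [jump s a b], the sum of these
    terms over all edges, weighted by their signed number of crossings with the
    segment ab ([crossing_formula]).

    The proof rests on a definition of this number, [cross], for which the
    dependence on the path is a formal matter. Counting the crossings of a
    segment with vertical rays gives [under] and [over], and [cross] combines
    the four counts at the endpoints of two segments. Summed over the sides of a
    closed triangle it is, by mere cancellation, the coboundary of a function of
    the vertices, the winding number of the triangle. So the sum of the jumps
    around a triangle is a combination of the forces
    [star s u = \sum_v s_uv (p v - p u)] at the vertices ([jump_triangle]), and
    it vanishes as soon as these are in equilibrium. What is left to geometry is
    that [cross] vanishes on disjoint segments ([cross_meets]) and takes its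
    expected value at a transversal crossing ([cross_right_left]).

    - A lifting has zero total jump around a small triangle that encloses one
      vertex u, and this total is the moment of [star s u] up to sign: the induced
      stress is in equilibrium ([lifting_star0]).
    - For an equilibrium stress the jumps satisfy
      [jump s a b + jump s b c = jump s a c], so that
      [q |-> jump s 0 q evaluated at q] is a lifting which induces s
      ([lift_is_lifting], [lift_induced]).
    - The crossings are counted in lattice coordinates, the second generator
      being vertical. The crossings of all translates of an edge with a segment
      from q to q + lambda_1 then telescope, and the change of the gradient
      along lambda_1 is the vector [\sum_b s_b c_b^2 e_b] up to a quarter turn
      and a factor ([lattice_sum], [period_jump]); exchanging the generators
      treats lambda_2. The two vector equations in the definition of a periodic
      stress thus say that the gradient is periodic. The lifting then grows by
      constants along the generators, which a linear function compensates
      ([make_periodic]).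
    - Two liftings with the same stress have the same jumps, so they differ by
      one affine function ([same_stress_affine]); if both are periodic, this
      function is constant.
    - Near a relative interior point of uv, a lifting is an affine function plus
      s_uv times the positive part of [orient (p u) (p v)] ([local_fold]), which
      is a convex or concave fold according to the sign of s_uv. *)

(** * Crossing numbers of segments *)

Section CrossingNumber.
Variable R : realType.
Implicit Types (a b c d o u v x : plane R) (k r s t : R).

Lemma coordE :
  (forall a b, (a + b).1 = a.1 + b.1) * (forall a b, (a + b).2 = a.2 + b.2) *
  ((forall a, (- a).1 = - a.1) * (forall a, (- a).2 = - a.2)) *
  ((forall t a, (t *: a).1 = t * a.1) * (forall t a, (t *: a).2 = t * a.2)).
Proof. by []. Qed.

Lemma eq_plane a b : a.1 = b.1 -> a.2 = b.2 -> a = b.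
Proof. by case: a b => [? ?] [? ?] /= -> ->. Qed.

Definition det a b : R := a.1 * b.2 - a.2 * b.1.

(** Twice the signed area of the triangle abc: positive when c lies to the left of
    the oriented line ab. *)
Definition orient a b c : R := det (b - a) (c - a).

Lemma orientE a b c :
  orient a b c = (b.1 - a.1) * (c.2 - a.2) - (b.2 - a.2) * (c.1 - a.1).
Proof. by rewrite /orient /det !coordE. Qed.

Lemma orientC a b c : orient b a c = - orient a b c.
Proof. rewrite !orientE; ring. Qed.

(** Signed indicator of the abscissas between a and b. The two versions close the
    interval at opposite ends; this breaks ties between endpoints of two segments
    with equal abscissas, as an infinitesimal horizontal shift would. *)
Definition slabl a b t : R := (a.1 <= t)%R%:R - (b.1 <= t)%R%:R.
Definition slabr a b t : R := (a.1 < t)%R%:R - (b.1 < t)%R%:R.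

(** Signed number of crossings of ab with the upward vertical ray from u. *)
Definition under a b u : R :=
  slabl a b u.1 * (slabl a b u.1 * orient a b u < 0)%R%:R.
(** Signed number of crossings of uv with the downward vertical ray from a. *)
Definition over u v a : R :=
  slabr u v a.1 * (0 < slabr u v a.1 * orient u v a)%R%:R.

(** The signed number of crossings of ab and uv, written so that its sum over a
    closed polygon in the first segment is a coboundary in the second one. *)
Definition cross a b u v : R :=
  under a b u - under a b v + (over u v a - over u v b).

Lemma under_anti a b u : under b a u = - under a b u.
Proof.
rewrite /under (orientC a b).
have -> : slabl b a u.1 = - slabl a b u.1 by rewrite /slabl opprB.
by rewrite mulrNN mulNr.
Qed.

Lemma over_anti u v a : over v u a = - over u v a.
Proof.
rewrite /over (orientC u v).
have -> : slabr v u a.1 = - slabr u v a.1 by rewrite /slabr opprB.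
by rewrite mulrNN mulNr.
Qed.

Lemma cross_antil a b u v : cross b a u v = - cross a b u v.
Proof. rewrite /cross !(under_anti a b); ring. Qed.

Lemma cross_antir a b u v : cross a b v u = - cross a b u v.
Proof. rewrite /cross !(over_anti u v); ring. Qed.

Lemma cross_trans d a b u v :
  cross (a + d) (b + d) (u + d) (v + d) = cross a b u v.
Proof.
rewrite /cross /under /over /slabl /slabr !orientE !coordE !lerD2r !ltrD2r.
by rewrite !(addrKA, opprD, addrACA _ d.1, addrACA _ d.2) ?subrr ?addr0.
Qed.

Lemma cross_bound a b u v : `|cross a b u v| <= 4.
Proof.
have S (x y z : bool) : `|(x%:R - y%:R) * z%:R| <= 1 :> R.
  by case: x; case: y; case: z;
    rewrite ?subrr ?subr0 ?sub0r ?mulr0 ?mulr1 ?normrN ?normr0 ?normr1.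
have := S (a.1 <= u.1) (b.1 <= u.1) (slabl a b u.1 * orient a b u < 0).
have := S (a.1 <= v.1) (b.1 <= v.1) (slabl a b v.1 * orient a b v < 0).
have := S (u.1 < a.1) (v.1 < a.1) (0 < slabr u v a.1 * orient u v a).
have := S (u.1 < b.1) (v.1 < b.1) (0 < slabr u v b.1 * orient u v b).
rewrite -/(slabl _ _ _) -/(slabl _ _ _) -/(slabr _ _ _) -/(slabr _ _ _).
rewrite /cross /under /over !ler_norml => /andP[? ?] /andP[? ?] /andP[? ?] /andP[? ?].
apply/andP; split; lra.
Qed.

(** Winding number of the triangle abc about u, up to sign: the upward ray from u
    is tested against the three sides. *)
Definition winding a b c u : R := under a b u + under b c u + under c a u.

(** The terms [over u v _] cancel around the triangle. *)
Lemma cross_triangle a b c u v :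
  cross a b u v + cross b c u v + cross c a u v =
  winding a b c u - winding a b c v.
Proof. rewrite /cross /winding; ring. Qed.

Lemma mul_sign k r s : 0 < k * r -> (k * s < 0) = (r * s < 0).
Proof.
move=> h; have k2 : 0 < k ^+ 2.
  by rewrite exprn_even_gt0 //=; apply: contraTneq h => ->; rewrite mul0r ltxx.
rewrite -(pmulr_rlt0 (k * s) h) -(pmulr_rlt0 (r * s) k2).
by congr (_ < 0); ring.
Qed.

(** The segment enters only through its supporting line and the abscissas of its
    ends, whence the additivity of crossing numbers along a line. *)
Lemma under_line o d s t u :
  under (o + s *: d) (o + t *: d) u =
  slabl (o + s *: d) (o + t *: d) u.1 * (d.1 * det d (u - o) < 0)%R%:R.
Proof.
rewrite /under.
have -> : orient (o + s *: d) (o + t *: d) u = (t - s) * det d (u - o).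
  rewrite orientE /det !coordE; ring.
set D := det d (u - o); rewrite /slabl !coordE.
case: (leP (o.1 + s * d.1) u.1) => h1; case: (leP (o.1 + t * d.1) u.1) => h2;
  rewrite ?subrr ?mul0r // ?subr0 ?sub0r ?mulN1r ?mul1r ?mulN1r.
- by rewrite (@mul_sign (t - s) d.1) //; lra.
- by rewrite -mulNr opprB (@mul_sign (s - t) d.1) //; lra.
Qed.

Lemma cross_line o d r s t u v :
  cross (o + r *: d) (o + s *: d) u v + cross (o + s *: d) (o + t *: d) u v =
  cross (o + r *: d) (o + t *: d) u v.
Proof.
rewrite /cross !under_line /slabl; ring.
Qed.

Lemma under_high a b u : a.2 <= u.2 -> b.2 <= u.2 -> under a b u = 0.
Proof.
rewrite /under orientE /slabl => ha hb.
case: (leP a.1 u.1) => h1; case: (leP b.1 u.1) => h2;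
  rewrite ?subrr ?mul0r // ?subr0 ?sub0r ?mulN1r ?mul1r.
- by rewrite ltNge (_ : _ <= _) //; nra.
- by rewrite ltNge (_ : _ <= _) ?oppr0 //; nra.
Qed.

Lemma under_low a b u : u.2 < a.2 -> u.2 < b.2 -> under a b u = slabl a b u.1.
Proof.
rewrite /under orientE /slabl => ha hb.
case: (leP a.1 u.1) => h1; case: (leP b.1 u.1) => h2;
  rewrite ?subrr ?mul0r // ?subr0 ?sub0r ?mulN1r ?mul1r.
- by rewrite (_ : _ < _) //; nra.
- by rewrite (_ : _ < _) //; nra.
Qed.

(** To the left and to the right of the box no ray meets a side, above it all sides
    lie below the ray, and below it the signed slabs of the sides add up to zero. *)
Lemma winding_out a b c u (M : R) :
  (M < `|u.1 - a.1| \/ M < `|u.2 - a.2|) ->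
  `|b.1 - a.1| <= M -> `|b.2 - a.2| <= M ->
  `|c.1 - a.1| <= M -> `|c.2 - a.2| <= M -> winding a b c u = 0.
Proof.
rewrite !lter_norml !ltNge !ler_norml.
move=> h /andP[b1 b2] /andP[b3 b4] /andP[c1 c2] /andP[c3 c4].
rewrite /winding; case: h; rewrite negb_and -!ltNge => /orP[] h.
- rewrite /under /slabl.
  do 3 (rewrite (_ : (_ <= u.1) = false); last by apply/negbTE; rewrite -ltNge; lra).
  by rewrite !subrr !mul0r !addr0.
- rewrite /under /slabl.
  do 3 (rewrite (_ : (_ <= u.1) = true); last by lra).
  by rewrite !subrr !mul0r !addr0.
- rewrite !under_low; try lra.
  rewrite /slabl; ring.
- rewrite !under_high ?addr0 //; lra.
Qed.

End CrossingNumber.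

Section CrossingMeets.
Variable R : realType.
Implicit Types (a b c d o u v x : plane R) (r s t : R).

Lemma segmentC a b : segment a b = segment b a.
Proof.
suff H : forall a b, segment a b `<=` segment b a by apply/seteqP; split; exact: H.
move=> {a b} a b x [t /= /andP[t0 t1] <-].
exists (1 - t); first by apply/andP; split; lra.
by apply: eq_plane; rewrite !coordE; ring.
Qed.

(** Ordinate at abscissa t of the line through a and b, when it is not vertical. *)
Definition yline a b t : R := a.2 + (b.2 - a.2) / (b.1 - a.1) * (t - a.1).

Lemma yline_l a b : yline a b a.1 = a.2.
Proof. by rewrite /yline subrr mulr0 addr0. Qed.

Lemma yline_r a b : a.1 < b.1 -> yline a b b.1 = b.2.
Proof. by move=> h; rewrite /yline divfK ?subr_eq0 ?gt_eqF //; ring. Qed.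

Lemma segment_yline a b t : a.1 < b.1 -> a.1 <= t <= b.1 ->
  segment a b (t, yline a b t).
Proof.
move=> ab /andP[h1 h2]; have d0 : 0 < b.1 - a.1 by lra.
exists ((t - a.1) / (b.1 - a.1)).
  by rewrite /= divr_ge0 ?ler_pdivrMr ?mul1r //; lra.
apply: eq_plane; rewrite !coordE /yline /=; field; lra.
Qed.

Lemma segment_vert a b t : a.1 = b.1 -> a.2 < b.2 -> a.2 <= t <= b.2 ->
  segment a b (a.1, t).
Proof.
move=> e h /andP[h1 h2]; have d0 : 0 < b.2 - a.2 by lra.
exists ((t - a.2) / (b.2 - a.2)).
  by rewrite /= divr_ge0 ?ler_pdivrMr ?mul1r //; lra.
by apply: eq_plane; rewrite !coordE /= -?e; field; lra.
Qed.

Lemma under_lt a b u : a.1 < b.1 ->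
  under a b u = ((a.1 <= u.1) && (u.1 < b.1) && (u.2 < yline a b u.1))%:R.
Proof.
move=> ab; have d0 : 0 < b.1 - a.1 by lra.
have E : (u.2 < yline a b u.1) = (orient a b u < 0).
  rewrite /yline -subr_lt0 -(pmulr_rlt0 _ d0) orientE; congr (_ < 0).
  by field; lra.
rewrite /under E /slabl.
case: (leP a.1 u.1) => h1; case: (leP b.1 u.1) => h2 //=;
  rewrite ?subrr ?subr0 ?mul0r ?mul1r //; lra.
Qed.

Lemma over_lt u v a : u.1 < v.1 ->
  over u v a = ((u.1 < a.1) && (a.1 <= v.1) && (yline u v a.1 < a.2))%:R.
Proof.
move=> ab; have d0 : 0 < v.1 - u.1 by lra.
have E : (yline u v a.1 < a.2) = (0 < orient u v a).
  rewrite /yline -subr_gt0 -(pmulr_rgt0 _ d0) orientE; congr (0 < _).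
  by field; lra.
rewrite /over E /slabr.
case: (ltP u.1 a.1) => h1; case: (ltP v.1 a.1) => h2 //=;
  rewrite ?subrr ?subr0 ?mul0r ?mul1r //; lra.
Qed.

(** Intermediate value property, with the explicit root of f - g. *)
Lemma affine_root (f g : R -> R) (l h : R) :
  (forall x y t : R, f (x + t * (y - x)) = f x + t * (f y - f x)) ->
  (forall x y t : R, g (x + t * (y - x)) = g x + t * (g y - g x)) ->
  l <= h -> (g l < f l) != (g h < f h) ->
  exists2 x : R, l <= x <= h & f x = g x.
Proof.
move=> F G lh ne.
have E : f l - g l - (f h - g h) != 0.
  apply/negP => /eqP e0; move: ne.
  by case: ltP => h1; case: ltP => h2 //= _; lra.
have [t0 t1] : 0 <= (f l - g l) / (f l - g l - (f h - g h)) /\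
    (f l - g l) / (f l - g l - (f h - g h)) <= 1.
  move: ne; case: ltP => h1; case: ltP => h2 //= _.
    by rewrite divr_ge0 ?ler_pdivrMr ?mul1r; lra.
  have h3 : 0 < f h - g h - (f l - g l) by lra.
  by rewrite -mulrNN -invrN !opprB divr_ge0 ?ler_pdivrMr ?mul1r; lra.
exists (l + (f l - g l) / (f l - g l - (f h - g h)) * (h - l)); first nra.
by rewrite F G; field.
Qed.

Lemma yline_affine a b (x y t : R) :
  yline a b (x + t * (y - x)) = yline a b x + t * (yline a b y - yline a b x).
Proof. rewrite /yline; ring. Qed.

(** For disjoint segments, which of the two is on top does not change over the common
    interval of abscissas. This interval starts at exactly one counted endpoint and
    ends at exactly one, by the choice of the half-open conventions, and the two
    contributions cancel. *)
Lemma cross_meets_lt a b u v : a.1 < b.1 -> u.1 < v.1 -> cross a b u v != 0 ->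
  exists x, segment a b x /\ segment u v x.
Proof.
move=> ab uv; apply: contraNP => N.
pose P t := yline u v t < yline a b t.
have PP (x y : R) : a.1 <= x <= b.1 -> u.1 <= x <= v.1 -> a.1 <= y <= b.1 ->
    u.1 <= y <= v.1 -> P x = P y.
  wlog xy : x y / x <= y => [H h1 h2 h3 h4|].
    by have [/H|/ltW /H ->] := leP x y; auto.
  move=> /andP[h1 h2] /andP[h3 h4] /andP[h5 h6] /andP[h7 h8].
  apply: contra_notP N => /eqP ne.
  have [z /andP[z1 z2] e] := affine_root (yline_affine a b) (yline_affine u v) xy ne.
  exists (z, yline a b z); split; first by apply: segment_yline => //; lra.
  by rewrite e; apply: segment_yline => //; lra.
have E : cross a b u v =
    ((a.1 <= u.1) && (u.1 < b.1) && P u.1)%:R -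
    ((a.1 <= v.1) && (v.1 < b.1) && P v.1)%:R +
    (((u.1 < a.1) && (a.1 <= v.1) && P a.1)%:R -
    ((u.1 < b.1) && (b.1 <= v.1) && P b.1)%:R).
  by rewrite /cross !under_lt // !over_lt // /P !yline_l !yline_r.
rewrite E; apply/eqP.
case: (leP a.1 u.1) => h1; case: (ltP u.1 b.1) => h2; case: (leP a.1 v.1) => h3;
  case: (ltP v.1 b.1) => h4 //=; try (exfalso; lra);
  rewrite ?subrr ?addr0 ?add0r ?subr0 ?oppr0 //.
- by rewrite (PP u.1 v.1) ?subrr; lra.
- by rewrite (PP u.1 b.1) ?subrr; lra.
- by rewrite (PP a.1 v.1) ?addNr; lra.
- by rewrite (PP a.1 b.1) ?subrr; lra.
Qed.

Lemma cross_meets a b u v : cross a b u v != 0 ->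
  exists x, segment a b x /\ segment u v x.
Proof.
wlog ab : a b / a.1 <= b.1 => [H|].
  have [|/ltW] := leP a.1 b.1; first exact: H.
  by rewrite cross_antil oppr_eq0 segmentC; exact: H.
wlog uv : u v / u.1 <= v.1 => [H|].
  have [|/ltW] := leP u.1 v.1; first exact: H.
  by rewrite cross_antir oppr_eq0 (segmentC u); exact: H.
case: (eqVneq a.1 b.1) => [e|ne]; case: (eqVneq u.1 v.1) => [e'|ne'].
- by rewrite /cross /under /over /slabl /slabr e e' !subrr !mul0r !subrr addr0 eqxx.
- have uv' : u.1 < v.1 by rewrite lt_neqAle ne'.
  rewrite /cross /under /slabl e !subrr !mul0r !subrr add0r !over_lt // -e => c.
  have h : u.1 <= a.1 <= v.1.
    by move: c; case: (ltP u.1 a.1) => h1; case: (leP a.1 v.1) => h2;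
      rewrite /= ?subrr ?eqxx //; lra.
  exists (a.1, yline u v a.1); split; last exact: segment_yline.
  move: c; case: (ltP (yline u v a.1) a.2) => h1;
    case: (ltP (yline u v a.1) b.2) => h2; rewrite ?subrr ?andbF ?subrr ?eqxx // => _.
    by rewrite segmentC [X in (X, _)]e; apply: segment_vert => //; lra.
  by apply: segment_vert => //; lra.
- have ab' : a.1 < b.1 by rewrite lt_neqAle ne.
  rewrite /cross /over /slabr e' !subrr !mul0r !subrr addr0 !under_lt // -e' => c.
  have h : a.1 <= u.1 <= b.1.
    by move: c; case: (leP a.1 u.1) => h1; case: (ltP u.1 b.1) => h2;
      rewrite /= ?subrr ?eqxx //; lra.
  exists (u.1, yline a b u.1); split; first exact: segment_yline.
  move: c; case: (ltP u.2 (yline a b u.1)) => h1;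
    case: (ltP v.2 (yline a b u.1)) => h2; rewrite ?subrr ?andbF ?subrr ?eqxx // => _.
    by apply: segment_vert => //; lra.
  by rewrite segmentC [X in (X, _)]e'; apply: segment_vert => //; lra.
- by apply: cross_meets_lt; rewrite lt_neqAle ?ne ?ne'.
Qed.

Lemma convex_between (k l t : R) : 0 <= t <= 1 ->
  (k <= k + t * (l - k) <= l) || (l <= k + t * (l - k) <= k).
Proof.
move=> /andP[t0 t1]; have [h|/ltW h] := leP k l; apply/orP; [left|right];
  by apply/andP; split; nra.
Qed.

Lemma convex_sbetween (k l t : R) : 0 < t < 1 -> k != l ->
  (k < k + t * (l - k) < l) || (l < k + t * (l - k) < k).
Proof.
move=> /andP[t0 t1]; case: (ltgtP k l) => // h _; apply/orP; [left|right];
  by apply/andP; split; nra.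
Qed.

(** Each segment separates the endpoints of the other one; exactly one of the four
    vertical rays then counts. *)
Lemma cross_right_left a b u v :
  orient u v a < 0 -> 0 < orient u v b -> 
  (exists2 x, segment a b x & open_segment u v x) -> cross a b u v = -1.
Proof.
move=> Da Db [x [t /= /andP[t0 t1] xt] [r /= /andP[r0 r1] xr]].
have x1 : x.1 = a.1 + t * (b.1 - a.1) by rewrite -xt.
have x2 : x.2 = a.2 + t * (b.2 - a.2) by rewrite -xt.
have y1 : x.1 = u.1 + r * (v.1 - u.1) by rewrite -xr.
have y2 : x.2 = u.2 + r * (v.2 - u.2) by rewrite -xr.
have e1 : u.1 - a.1 = t * (b.1 - a.1) - r * (v.1 - u.1) by lra.
have e2 : u.2 - a.2 = t * (b.2 - a.2) - r * (v.2 - u.2) by lra.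
have e3 : v.1 - a.1 = t * (b.1 - a.1) + (1 - r) * (v.1 - u.1) by lra.
have e4 : v.2 - a.2 = t * (b.2 - a.2) + (1 - r) * (v.2 - u.2) by lra.
have Eu : orient a b u = r * (orient u v b - orient u v a).
  rewrite (orientE a) e1 e2 !orientE; ring.
have Ev : orient a b v = (r - 1) * (orient u v b - orient u v a).
  rewrite (orientE a) e3 e4 !orientE; ring.
have Duv : 0 < orient u v b - orient u v a by lra.
have Du : 0 < orient a b u by rewrite Eu mulr_gt0.
have Dv : orient a b v < 0 by rewrite Ev nmulr_rlt0 //; lra.
have [Fu Fv Fa Fb] : [/\ (orient a b u < 0) = false, (0 < orient a b v) = false,
    (0 < orient u v a) = false & (orient u v b < 0) = false].
  by split; exact: lt_gtF.
have hab : (a.1 <= x.1 <= b.1) || (b.1 <= x.1 <= a.1).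
  by rewrite x1 convex_between // t0 t1.
have huv : [|| u.1 < x.1 < v.1, v.1 < x.1 < u.1 |
    [&& u.1 == v.1, x.1 == u.1, a.1 != u.1 & b.1 != u.1]].
  rewrite y1; have [h|h] := eqVneq u.1 v.1; last first.
    by have /orP[->|->] := convex_sbetween (introT andP (conj r0 r1)) h; rewrite ?orbT.
  apply/orP; right; apply/orP; right; rewrite -h subrr mulr0 addr0 !eqxx /=.
  by apply/andP; split; [apply: contraTneq Da|apply: contraTneq Db] => k;
    rewrite orientE -h k !subrr mul0r mulr0 subrr ltxx.
have sl t' : slabr u v t' = (~~ (t' <= u.1))%:R - (~~ (t' <= v.1))%:R.
  by rewrite /slabr !ltNge.
rewrite /cross /under /over !sl /slabl.
case: (leP a.1 u.1) => h1; case: (leP b.1 u.1) => h2; case: (leP a.1 v.1) => h3;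
  case: (leP b.1 v.1) => h4 /=;
  rewrite ?(subrr, subr0, sub0r, mul0r, mul1r, mulN1r, oppr_lt0, oppr_gt0, Du, Dv,
    Da, Db, Fu, Fv, Fa, Fb, oppr0, addr0, opprK) //=.
all: exfalso; move: hab huv; lra.
Qed.

End CrossingMeets.

(** * Convexity, genericity and connectedness in the plane *)

Section PlaneTopology.
Variable R : realType.
Implicit Types (a b c d o u v x y z : plane R) (k r s t e : R).

Lemma ball_planeE x e y : ball x e y <-> `|x.1 - y.1| < e /\ `|x.2 - y.2| < e.
Proof. by []. Qed.

Definition convexset (K : set (plane R)) :=
  forall a b, K a -> K b -> segment a b `<=` K.

Lemma convex_ball x e : convexset (ball x e).
Proof.
move=> a b /ball_planeE[a1 a2] /ball_planeE[b1 b2] y [t /= /andP[t0 t1] <-].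
move: a1 a2 b1 b2; rewrite !ltr_norml => /andP[? ?] /andP[? ?] /andP[? ?] /andP[? ?].
have t01 : 0 <= t <= 1 by rewrite t0.
have := convex_between a.1 b.1 t01; have := convex_between a.2 b.2 t01.
move=> H1 H2; apply/ball_planeE; rewrite !coordE !ltr_norml; move: H1 H2.
by case/orP=> /andP[? ?]; case/orP=> /andP[? ?]; split; apply/andP; split; lra.
Qed.

Lemma convexsetI (K L : set (plane R)) :
  convexset K -> convexset L -> convexset (K `&` L).
Proof. by move=> hK hL a b [? ?] [? ?] x ax; split; [exact: (hK a b)|exact: (hL a b)]. Qed.

Lemma orient_affine u v a b t :
  orient u v (a + t *: (b - a)) = orient u v a + t * (orient u v b - orient u v a).
Proof. rewrite !orientE !coordE; ring. Qed.

Lemma convex_left u v : convexset [set x | 0 < orient u v x].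
Proof.
move=> a b /= a0 b0 y [t /= /andP[t0 t1] <-] /=; rewrite orient_affine.
by have := convex_between (orient u v a) (orient u v b) (introT andP (conj t0 t1)); lra.
Qed.

Lemma segmentl a b : segment a b a.
Proof. by exists 0; rewrite /= ?lexx ?ler01 // scale0r addr0. Qed.

Lemma segmentr a b : segment a b b.
Proof. by rewrite segmentC; exact: segmentl. Qed.

Lemma open_segmentW a b : open_segment a b `<=` segment a b.
Proof. by move=> x [t /= /andP[t0 t1] <-]; exists t => //=; rewrite !ltW. Qed.

Lemma line_continuous a d : continuous (fun t : R => a + t *: d).
Proof.
move=> t; apply: cvgD; first exact: cvg_cst.
by apply: cvgZr_tmp; exact: cvg_id.
Qed.

Lemma convex_connected (K : set (plane R)) : convexset K -> connected K.
Proof.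
move=> cK; have [->|/set0P[a Ka]] := eqVneq K set0; first exact: connected0.
have -> : K = \bigcup_(b in K) segment a b.
  apply/seteqP; split=> [b Kb|x [b Kb]]; first by exists b => //; exact: segmentr.
  exact: cK.
apply: bigcup_connected; first by exists a => b _; exact: segmentl.
move=> b _; have -> : segment a b = (fun t : R => a + t *: (b - a)) @` `[0, 1].
  by rewrite /segment; congr image; apply/seteqP; split=> t /=; rewrite in_itv.
apply: connected_continuous_connected; first exact: segment_connected.
apply: continuous_subspaceT; exact: line_continuous.
Qed.

(** A countable set has Lebesgue measure zero, an interval has not. *)
Lemma avoid_countable (K : countType) (f : K -> R) (k l : R) :
  k < l -> exists2 x, k < x < l & forall i, f i <> x.
Proof.
move=> kl; apply: contrapT => N.
have /countable_lebesgue_measure0 : countable (`]k, l[%classic : set R).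
  apply: (@sub_countable _ _ _ (\bigcup_(i in [set: K]) [set f i])); last first.
    by apply: bigcup_countable => [|i _]; [exact: countableP|exact: countable1].
  apply: subset_card_le => x /= xkl; apply: contrapT => M; apply: N.
  exists x; first by move: xkl; rewrite in_itv.
  by move=> i fi; apply: M; exists i.
rewrite lebesgue_measure_itv /= lte_fin kl -EFinB => /eqP.
by rewrite eqe subr_eq0 gt_eqF.
Qed.

(** First choose an abscissa that avoids the vertical lines, then an ordinate that
    avoids the points where the other lines meet that vertical. *)
Lemma avoid_lines (K : countType) (n : K -> plane R) (c : K -> R) x e :
  (forall i, n i <> 0) -> 0 < e ->
  exists2 y, ball x e y & forall i, dotp (n i) y <> c i.
Proof.
move=> n0 e0.
have [x1 /andP[l1 h1] N1] := @avoid_countable K (fun i => c i / (n i).1)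
  (x.1 - e) (x.1 + e) ltac:(lra).
have [x2 /andP[l2 h2] N2] := @avoid_countable K 
  (fun i => (c i - (n i).1 * x1) / (n i).2) (x.2 - e) (x.2 + e) ltac:(lra).
exists (x1, x2).
  by apply/ball_planeE; rewrite /= !ltr_norml; split; apply/andP; split; lra.
move=> i; rewrite /dotp /= => E.
have [z2|nz2] := eqVneq (n i).2 0.
  have [z1|nz1] := eqVneq (n i).1 0.
    by apply: (n0 i); apply: eq_plane.
  by apply: (N1 i); rewrite -E z2 mul0r addr0; field.
by apply: (N2 i); rewrite -E; field.
Qed.

(** Induction along a connected open set of parameters: a transitive relation that
    holds locally between good parameters holds globally, provided that bad
    parameters are isolated. *)
Lemma local_to_global (I G : set R) (Q : R -> R -> Prop) : open I -> connected I ->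
  (forall r s t, G r -> G s -> G t -> Q r s -> Q s t -> Q r t) ->
  (forall t, I t -> \forall t' \near t, t' != t -> G t') ->
  (forall t, I t -> exists2 O, nbhs t O &
     forall t' t'', O t' -> O t'' -> G t' -> G t'' -> Q t' t'') ->
  forall k l, I k -> G k -> I l -> G l -> Q k l.
Proof.
move=> oI cI tr dG lQ k l Ik Gk Il Gl.
pose B := [set t | I t /\ \forall t' \near t, G t' -> Q k t'].
suff : B = I.
  move=> BI; have Bl : B l by rewrite BI.
  by case: Bl => _ /nbhs_singleton; apply.
apply: cI.
- exists k; split=> //; have [N Nk h] := lQ _ Ik; have k0 := nbhs_singleton Nk.
  by apply: filterS Nk => t' Ot' Gt'; apply: h.
- exists B; last by apply/seteqP; split => [t [? ?]|t [? []]].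
  move=> t [It ht]; near=> s; split; first by near: s; exact: open_nbhs_nbhs.
  by near: s; exact: (@nbhs_interior _ t [set t' | G t' -> Q k t']).
- exists (closure B); first exact: closed_closure.
  apply/seteqP; split=> [t bt|t [It clt]].
    by split; [case: bt|exact: subset_closure].
  split=> //; have [N Nt hO] := lQ _ It.
  have [s [[Is hs] Os]] := clt _ (nbhs_interior Nt).
  (* a good parameter s' close to s links k to the good parameters near t *)
  have [s' [s'1 [s'2 s'3]]] : exists s', Q k s' /\ N s' /\ G s'.
    have hG : s^' G by exact: dG.
    have hs' : s^' [set t' | G t' -> Q k t'] by apply: filterS hs.
    have hN : s^' N by apply: filterS Os.
    have [s' [Gs' [Qs' Ns']]] := filter_ex (filterI hG (filterI hs' hN)).
    by exists s'; split; [exact: Qs'|].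
  by apply: filterS Nt => t' Ot' Gt'; apply: (tr _ s') => //; exact: hO.
Unshelve. all: by end_near. Qed.

End PlaneTopology.

Section SegmentTopology.
Variable R : realType.
Implicit Types (a b c d o u v x y z : plane R) (k r s t e : R).

Lemma dotp_continuous (n : plane R) : continuous (dotp n).
Proof.
move=> x; apply: cvgD; (apply: cvgM; first exact: cvg_cst).
  exact: cvg_fst.
exact: cvg_snd.
Qed.

Lemma closed_segment a b : closed (segment a b).
Proof.
apply: compact_closed; first exact: norm_hausdorff.
have -> : segment a b = (fun t : R => a + t *: (b - a)) @` `[0, 1].
  by rewrite /segment; congr image; apply/seteqP; split=> t /=; rewrite in_itv.
apply: continuous_compact; last exact: segment_compact.
apply: continuous_subspaceT; exact: line_continuous.
Qed.

End SegmentTopology.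

Section Pairs.
Variable T : Type.
Implicit Types a b c d : T.

Lemma set2_eq a b c d : [set a; b] = [set c; d] ->
  (a = c /\ b = d) \/ (a = d /\ b = c).
Proof.
move=> E.
have : [set c; d] a by rewrite -E; left.
have : [set c; d] b by rewrite -E; right.
have : [set a; b] c by rewrite E; left.
have : [set a; b] d by rewrite E; right.
move=> [] h1 [] h2 [] h3 [] h4; rewrite /= in h1 h2 h3 h4; subst; auto.
Qed.

Lemma set2C a b : [set a; b] = [set b; a].
Proof. by rewrite setUC. Qed.

End Pairs.

(** * Edges and vertices of a framework *)

Section Framework.
Variables (R : realType) (V : choiceType) (Gamma : zmodType).
Variable F : periodic_framework R V Gamma.
Variable D : fundamental_data F.

Local Notation adj := (fw_adj F).
Local Notation act := (fw_act F).
Local Notation p := (fw_p F).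

(** Index set of the unoriented edges, each counted once: an edge orbit and the
    translation that carries its chosen representative to the edge. The chosen
    orientation of the representatives orients every edge. *)
Definition edge_id := ('I_(fd_m D) * Gamma)%type.
Implicit Types (i j : edge_id) (u v w : V) (g : Gamma) (x y z q : plane R).

Definition src i : V := act i.2 (fd_rep (fd_src i.1)).
Definition tgt i : V := act i.2 (fd_end i.1).
Definition Seg i : set (plane R) := segment (p (src i)) (p (tgt i)).

Lemma actK g : cancel (act g) (act (- g)).
Proof. by move=> v; rewrite -fw_actD addNr fw_act0. Qed.

Lemma act_eq g h v : act g v = act h v -> g = h.
Proof.
move=> E; apply/eqP; rewrite -subr_eq0; apply: contraT => ne.
apply: contra_notT (@fw_no_fixed_vertex _ _ _ F (g - h) v ne) => _.
by rewrite addrC fw_actD E actK.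
Qed.

Lemma act_pair g u v : act g @` [set u; v] = [set act g u; act g v].
Proof. by rewrite image_setU !image_set1. Qed.

Lemma adj_src_tgt i : adj (src i) (tgt i).
Proof. rewrite /src /tgt fw_act_adj; exact: fd_edge_adj. Qed.

(** The edge determines its orbit, and then the translation, since only the identity maps
    an edge to itself. *)
Lemma edge_set_inj i j : [set src i; tgt i] = [set src j; tgt j] -> i = j.
Proof.
case: i j => b g [b' g'] E.
have ed : edges F [set src (b, g); tgt (b, g)].
  by exists (src (b, g)), (tgt (b, g)); split=> //; exact: adj_src_tgt.
have [b0 [_ b0U]] := @fd_edgeP _ _ _ _ D _ ed.
have eb : b = b'.
  have e1 : b0 = b by apply: b0U; exists g; rewrite act_pair.
  have e2 : b0 = b' by apply: b0U; exists g'; rewrite E act_pair.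
  by rewrite -e1 -e2.
rewrite -eb in E *; congr (_, _).
apply/eqP; rewrite -subr_eq0; apply: contraT => ne.
case: (fw_no_fixed_edge ne (@fd_edge_adj _ _ _ _ D b)).
have /(congr1 (fun A => act (- g') @` A)) := E.
by rewrite !act_pair /src /tgt /= -!fw_actD !(addrC (- g')) subrr !fw_act0 add0r; exact.
Qed.

Lemma edge_index u v : adj u v ->
  exists i, (src i = u /\ tgt i = v) \/ (src i = v /\ tgt i = u).
Proof.
move=> uv; have ed : edges F [set u; v] by exists u, v.
have [b [[g E] _]] := @fd_edgeP _ _ _ _ D _ ed.
by exists (b, g); apply: set2_eq; rewrite E act_pair.
Qed.

Lemma adj_neq u v : adj u v -> u <> v.
Proof. by move=> uv e; move: uv; rewrite e fw_irrefl. Qed.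

Lemma adj_exists u : exists v, adj u v.
Proof.
have [v vu] : exists v, v <> u.
  apply: contrapT => N; apply: (@fw_infinite _ _ _ F).
  have -> : [set: V] = [set u]; last exact: finite_set1.
  apply/seteqP; split=> v //= _; apply: contrapT => h; apply: N; by exists v.
have [[|w s] [/= h1 h2]] := fw_connected F u v; first by case: vu.
by exists w; case/andP: h1.
Qed.

Lemma skeletonE x : skeleton F x <-> exists i, Seg i x.
Proof.
split=> [[[v ->]|[u [v [uv sx]]]]|[i ix]].
- have [w /edge_index[i [[<- _]|[_ <-]]]] := adj_exists v; exists i.
    exact: segmentl.
  exact: segmentr.
- have [i [[e1 e2]|[e1 e2]]] := edge_index uv; exists i; rewrite /Seg e1 e2 //.
  by rewrite segmentC.
- by right; exists (src i), (tgt i); split=> //; exact: adj_src_tgt.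
Qed.

Lemma vertex_skeleton v : skeleton F (p v).
Proof. by left; exists v. Qed.

Section NonCrossing.
Hypothesis NC : noncrossing F.

Lemma Seg_meet i j x : i <> j -> Seg i x -> Seg j x ->
  x = p (src i) \/ x = p (tgt i).
Proof.
move=> ij ix jx.
have := NC (adj_src_tgt i) (adj_src_tgt j) (fun E => ij (edge_set_inj E)).
move=> /seteqP[/(_ x (conj ix jx)) [w [[->|->] _] <-] _]; by [left|right].
Qed.

(** Two vertices at the same point would have incident edges that meet at a point
    which is not a common endpoint. *)
Lemma p_inj : injective p.
Proof.
move=> u u' E; have [//|/eqP ne] := eqVneq u u'.
have [v uv] := adj_exists u; have [v' uv'] := adj_exists u'.
have [e|ne2] := pselect ([set u; v] = [set u'; v']).
  case: (set2_eq e) => [[]//|[e1 e2]].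
  by case: (fw_edge_nondeg uv); rewrite E e2.
have /seteqP[+ _] := NC uv uv' ne2.
move=> /(_ (p u)) []; first by split; [|rewrite E]; exact: segmentl.
move=> w [[->|->] []//= e] e2.
- by case: (fw_edge_nondeg uv'); rewrite -E -e.
- by case: (fw_edge_nondeg uv); rewrite e2.
- by case: (fw_edge_nondeg uv); rewrite e2.
Qed.

Lemma open_edge_not_vertex u v x w : adj u v -> open_segment (p u) (p v) x ->
  x <> p w.
Proof.
move=> uv ox xw.
have N u' v' : adj u' v' -> open_segment (p u') (p v') x -> x <> p u'.
  move=> uv' [t /= /andP[t0 t1] <-] /eqP; rewrite -subr_eq0 addrAC subrr add0r.
  rewrite scaler_eq0 gt_eqF //= subr_eq0 => /eqP e.
  by case: (fw_edge_nondeg uv').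
have ox' : open_segment (p v) (p u) x.
  move: ox => [t /= /andP[t0 t1] <-]; exists (1 - t); first by apply/andP; split; lra.
  by apply: eq_plane; rewrite !coordE; ring.
have n1 := N _ _ uv ox; have n2 : x <> p v by apply: N ox'; rewrite fw_sym.
have [w' ww'] := adj_exists w.
have [e|ne] := pselect ([set u; v] = [set w; w']).
  by case: (set2_eq e) => [[e1 _]|[_ e1]]; [apply: n1; rewrite e1|apply: n2; rewrite e1].
have /seteqP[+ _] := NC uv ww' ne.
move=> /(_ x) []; first by split; [exact: open_segmentW|rewrite xw; exact: segmentl].
by move=> z [[->|->] _] e; [apply: n1|apply: n2].
Qed.

End NonCrossing.

End Framework.

(** * Lattice coordinates and local finiteness *)

Section Coordinates.
Variables (R : realType) (V : choiceType) (Gamma : zmodType).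
Variable F : periodic_framework R V Gamma.
Variable D : fundamental_data F.
Variables h1 h2 : Gamma.
Hypothesis hB : is_Z2_basis h1 h2.

Local Notation p := (fw_p F).
Local Notation pi := (fw_pi F).
Local Notation Seg := (@Seg R V Gamma F D).
Local Notation src := (@src R V Gamma F D).
Local Notation tgt := (@tgt R V Gamma F D).
Local Notation edge_id := (edge_id D).

Implicit Types (a b c q x y z : plane R) (e k r s t : R) (i j : edge_id) (v w : V).
Implicit Types (m n : int) (g : Gamma).

Definition area : R := det (pi h1) (pi h2).

Definition latt m n : Gamma := h1 *~ m + h2 *~ n.

Lemma lattP g : exists m n, g = latt m n.
Proof. by have [f _ fK] := hB; exists (f g).1, (f g).2; rewrite /latt fK. Qed.

Lemma latt_inj m n m' n' : latt m n = latt m' n' -> m = m' /\ n = n'.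
Proof.
have [f fK _] := hB => E.
by have /(_ (m, n) (m', n') E)[-> ->] := can_inj fK.
Qed.

Lemma pi_latt m n : pi (latt m n) = m%:~R *: pi h1 + n%:~R *: pi h2.
Proof. by rewrite /latt raddfD /= !raddfMz !scaler_int. Qed.

(** The two generators and a basis of the lattice generate the same group, so one
    determinant is an integer multiple of the other. *)
Lemma area_neq0 : area != 0.
Proof.
have [a [b [ab E]]] := fw_lattice F.
have pre c : range pi c -> exists m n, c = m%:~R *: pi h1 + n%:~R *: pi h2.
  by move=> [g _ <-]; have [m [n ->]] := lattP g; exists m, n; exact: pi_latt.
have [|m [n ea]] := pre a.
  by rewrite E; exists (1, 0); rewrite //= mulr1z mulr0z addr0.
have [|m' [n' eb]] := pre b.
  by rewrite E; exists (0, 1); rewrite //= mulr1z mulr0z add0r.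
apply: contraNneq ab => A0; apply/eqP.
transitivity ((m%:~R * n'%:~R - n%:~R * m'%:~R) * area); last by rewrite A0 mulr0.
by rewrite ea eb /area /det !coordE; ring.
Qed.

(** Coordinates in the basis formed by the images of the generators; translations by
    the group become translations by integer vectors. *)
Definition phi q : plane R := (det q (pi h2) / area, det (pi h1) q / area).

Lemma phiD a b : phi (a + b) = phi a + phi b.
Proof. by apply: eq_plane; rewrite /phi /det !coordE /=; ring. Qed.

Lemma phiB a b : phi (a - b) = phi a - phi b.
Proof. by apply: eq_plane; rewrite /phi /det !coordE /=; ring. Qed.

Lemma phiZ t a : phi (t *: a) = t *: phi a.
Proof. by apply: eq_plane; rewrite /phi /det !coordE /=; ring. Qed.

Lemma phi_line a t d : phi (a + t *: d) = phi a + t *: phi d.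
Proof. by rewrite phiD phiZ. Qed.

Lemma phi_det a b : det a b = area * det (phi a) (phi b).
Proof.
have A := area_neq0.
rewrite /phi /det /=; rewrite /area /det in A *; field; exact: A.
Qed.

Lemma phi_orient a b c : orient a b c = area * orient (phi a) (phi b) (phi c).
Proof. by rewrite /orient phi_det !phiB. Qed.

Lemma phiK q : (phi q).1 *: pi h1 + (phi q).2 *: pi h2 = q.
Proof.
have A := area_neq0.
by apply: eq_plane; rewrite !coordE /phi /det /=; rewrite /area /det in A *; field; exact: A.
Qed.

Lemma phi_inj : injective phi.
Proof. by move=> a b e; rewrite -(phiK a) e phiK. Qed.

Lemma phi_latt m n : phi (pi (latt m n)) = (m%:~R, n%:~R).
Proof.
have A := area_neq0.
by apply: eq_plane; rewrite pi_latt /phi /det !coordE /=;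
  rewrite /area /det in A *; field; exact: A.
Qed.

Lemma cross_phi_meets a b c d :
  cross (phi a) (phi b) (phi c) (phi d) != 0 ->
  exists x, segment a b x /\ segment c d x.
Proof.
move=> /cross_meets[y [[t t01 ty] [s s01 sy]]].
exists (a + t *: (b - a)); split; first by exists t.
by exists s => //; apply: phi_inj; rewrite !phi_line !phiB ty sy.
Qed.

Lemma near_phi q e : 0 < e -> \forall y \near q,
  `|(phi y).1 - (phi q).1| <= e /\ `|(phi y).2 - (phi q).2| <= e.
Proof.
move=> e0.
have L (n : plane R) (f : plane R -> R) : (forall y, f y = dotp n y) ->
    \forall y \near q, `|f y - f q| <= e.
  move=> fE; have /cvgrPdist_le := @dotp_continuous R n q.
  move=> /(_ e e0); apply: filterS => y; by rewrite !fE distrC.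
apply: filterI.
- apply: (L ((pi h2).2 / area, - (pi h2).1 / area) (fun y => (phi y).1)) => y.
  by rewrite /phi /det /dotp /=; ring.
- apply: (L (- (pi h1).2 / area, (pi h1).1 / area) (fun y => (phi y).2)) => y.
  by rewrite /phi /det /dotp /=; ring.
Qed.

Lemma src_latt (b : 'I_(fd_m D)) m n : p (src (b, latt m n)) = p (fd_rep (fd_src b)) + pi (latt m n).
Proof. exact: fw_equivariant. Qed.

Lemma tgt_latt (b : 'I_(fd_m D)) m n : p (tgt (b, latt m n)) = p (fd_end b) + pi (latt m n).
Proof. exact: fw_equivariant. Qed.

Lemma Seg_latt (b : 'I_(fd_m D)) m n y : Seg (b, latt m n) y ->
  segment (p (fd_rep (fd_src b))) (p (fd_end b)) (y - pi (latt m n)).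
Proof.
move=> [t t01 <-]; exists t => //.
by rewrite src_latt tgt_latt; apply: eq_plane; rewrite !coordE; ring.
Qed.

Definition in_box (M : R) y := `|(phi y).1| <= M /\ `|(phi y).2| <= M.

(** In lattice coordinates, an edge is an integer translate of one of finitely many
    segments, so a bounded region bounds the translation. *)
Lemma Seg_box (M : R) : exists N : nat, forall (b : 'I_(fd_m D)) m n y,
  Seg (b, latt m n) y -> in_box M y -> (`|m| <= N)%N /\ (`|n| <= N)%N.
Proof.
pose f (b : 'I_(fd_m D)) : R :=
  `|(phi (p (fd_rep (fd_src b)))).1| + `|(phi (p (fd_rep (fd_src b)))).2| +
  (`|(phi (p (fd_end b))).1| + `|(phi (p (fd_end b))).2|).
pose K := \sum_b f b.
have fK (b : 'I_(fd_m D)) : f b <= K.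
  rewrite /K (bigD1 b) //= lerDl sumr_ge0 // => b' _; rewrite /f !addr_ge0 //.
exists (Num.trunc (M + K)).+1 => b m n y /Seg_latt[t /= t01 ty] [y1 y2].
have {}ty : y = p (fd_rep (fd_src b)) + t *: (p (fd_end b) - p (fd_rep (fd_src b)))
    + pi (latt m n) by rewrite ty subrK.
have := fK b; rewrite /f => fb.
have n0 := normr_ge0; rewrite ty phiD phi_latt phi_line phiB !coordE /= in y1 y2.
have := convex_between (phi (p (fd_rep (fd_src b)))).1 (phi (p (fd_end b))).1 t01.
have := convex_between (phi (p (fd_rep (fd_src b)))).2 (phi (p (fd_end b))).2 t01.
move: y1 y2 fb.
set x1 := _.1; set x2 := (phi (p (fd_end b))).1.
set x3 := (phi (p (fd_rep (fd_src b)))).2; set x4 := (phi (p (fd_end b))).2.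
set z1 := x1 + _; set z2 := x3 + _ => y1 y2 fb b2 b1.
have key (z x x' k : R) (l : int) : `|z + l%:~R| <= M -> `|x| + `|x'| <= K ->
    (x <= z <= x') || (x' <= z <= x) -> (`|l| <= (Num.trunc (M + K)).+1)%N.
  move=> h1' h2' h3'.
  have : `|l%:~R : R| <= M + K.
    move: h1' h2' h3'; rewrite !ler_norml.
    have := ler_norm x; have := ler_norm x'; have := ler_norm (- x); have := ler_norm (- x').
    rewrite !normrN; lra.
  rewrite -intr_norm -natr_absz => h.
  have h0 : 0 <= M + K by apply: le_trans h.
  rewrite -(ler_nat R); apply: (le_trans h); apply/ltW.
  exact: truncnS_gt.
have := n0 _ _ x1; have := n0 _ _ x2; have := n0 _ _ x3; have := n0 _ _ x4 => a1 a2 a3 a4.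
split; [apply: (key z1 x1 x2)|apply: (key z2 x3 x4)] => //; lra.
Qed.

Definition touching (M : R) : set edge_id := [set i | exists2 y, Seg i y & in_box M y].

Lemma touching_finite M : finite_set (touching M).
Proof.
have [N hN] := Seg_box M.
pose f (c : 'I_(fd_m D) * ('I_(N.*2.+1) * 'I_(N.*2.+1))) : edge_id :=
  (c.1, latt (c.2.1%:Z - N%:Z) (c.2.2%:Z - N%:Z)).
apply: (@sub_finite_set _ _ (range f)); last exact: finite_image.
move=> [b g] [y by_ bx]; have [m [n gE]] := lattP g; rewrite gE in by_ *.
have [h h'] := hN _ _ _ _ by_ bx.
have B (l : int) : (`|l| <= N)%N -> (absz (l + N%:Z)%R < N.*2.+1)%N /\ (0 <= l + N%:Z)%R by lia.
have [u1 u2] := B _ h; have [w1 w2] := B _ h'.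
exists (b, (Ordinal u1, Ordinal w1)) => //.
by rewrite /f /= !gez0_abs // !addrK.
Qed.

Lemma vertices_finite M : finite_set [set v | in_box M (p v)].
Proof.
have T := touching_finite M.
apply: (@sub_finite_set _ _ (src @` touching M `|` tgt @` touching M)); last first.
  by rewrite finite_setU; split; exact: finite_image.
move=> v bv; have [w vw] := adj_exists F v.
by have [i [[e _]|[_ e]]] := edge_index D vw; [left|right]; exists i => //;
  exists (p v) => //; rewrite /Seg e; [exact: segmentl|exact: segmentr].
Qed.

Lemma near_box q : exists2 M, 0 < M & \forall y \near q, in_box M y.
Proof.
have a0 := normr_ge0 (phi q).1; have b0 := normr_ge0 (phi q).2.
exists (`|(phi q).1| + `|(phi q).2| + 1); first lra.
apply: filterS (near_phi q ltr01) => y [y1 y2]; split.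
- have := ler_normD ((phi y).1 - (phi q).1) (phi q).1; rewrite subrK; lra.
- have := ler_normD ((phi y).2 - (phi q).2) (phi q).2; rewrite subrK; lra.
Qed.

(** Only finitely many edges come near q, and each is closed. *)
Lemma near_Seg q : \forall y \near q, forall i, Seg i y -> Seg i q.
Proof.
have [M M0 hM] := near_box q.
have N i : \forall y \near q, Seg i y -> Seg i q.
  have [qi|nqi] := pselect (Seg i q); first by near=> y.
  have : open (~` Seg i) by rewrite openC; exact: closed_segment.
  by rewrite openE => /(_ _ nqi); apply: filterS.
have H : \forall y \near q,
    (\bigcap_(i in [set` fset_set (touching M)]) [set y | Seg i y -> Seg i q]) y.
  by apply: filter_bigI => i _; exact: N.
near=> y => i iy.
have by_ : in_box M y by near: y.
have : (\bigcap_(i in [set` fset_set (touching M)]) [set y | Seg i y -> Seg i q]) y.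
  by near: y.
move=> h; apply: (h i) => //=; rewrite in_fset_set; last exact: touching_finite.
by apply: mem_set; exists y.
Unshelve. all: by end_near. Qed.

Lemma open_off_skeleton : open (~` skeleton F).
Proof.
rewrite openE => q nq; apply: filterS (near_Seg q) => y h /(skeletonE D)[i iy].
by apply: nq; apply/(skeletonE D); exists i; exact: h.
Qed.

End Coordinates.

(** * Affine germs *)

Section Germs.
Variable R : realType.
Implicit Types (a b c d q u v x y z : plane R) (e s t : R) (H L : plane R -> R).

(** Affine functions are handled through their values at a free point z: one scalar
    identity for all z stands for the gradient and the constant term together. *)
Definition affine_fun L := exists n C, forall z, L z = dotp n z + C.

Definition germ H q L := affine_fun L /\ \forall y \near q, H y = L y.

Lemma affine_zero L q : affine_fun L -> (\forall y \near q, L y = 0) ->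
  forall z, L z = 0.
Proof.
move=> [n [C LE]] /nbhs_ballP[e /= e0 h].
have h0 : L q = 0 by apply: h; exact: ballxx.
have h1 : L (q.1 + e / 2, q.2) = 0.
  by apply: h; apply/ball_planeE; rewrite /= subrr normr0 opprD addNKr normrN gtr0_norm //; lra.
have h2 : L (q.1, q.2 + e / 2) = 0.
  by apply: h; apply/ball_planeE; rewrite /= subrr normr0 opprD addNKr normrN gtr0_norm //; lra.
move: h0 h1 h2; rewrite !LE /dotp /= => h0 h1 h2.
have n1 : n.1 * e = 0 by lra.
have n2 : n.2 * e = 0 by lra.
have e' : e != 0 by rewrite gt_eqF.
have {}n1 : n.1 = 0 by apply: (mulIf e'); rewrite n1 mul0r.
have {}n2 : n.2 = 0 by apply: (mulIf e'); rewrite n2 mul0r.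
move=> z; rewrite LE /dotp; move: h0; rewrite n1 n2; lra.
Qed.

Lemma affine_funB L L' : affine_fun L -> affine_fun L' -> affine_fun (fun z => L z - L' z).
Proof.
move=> [n [C E]] [n' [C' E']]; exists (n - n'), (C - C') => z.
rewrite E E' /dotp !coordE; ring.
Qed.

Lemma affine_funZ k L : affine_fun L -> affine_fun (fun z => k * L z).
Proof.
move=> [n [C E]]; exists (k *: n), (k * C) => z; rewrite E /dotp !coordE; ring.
Qed.

Lemma affine_orient a b : affine_fun (orient a b).
Proof.
exists (perp (b - a)), (- dotp (perp (b - a)) a) => z.
rewrite orientE /dotp /perp /= ?coordE; ring.
Qed.

Lemma line_cvg0 a d : (a + t *: d) @[t --> (0 : R)] --> a.
Proof.
have := @line_continuous R a d 0; rewrite /continuous_at.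
by rewrite scale0r addr0.
Qed.

Lemma germ_uniq H q L L' : germ H q L -> germ H q L' -> forall z, L z = L' z.
Proof.
move=> [aL hL] [aL' hL'] z; apply/eqP; rewrite -subr_eq0; apply/eqP.
apply: (@affine_zero _ q (affine_funB aL aL')).
by apply: filterS2 hL hL' => y <- <-; rewrite subrr.
Qed.

Lemma affine_continuous L : affine_fun L -> continuous L.
Proof.
move=> [n [C E]]; have -> : L = fun z => dotp n z + C by apply/funext.
by move=> z; apply: cvgD; [exact: dotp_continuous|exact: cvg_cst].
Qed.

Lemma orient_perp u v x t :
  orient u v (x + t *: perp (v - u)) = orient u v x + t * dotp (v - u) (v - u).
Proof. rewrite !orientE /dotp !coordE /perp /= ?coordE; ring. Qed.

Lemma dotp_gt0 a : a != 0 -> 0 < dotp a a.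
Proof.
move=> a0; rewrite /dotp -!expr2 lt_neqAle addr_ge0 ?sqr_ge0 // andbT eq_sym.
rewrite paddr_eq0 ?sqr_ge0 // !sqrf_eq0; apply: contra a0 => /andP[/eqP h /eqP k].
by apply/eqP; apply: eq_plane.
Qed.

Lemma orient_segment u v x : segment u v x -> orient u v x = 0.
Proof. by move=> [t _ <-]; rewrite orientE !coordE; ring. Qed.

End Germs.

(** * Faces on the two sides of an edge *)

Section Faces.
Variables (R : realType) (V : choiceType) (Gamma : zmodType).
Variable F : periodic_framework R V Gamma.
Variable D : fundamental_data F.
Hypothesis NC : noncrossing F.

Local Notation adj := (fw_adj F).
Local Notation p := (fw_p F).
Local Notation skel := (skeleton F).
Local Notation Seg := (@Seg R V Gamma F D).
Local Notation src := (@src R V Gamma F D).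
Local Notation tgt := (@tgt R V Gamma F D).

Implicit Types (a b c q x y z : plane R) (k r s t e : R) (u v w : V).
Implicit Types (W U K : set (plane R)) (H L : plane R -> R).

Lemma face_off W x : faces F W -> W x -> ~ skel x.
Proof. by move=> [q _ <-] /connected_component_sub. Qed.

Lemma face_exists x : ~ skel x -> exists2 W, faces F W & W x.
Proof.
move=> nx; exists (connected_component (~` skel) x); first by exists x.
exact: connected_component_refl.
Qed.

Lemma face_eq W U x : faces F W -> faces F U -> W x -> U x -> W = U.
Proof.
move=> [q _ <-] [q' _ <-] /same_connected_component -> /same_connected_component ->.
by [].
Qed.

(** A convex set off the skeleton is connected, hence inside one face. *)
Lemma face_sub K W x : convexset K -> K `<=` ~` skel -> faces F W ->
  K x -> W x -> K `<=` W.
Proof.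
move=> cK Ks [q _ <-] Kx /same_connected_component ->.
by apply: connected_component_max => //; exact: convex_connected.
Qed.

Lemma face_open W : faces F W -> open W.
Proof.
move=> fW; rewrite openE => x Wx.
have : nbhs x (~` skel).
  by apply: open_nbhs_nbhs; split; [apply: open_off_skeleton (fd_gens D)|exact: face_off Wx].
move=> /nbhs_ballP[e e0 h]; apply/nbhs_ballP; exists e => //.
by apply: (face_sub (x := x)) => //; [exact: convex_ball|exact: ballxx].
Qed.

Lemma face_germ W H n C x : faces F W -> affine_on H W n C -> W x ->
  germ H x (fun z => dotp n z + C).
Proof.
move=> fW aH Wx; split; first by exists n, C.
apply: filterS (open_nbhs_nbhs (conj (face_open fW) Wx)) => y; exact: aH.
Qed.

Lemma lifting_germ H x : is_lifting F H -> ~ skel x -> exists L, germ H x L.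
Proof.
move=> [_ aH] /face_exists[W fW Wx]; have [n [C h]] := aH _ fW.
by eexists; exact: (face_germ fW h Wx).
Qed.

Lemma near_edge u v x : adj u v -> open_segment (p u) (p v) x ->
  exists2 e, 0 < e & forall y i, ball x e y -> Seg i y ->
    [set src i; tgt i] = [set u; v].
Proof.
move=> uv ox; have /nbhs_ballP[e e0 h] := near_Seg D (fd_gens D) x.
exists e => // y i by_ /(h _ by_) ix.
have [k0 k0E] := edge_index D uv.
have E0 : [set src k0; tgt k0] = [set u; v].
  by case: k0E => [[-> ->]|[-> ->]] //; rewrite set2C.
have [->//|ne] := eqVneq i k0.
have k0x : Seg k0 x.
  by have := open_segmentW ox; rewrite /Seg; case: k0E => [[-> ->]|[-> ->]] //; rewrite segmentC.
have [e1|e1] := Seg_meet NC (elimN eqP ne) ix k0x;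
  by case: (open_edge_not_vertex NC uv ox e1).
Qed.

Lemma near_edge_skel u v x : adj u v -> open_segment (p u) (p v) x ->
  exists2 e, 0 < e & forall y, ball x e y -> skel y -> segment (p u) (p v) y.
Proof.
move=> uv ox; have [e e0 h] := near_edge uv ox; exists e => // y xy.
move=> /(skeletonE D)[i iy]; have := set2_eq (h _ _ xy iy).
by move=> [[<- <-]|[<- <-]] //; rewrite segmentC.
Qed.

Definition left_half u v x e : set (plane R) :=
  ball x e `&` [set y | 0 < orient (p u) (p v) y].

Lemma convex_left_half u v x e : convexset (left_half u v x e).
Proof. by apply: convexsetI; [exact: convex_ball|exact: convex_left]. Qed.

Lemma left_half_off u v x e : (forall y, ball x e y -> skel y -> segment (p u) (p v) y) ->
  left_half u v x e `<=` ~` skel.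
Proof.
move=> h y [xy oy] sy; have := orient_segment (h _ xy sy).
by move: oy => /=; lra.
Qed.

Lemma edge_vec_neq0 u v : adj u v -> p v - p u != 0.
Proof. by move=> uv; rewrite subr_eq0; apply/eqP => e; case: (fw_edge_nondeg uv). Qed.

Lemma near_left_half u v x e y : adj u v -> orient (p u) (p v) y = 0 -> ball x e y ->
  \forall t \near 0^'+, left_half u v x e (y + t *: perp (p v - p u)).
Proof.
move=> uv sy xy.
have P := dotp_gt0 (edge_vec_neq0 uv).
have : \forall t \near (0 : R), ball x e (y + t *: perp (p v - p u)).
  apply: line_cvg0; apply: open_nbhs_nbhs; split=> //; exact: ball_open.
move=> N.
have N' : \forall t \near (0 : R)^'+, ball x e (y + t *: perp (p v - p u)).
  by apply: filterS N.
near=> t; split; first by near: t; exact: N'.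
by rewrite /= orient_perp sy add0r mulr_gt0.
Unshelve. all: by end_near. Qed.

Lemma left_face_half W u v x e : adj u v -> left_face F W u v ->
  open_segment (p u) (p v) x -> 0 < e ->
  (forall y, ball x e y -> skel y -> segment (p u) (p v) y) ->
  left_half u v x e `<=` W.
Proof.
move=> uv [fW lW] ox e0 h.
have N := near_left_half uv (orient_segment (open_segmentW ox)) (ballxx x e0).
have [t [t1 t2]] := filter_ex (filterI N (lW _ ox)).
by apply: (face_sub (x := x + t *: perp (p v - p u))) => //;
  [exact: convex_left_half|exact: left_half_off].
Qed.

(** Near each interior point of the edge, a half disc to its left is off the skeleton
    and lies in one face; this face is locally constant along the edge. *)
Lemma left_face_exists u v : adj u v -> exists W, left_face F W u v.
Proof.
move=> uv.
pose x (t : R) := p u + t *: (p v - p u).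
pose lnear W (t : R) := \forall k \near 0^'+, W (x t + k *: perp (p v - p u)).
have loc (t : R) : 0 < t < 1 -> exists W (e : R), [/\ 0 < e, faces F W &
    forall t' : R, 0 < t' < 1 -> ball (x t) e (x t') -> lnear W t'].
  move=> t01; have ox : open_segment (p u) (p v) (x t) by exists t.
  have [e e0 h] := near_edge_skel uv ox.
  have [k hk] := filter_ex (near_left_half uv (orient_segment (open_segmentW ox)) (ballxx _ e0)).
  have [W fW Wk] := face_exists (left_half_off h hk).
  exists W, e; split=> // t' t'01 bt'.
  have ox' : open_segment (p u) (p v) (x t') by exists t'.
  apply: filterS (near_left_half uv (orient_segment (open_segmentW ox')) bt') => k'.
  by apply: (face_sub _ _ fW hk Wk); [exact: convex_left_half|exact: left_half_off].
have H01 : is_true (0 < 2^-1 :> R) /\ is_true (2^-1 < 1 :> R) by split; lra.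
have [W [e [e0 fW hW]]] := loc _ (introT andP H01).
exists W; split=> // y [t t01 <-].
pose Q (t t' : R) := forall W, faces F W -> lnear W t -> lnear W t'.
suff /(_ W fW) : Q 2^-1 t by apply; apply: hW; [exact: (introT andP H01)|exact: ballxx].
have oI : open (`]0, 1[%classic : set R) by exact: itv_open.
have I01 (r : R) : `]0, 1[%classic r = (0 < r < 1) :> Prop by rewrite /= in_itv.
have cI : connected (`]0, 1[%classic : set R).
  exact/connected_intervalP/interval_is_interval.
have tr r1 r2 r3 : setT r1 -> setT r2 -> setT r3 -> Q r1 r2 -> Q r2 r3 -> Q r1 r3.
  by move=> _ _ _ k1 k2 W' fW' /(k1 _ fW')/(k2 _ fW').
apply: (local_to_global oI cI tr _ _ _ I _ I); rewrite ?I01 //.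
- by move=> t' _; near=> t''.
- move=> t'; rewrite I01 => t'01; have [W' [e' [e'0 fW' hW']]] := loc _ t'01.
  exists ([set t | 0 < t < 1] `&` [set t | ball (x t') e' (x t)]).
  apply: filterI.
    have -> : [set t : R | 0 < t < 1] = `]0, 1[%classic by apply/seteqP; split=> r /=; rewrite in_itv.
    by apply: open_nbhs_nbhs; split => //; rewrite I01.
  have c := @line_continuous R (p u) (p v - p u) t'; apply: c.
  by apply: open_nbhs_nbhs; split; [exact: ball_open|exact: ballxx].
move=> r1 r2 [r101 b1] [r201 b2] _ _ W'' fW'' h.
have [k [k1 k2]] := filter_ex (filterI h (hW' _ r101 b1)).
by rewrite (face_eq fW'' fW' k1 k2); exact: hW'.
- exact: (introT andP H01).
Unshelve. all: by end_near. Qed.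

(** By continuity, the affine function of a face also gives the values of the lifting
    at boundary points reached from inside the face. *)
Lemma left_limit_value H W n C a x : continuous H -> affine_on H W n C ->
  (\forall t \near (0 : R)^'+, W (x + t *: a)) -> H x = dotp n x + C.
Proof.
move=> cH aH Wx.
have c0 : x + t *: a @[t --> (0 : R)^'+] --> x.
  by apply: cvg_within_filter; exact: line_cvg0.
have c1 : H (x + t *: a) @[t --> (0 : R)^'+] --> H x.
  by apply: continuous_cvg c0; exact: cH.
have c2 : H (x + t *: a) @[t --> (0 : R)^'+] --> dotp n x + C.
  have aL : affine_fun (fun z => dotp n z + C) by exists n, C.
  have c3 : dotp n (x + t *: a) + C @[t --> (0 : R)^'+] --> dotp n x + C.
    exact: (continuous_cvg (h := fun z => dotp n z + C) _ (affine_continuous aL (x := x)) c0).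
  apply: cvg_trans c3; apply: near_eq_cvg; apply: filterS Wx => t Wt /=.
  by rewrite aH.
apply: (cvg_unique _ c1 c2); exact: norm_hausdorff.
Qed.

Lemma left_face_value H W n C u v x : continuous H -> left_face F W u v ->
  affine_on H W n C -> open_segment (p u) (p v) x -> H x = dotp n x + C.
Proof. by move=> cH [fW lW] aH ox; exact: left_limit_value (lW _ ox). Qed.

Lemma mid_open u v : open_segment (p u) (p v) (p u + 2^-1 *: (p v - p u)).
Proof. by exists 2^-1 => //=; apply/andP; split; lra. Qed.

(** The constant terms of the two affine functions are related by the continuity of H
    at the midpoint of the edge, and their gradients by the definition of the stress. *)
Lemma edge_jump H (s : set V -> R) u v : is_lifting F H -> induced_stress F H s -> adj u v ->
  exists W U nW nU CW CU, [/\ left_face F W u v, left_face F U v u,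
    affine_on H W nW CW, affine_on H U nU CU &
    forall z, dotp nW z + CW - (dotp nU z + CU) =
      s [set u; v] * orient (p u) (p v) z].
Proof.
move=> [cH _] iH uv; have [W [U [nW [nU [CW [CU [lW lU aW aU E]]]]]]] := iH _ _ uv.
exists W, U, nW, nU, CW, CU; split=> // z.
have ox := mid_open u v.
have ox' : open_segment (p v) (p u) (p u + 2^-1 *: (p v - p u)).
  by exists 2^-1; [apply/andP; split; lra|apply: eq_plane; rewrite !coordE; field].
have := left_face_value cH lW aW ox.
rewrite (left_face_value cH lU aU ox').
have E1 : nW = nU + s [set u; v] *: perp (p v - p u) by rewrite -E addrC subrK.
rewrite E1 orientE /dotp /perp ?coordE /=; lra.
Qed.

End Faces.

(** * Sums with finite support *)

Section FiniteSums.
Variables (T : choiceType) (R : realType).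
Implicit Types (f g : T -> R) (A : set T).

Definition fin_supp f := finite_set [set i | f i != 0].

Lemma fin_suppW A f : finite_set A -> (forall i, f i != 0 -> A i) -> fin_supp f.
Proof. by move=> fA h; apply: sub_finite_set fA => i /h. Qed.

Lemma fsum_set A f : finite_set A -> (forall i, f i != 0 -> A i) ->
  \sum_(i \in setT) f i = \sum_(i \in A) f i.
Proof.
move=> fA h; symmetry; apply: fsbig_widen => //.
move=> i [_ nA] /=; apply/eqP; apply: contra_notT nA; exact: h.
Qed.

Lemma fsumD f g : fin_supp f -> fin_supp g ->
  \sum_(i \in setT) (f i + g i) = \sum_(i \in setT) f i + \sum_(i \in setT) g i.
Proof.
move=> ff fg; have fA : finite_set ([set i | f i != 0] `|` [set i | g i != 0]).
  by rewrite finite_setU.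
rewrite !(fsum_set fA) ?fsbig_split //= => i.
- by move=> h; right.
- by move=> h; left.
- by apply: contraNP => /not_orP[/negP/negPn/eqP -> /negP/negPn/eqP ->]; rewrite addr0.
Qed.

Lemma fsumZ k f : \sum_(i \in setT) (k * f i) = k * \sum_(i \in setT) f i.
Proof.
have [->|k0] := eqVneq k 0; first by rewrite mul0r fsbig1 // => i _; rewrite mul0r.
have [ff|nf] := pselect (fin_supp f).
  rewrite !(fsum_set ff) ?mulr_fsumr //= => i; by apply: contraNneq => ->; rewrite mulr0.
have N g : ~ fin_supp g -> \sum_(i \in setT) g i = 0.
  move=> ng; rewrite fsbig_dflt // setTI => h; apply: ng.
  by apply: sub_finite_set h => i /= /eqP.
rewrite (N f) // N ?mulr0 // => h; apply: nf; apply: sub_finite_set h => i /= fi.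
by rewrite mulf_neq0.
Qed.

Lemma fsumN f : \sum_(i \in setT) (- f i) = - \sum_(i \in setT) f i.
Proof. by rewrite -mulN1r -fsumZ; apply: eq_fsbigr => i _; rewrite mulN1r. Qed.

Lemma fsum1 i0 f : (forall i, i <> i0 -> f i = 0) -> \sum_(i \in setT) f i = f i0.
Proof.
move=> h; rewrite (@fsum_set [set i0]) ?fsbig_set1 // => i.
by apply: contra_neqP => /h.
Qed.

Lemma fin_suppM f g : fin_supp g -> fin_supp (fun i => f i * g i).
Proof.
by move=> fg; apply: fin_suppW fg _ => i /=; apply: contraNneq => ->; rewrite mulr0.
Qed.

Lemma fin_suppD f g : fin_supp f -> fin_supp g -> fin_supp (fun i => f i + g i).
Proof.
move=> ff fg; apply: (@fin_suppW ([set i | f i != 0] `|` [set i | g i != 0])).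
  by rewrite finite_setU.
by move=> i; apply: contraNP => /not_orP[/negP/negPn/eqP -> /negP/negPn/eqP ->]; rewrite addr0.
Qed.

Lemma fin_suppN f : fin_supp f -> fin_supp (fun i => - f i).
Proof. by move=> ff; apply: fin_suppW ff _ => i /=; rewrite oppr_eq0. Qed.

End FiniteSums.

(** * The crossing formula for liftings *)

Section CrossingSums.
Variables (R : realType) (V : choiceType) (Gamma : zmodType).
Variable F : periodic_framework R V Gamma.
Variable D : fundamental_data F.
Variables h1 h2 : Gamma.
Hypothesis hB : is_Z2_basis h1 h2.

Local Notation adj := (fw_adj F).
Local Notation p := (fw_p F).
Local Notation skel := (skeleton F).
Local Notation Seg := (@Seg R V Gamma F D).
Local Notation src := (@src R V Gamma F D).
Local Notation tgt := (@tgt R V Gamma F D).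
Local Notation edge_id := (edge_id D).
Local Notation phi := (@phi R V Gamma F h1 h2).
Local Notation area := (@area R V Gamma F h1 h2).

Implicit Types (a b c d q x y z : plane R) (k r t e : R) (u v w : V) (i j : edge_id).
Implicit Types (H L : plane R -> R) (s : set V -> R).

(** Crossing number of the segment ab with an edge, computed in lattice coordinates.
    The sign makes it +1 when ab passes from the right to the left of the edge: the
    coordinate change reverses orientation when [area] is negative. *)
Definition crossing a b i : R :=
  - Num.sg area * cross (phi a) (phi b) (phi (p (src i))) (phi (p (tgt i))).

(** The affine function that a lifting with stress s gains when the edge is crossed
    from right to left. Reversing the edge changes its sign, as it changes the sign
    of the crossing number. *)
Definition weight s i z : R :=
  s [set src i; tgt i] * orient (p (src i)) (p (tgt i)) z.

Lemma crossing_meets a b i : crossing a b i != 0 -> exists x, segment a b x /\ Seg i x.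
Proof. by rewrite mulf_eq0 negb_or => /andP[_ /(cross_phi_meets hB)]. Qed.

Lemma crossing_anti a b i : crossing b a i = - crossing a b i.
Proof. by rewrite /crossing cross_antil mulrN. Qed.

Lemma crossing_line a d r t k i :
  crossing (a + r *: d) (a + t *: d) i + crossing (a + t *: d) (a + k *: d) i =
  crossing (a + r *: d) (a + k *: d) i.
Proof. by rewrite /crossing -mulrDr !phi_line cross_line. Qed.

Lemma crossing_bound a b i : `|crossing a b i| <= 4.
Proof.
rewrite /crossing normrM normrN normr_sg; case: eqP => _ /=.
  by rewrite mul0r.
by rewrite mul1r cross_bound.
Qed.

Lemma crossing_right_left a b i x : orient (p (src i)) (p (tgt i)) a < 0 ->
  0 < orient (p (src i)) (p (tgt i)) b ->
  segment a b x -> open_segment (p (src i)) (p (tgt i)) x -> crossing a b i = 1.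
Proof.
rewrite (phi_orient F hB _ _ a) (phi_orient F hB _ _ b) => oa ob [t t01 tx] [r r01 rx].
have sx : segment (phi a) (phi b) (phi x).
  by exists t => //; rewrite -phiB -phi_line tx.
have ox : open_segment (phi (p (src i))) (phi (p (tgt i))) (phi x).
  by exists r => //; rewrite -phiB -phi_line rx.
have A0 := area_neq0 F hB; rewrite /crossing.
have [A|A|A] := ltgtP 0 area; last by rewrite -A eqxx in A0.
- rewrite gtr0_sg // mulN1r cross_right_left ?opprK //; last by exists (phi x).
    by move: oa; rewrite pmulr_rlt0.
  by move: ob; rewrite pmulr_rgt0.
- rewrite ltr0_sg // opprK mul1r.
  rewrite cross_antil cross_right_left ?opprK //; last first.
    by exists (phi x) => //; rewrite segmentC.
    by move: oa; rewrite nmulr_rlt0.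
  by move: ob; rewrite nmulr_rgt0.
Qed.

Lemma in_box_segment a b : exists M, forall x, segment a b x -> in_box F h1 h2 M x.
Proof.
exists (`|(phi a).1| + `|(phi b).1| + (`|(phi a).2| + `|(phi b).2|)) => x [t t01 <-].
rewrite /in_box phi_line phiB !coordE.
have N (k l : R) : `|k + t * (l - k)| <= `|k| + `|l|.
  have := convex_between k l t01.
  have := ler_norm k; have := ler_norm l; have := ler_norm (- k); have := ler_norm (- l).
  rewrite !normrN ler_norml; lra.
have := N (phi a).1 (phi b).1; have := N (phi a).2 (phi b).2.
have := normr_ge0 (phi a).1; have := normr_ge0 (phi a).2.
have := normr_ge0 (phi b).1; have := normr_ge0 (phi b).2.
lra.
Qed.

Lemma crossing_fin_supp a b : fin_supp (crossing a b).
Proof.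
have [M hM] := in_box_segment a b.
apply: fin_suppW (touching_finite D hB M) _ => i.
by move=> /crossing_meets[x [/hM bx ix]]; exists x.
Qed.

(** Total gain along the segment from a to b, evaluated at z. *)
Definition jump s a b z : R := \sum_(i \in [set: edge_id]) (weight s i z * crossing a b i).

Lemma jump_line s a d r t k z :
  jump s (a + r *: d) (a + t *: d) z + jump s (a + t *: d) (a + k *: d) z =
  jump s (a + r *: d) (a + k *: d) z.
Proof.
rewrite /jump -fsumD; try (by apply: fin_suppM; exact: crossing_fin_supp).
by apply: eq_fsbigr => i _; rewrite -mulrDr crossing_line.
Qed.

Lemma jump_anti s a b z : jump s b a z = - jump s a b z.
Proof. by rewrite /jump -fsumN; apply: eq_fsbigr => i _; rewrite crossing_anti mulrN. Qed.

Lemma jump_off s a b z : (segment a b `<=` ~` skel) -> jump s a b z = 0.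
Proof.
move=> h; rewrite /jump fsbig1 // => i _; apply/eqP; rewrite mulf_eq0; apply/orP; right.
apply: contraT => /crossing_meets[x [/h nx ix]].
by case: nx; apply/(skeletonE D); exists i.
Qed.

Lemma jump_one s a b z i : (forall j, j <> i -> crossing a b j = 0) ->
  jump s a b z = weight s i z * crossing a b i.
Proof. by move=> h; apply: fsum1 => j /h ->; rewrite mulr0. Qed.

Hypothesis NC : noncrossing F.

(** A convex set off the skeleton lies in one face, where the lifting is one affine
    function. *)
Lemma germ_same_convex H K x y L L' : is_lifting F H -> convexset K -> K `<=` ~` skel ->
  K x -> K y -> germ H x L -> germ H y L' -> forall z, L z = L' z.
Proof.
move=> lH cK sK Kx Ky gx gy z.
have [W fW Wx] := face_exists (sK _ Kx).
have Wy := face_sub cK sK fW Kx Wx Ky.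
have [n [C aH]] := lH.2 _ fW.
rewrite (germ_uniq gx (face_germ D fW aH Wx) z).
by rewrite -(germ_uniq gy (face_germ D fW aH Wy) z).
Qed.

(** The segment ab lies in a disc that meets no other edge, so one term of the jump
    survives, and it is the difference of the affine functions on the two sides. *)
Lemma cross_edge_right_left H s i x e a b L L' : is_lifting F H -> induced_stress F H s ->
  open_segment (p (src i)) (p (tgt i)) x -> 0 < e ->
  (forall y j, ball x e y -> Seg j y -> j = i) ->
  ball x e a -> ball x e b -> segment a b x ->
  orient (p (src i)) (p (tgt i)) a < 0 -> 0 < orient (p (src i)) (p (tgt i)) b ->
  germ H a L -> germ H b L' -> forall z, L' z - L z = jump s a b z.
Proof.
move=> lH iH ox e0 hj xa xb abx oa ob ga gb z.
have uv := adj_src_tgt i.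
have ox' : open_segment (p (tgt i)) (p (src i)) x.
  move: ox => [t /= /andP[t0 t1] <-]; exists (1 - t); first by apply/andP; split; lra.
  by apply: eq_plane; rewrite !coordE; ring.
have hs y : ball x e y -> skel y -> segment (p (src i)) (p (tgt i)) y.
  by move=> xy /(skeletonE D)[j jy]; have := jy; rewrite (hj _ _ xy jy).
have hs' y : ball x e y -> skel y -> segment (p (tgt i)) (p (src i)) y.
  by rewrite segmentC; exact: hs.
have [W [U [nW [nU [CW [CU [lW lU aW aU E]]]]]]] := edge_jump lH iH uv.
have Wb : W b by apply: (left_face_half uv lW ox e0 hs).
have vu : adj (tgt i) (src i) by rewrite fw_sym.
have Ua : U a.
  by apply: (left_face_half vu lU ox' e0 hs'); split=> //=; rewrite orientC oppr_gt0.
rewrite (germ_uniq gb (face_germ D lW.1 aW Wb) z) (germ_uniq ga (face_germ D lU.1 aU Ua) z) E.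
rewrite (@jump_one s a b z i) ?(crossing_right_left oa ob abx ox) ?mulr1 //.
move=> j ji; apply/eqP; apply: contraT => /crossing_meets[y [aby jy]].
by case: ji; apply: (hj y) => //; exact: (convex_ball xa xb).
Qed.

(** Both sides are additive along the line, so it is enough to compare them locally.
    Off the skeleton both vanish. A line without vertices on it crosses every edge
    that it meets transversally at an interior point, and near that point the edge is
    the only one. *)
Lemma crossing_formula H s a d : is_lifting F H -> induced_stress F H s ->
  (forall t v, a + t *: d <> p v) -> forall t t', 
  ~ skel (a + t *: d) -> ~ skel (a + t' *: d) -> forall L L',
  germ H (a + t *: d) L -> germ H (a + t' *: d) L' ->
  forall z, L' z - L z = jump s (a + t *: d) (a + t' *: d) z.
Proof.
move=> lH iH av t t' nt nt'.
pose q t := a + t *: d.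
pose Q t t' := forall L L', germ H (q t) L -> germ H (q t') L' ->
  forall z, L' z - L z = jump s (q t) (q t') z.
have qB (t0 : R) A : nbhs (q t0) A -> \forall r \near t0, A (q r).
  by move=> ?; exact: (@line_continuous R a d t0).
(* at a parameter on the skeleton: the unique edge i, and the signed distance to
   it, up to a nonzero factor k, along the line *)
have onedge r : skel (q r) -> exists i e k, [/\ 0 < e,
    open_segment (p (src i)) (p (tgt i)) (q r),
    forall y j, ball (q r) e y -> Seg j y -> j = i, k != 0 &
    forall t, orient (p (src i)) (p (tgt i)) (q t) = (t - r) * k].
  move=> /(skeletonE D)[i ix]; have uv := adj_src_tgt i.
  have ox : open_segment (p (src i)) (p (tgt i)) (q r).
    have [l /= /andP[l0 l1] lx] := ix; exists l => //=; apply/andP; split.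
      rewrite lt_neqAle l0 andbT; apply/eqP => e; apply: (av r (src i)).
      by rewrite -[LHS]lx -e scale0r addr0.
    rewrite lt_neqAle l1 andbT; apply/eqP => e; apply: (av r (tgt i)).
    by rewrite -[LHS]lx e scale1r addrC subrK.
  have [e e0 he] := near_edge D NC uv ox.
  have oE t0 : orient (p (src i)) (p (tgt i)) (q t0) =
      (t0 - r) * det (p (tgt i) - p (src i)) d.
    have <- : orient (p (src i)) (p (tgt i)) (q r) +
       (t0 - r) * det (p (tgt i) - p (src i)) d = orient (p (src i)) (p (tgt i)) (q t0).
      by rewrite !orientE /q /det !coordE; ring.
    by rewrite (orient_segment ix) add0r.
  exists i, e, (det (p (tgt i) - p (src i)) d); split=> //.
    by move=> y j ye jy; apply: edge_set_inj; exact: he jy.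
  apply/eqP => k0.
  have [d0|d0] := eqVneq d 0.
    apply: nt; apply/(skeletonE D); exists i.
    by move: ix; rewrite /q d0 !scaler0.
  have dd := dotp_gt0 d0; have {ix} [l _ lx] := ix.
  apply: (av (r - l * (dotp (p (tgt i) - p (src i)) d / dotp d d)) (src i)).
  have {k0} k0 : (p (tgt i) - p (src i)).1 * d.2 = (p (tgt i) - p (src i)).2 * d.1.
    by apply/eqP; rewrite -subr_eq0 -/(det _ _) k0.
  have cE : p (tgt i) - p (src i) = (dotp (p (tgt i) - p (src i)) d / dotp d d) *: d.
    have dn : dotp d d != 0 by rewrite gt_eqF.
    apply: eq_plane; rewrite !coordE; apply: (mulIf dn);
      rewrite mulrAC divfK // /dotp; rewrite !coordE in k0 *.
      have := congr1 ( *%R d.2) k0; lra.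
    have := congr1 ( *%R d.1) k0; lra.
  by rewrite scalerBl addrA -scalerA -cE -/(q r) -lx addrK.
suff : Q t t' by [].
have cI : connected [set: R] by apply/connected_intervalP.
apply: (@local_to_global R setT [set t | ~ skel (q t)] Q openT cI) => //.
- move=> r1 r2 r3 n1 n2 n3 Q1 Q2 L L3 g1 g3 z.
  have [L2 g2] := lifting_germ D lH n2.
  by rewrite /q -(jump_line s a d r1 r2 r3) -(Q1 _ _ g1 g2) -(Q2 _ _ g2 g3); ring.
- move=> r _; have [sq|nq] := pselect (skel (q r)).
    have [i [e [k [e0 ox hj k0 oE]]]] := onedge _ sq.
    have : nbhs (q r) (ball (q r) e) by exact: nbhsx_ballx.
    move=> /qB; apply: filterS => r' br' ne /= /(skeletonE D)[j jy].
    have ji := hj _ _ br' jy; rewrite ji in jy.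
    have /eqP := oE r'; rewrite (orient_segment jy) eq_sym mulf_eq0 (negbTE k0) orbF.
    by rewrite subr_eq0 (negbTE ne).
  have : nbhs (q r) (~` skel).
    by apply: open_nbhs_nbhs; split => //; apply: open_off_skeleton (fd_gens D).
  by move=> /qB; apply: filterS => r' h _.
- move=> r _; have [sq|nq] := pselect (skel (q r)); last first.
    have : nbhs (q r) (~` skel).
      by apply: open_nbhs_nbhs; split => //; apply: open_off_skeleton (fd_gens D).
    move=> /nbhs_ballP[e /= e0 he].
    exists [set r' | ball (q r) e (q r')]; first exact: qB (nbhsx_ballx _ _ e0).
    move=> r1 r2 b1 b2 _ _ L1 L2 g1 g2 z.
    rewrite (germ_same_convex lH (@convex_ball _ (q r) e) he b1 b2 g1 g2) subrr.
    by rewrite jump_off //; apply: subset_trans he; exact: convex_ball.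
  have [i [e [k [e0 ox hj k0 oE]]]] := onedge _ sq.
  exists [set r' | ball (q r) e (q r')]; first exact: qB (nbhsx_ballx _ _ e0).
  have hs y : ball (q r) e y -> skel y -> segment (p (src i)) (p (tgt i)) y.
    by move=> xy /(skeletonE D)[j jy]; have := jy; rewrite (hj _ _ xy jy).
  have hs' y : ball (q r) e y -> skel y -> segment (p (tgt i)) (p (src i)) y.
    by rewrite segmentC; exact: hs.
  have same (r1 r2 : R) u v L1 L2 :
      (forall y, ball (q r) e y -> skel y -> segment (p u) (p v) y) ->
      left_half F u v (q r) e (q r1) -> left_half F u v (q r) e (q r2) ->
      germ H (q r1) L1 -> germ H (q r2) L2 ->
      forall z, L2 z - L1 z = jump s (q r1) (q r2) z.
    move=> hu l1 l2 g1 g2 z; have off := left_half_off hu.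
    rewrite (germ_same_convex lH (@convex_left_half _ _ _ F u v (q r) e) off l1 l2 g1 g2) subrr.
    by rewrite jump_off //; apply: subset_trans off; exact: convex_left_half.
  have seg (r1 r2 : R) : (r1 - r) * k < 0 -> 0 < (r2 - r) * k ->
      segment (q r1) (q r2) (q r).
    move=> k1 k2; have k3 : 0 < (r2 - r1) * k by lra.
    have k4 : (r2 - r1) != 0 by apply: contraTneq k3 => ->; rewrite mul0r ltxx.
    exists ((r - r1) / (r2 - r1)); last first.
      by apply: eq_plane; rewrite /q !coordE; field.
    have -> : (r - r1) / (r2 - r1) = ((r - r1) * k) / ((r2 - r1) * k) by field; rewrite k0.
    by apply/andP; split; rewrite ?divr_ge0 ?ler_pdivrMr ?mul1r //; lra.
  have off0 r' : ~ skel (q r') -> ball (q r) e (q r') -> (r' - r) * k != 0.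
    move=> n' _; rewrite mulf_neq0 // subr_eq0; apply/eqP => e'.
    by apply: n'; rewrite e'.
  move=> r1 r2 b1 b2 /= n1 n2 L1 L2 g1 g2 z.
  have := off0 _ n1 b1; have := off0 _ n2 b2.
  rewrite !neq_lt => /orP[] k2 /orP[] k1.
  + by apply: (same _ _ _ _ _ _ hs') g1 g2 z; split=> //=; rewrite orientC oE oppr_gt0.
  + have sg := seg _ _ k2 k1.
    rewrite -opprB (@cross_edge_right_left H s i (q r) e (q r2) (q r1) L2 L1) ?oE //.
    by rewrite jump_anti opprK.
  + have sg := seg _ _ k1 k2.
    by apply: (@cross_edge_right_left H s i (q r) e) => //; rewrite oE.
  + by apply: (same _ _ _ _ _ _ hs) g1 g2 z; split=> //=; rewrite oE.
Qed.

End CrossingSums.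

Section FiniteReindex.
Variables (T : choiceType) (R : realType).

Lemma fsum_fin (K : finType) (h : K -> T) (f : T -> R) : injective h ->
  (forall i, f i != 0 -> exists k, i = h k) ->
  \sum_(i \in setT) f i = \sum_k f (h k).
Proof.
move=> hi hf; have fA : finite_set (range h) by exact: finite_image.
rewrite (@fsum_set _ _ (range h)) //; last by move=> i /hf[k ->]; exists k.
rewrite fsbig_image; last by move=> k k' _ _; exact: hi.
rewrite [RHS]fsbig_seq ?index_enum_uniq //.
apply: eq_fsbigl; apply/seteqP; split=> k //= _; exact: mem_index_enum.
Qed.

End FiniteReindex.

(** * Equilibrium and coboundaries *)

Section Equilibrium.
Variables (R : realType) (V : choiceType) (Gamma : zmodType).
Variable F : periodic_framework R V Gamma.
Variable D : fundamental_data F.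

Local Notation adj := (fw_adj F).
Local Notation p := (fw_p F).
Local Notation Seg := (@Seg R V Gamma F D).
Local Notation src := (@src R V Gamma F D).
Local Notation tgt := (@tgt R V Gamma F D).
Local Notation edge_id := (edge_id D).
Local Notation weight := (@weight R V Gamma F D).

Implicit Types (a b c d q x y z : plane R) (k r t e : R) (u v w : V) (i j : edge_id).
Implicit Types (s : set V -> R) (g : Gamma).

(** The resultant of the stresses at u. *)
Definition star s u : plane R :=
  \sum_(v \in [set v | adj u v]) s [set u; v] *: (p v - p u).

Definition ends u : set edge_id := [set i | src i = u \/ tgt i = u].

Lemma ends_finite u : finite_set (ends u).
Proof.
have := touching_finite D (fd_gens D)
  (`|(phi F (fd_g1 D) (fd_g2 D) (p u)).1| + `|(phi F (fd_g1 D) (fd_g2 D) (p u)).2|).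
apply: sub_finite_set => i h; exists (p u).
  by case: h => <-; rewrite /Seg; [exact: segmentl|exact: segmentr].
by split; [rewrite lerDl|rewrite lerDr].
Qed.

Definition other u i : V := if src i == u then tgt i else src i.

Lemma tgt_neq_src i : (tgt i == src i) = false.
Proof. by apply/eqP => e; apply: (adj_neq (adj_src_tgt i)). Qed.

Lemma ends_other u i : ends u i -> [set src i; tgt i] = [set u; other u i].
Proof.
rewrite /other; have [-> //|ne [e|<-]] := eqVneq (src i) u; last exact: set2C.
by rewrite e eqxx in ne.
Qed.

(** Each neighbour of u is the other end of exactly one edge at u. *)
Lemma ends_bij u : set_bij (ends u) [set v | adj u v] (other u).
Proof.
split.
- move=> i [e|e] /=; rewrite /other.
    by rewrite e eqxx -e adj_src_tgt.
  by rewrite -e eq_sym tgt_neq_src fw_sym adj_src_tgt.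
- move=> i j; rewrite !in_setE => hi hj E; apply: edge_set_inj.
  by rewrite (ends_other hi) E -(ends_other hj).
- move=> v /= uv; have [i [[e1 e2]|[e1 e2]]] := edge_index D uv; exists i.
  + by left.
  + by rewrite /other e1 eqxx.
  + by right.
  + by rewrite /other -e2 eq_sym tgt_neq_src.
Qed.

Lemma nbr_finite u : finite_set [set v | adj u v].
Proof.
have [h _ sj] := ends_bij u.
by apply: (sub_finite_set sj); exact: finite_image (ends_finite u).
Qed.

Lemma det0l a : det 0 a = 0.
Proof. by rewrite /det /=; ring. Qed.

Lemma orient_det a b z : orient a b z = det (b - a) (z - a).
Proof. by []. Qed.

Lemma star_det s u z :
  \sum_(v \in [set v | adj u v]) s [set u; v] * orient (p u) (p v) z =
  det (star s u) (z - p u).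
Proof.
rewrite /star !fsbig_finite ?nbr_finite //=; try exact: nbr_finite.
rewrite (big_morph (fun a => det a (z - p u)) (id1 := 0) (op1 := +%R)).
- by apply: eq_bigr => v _; rewrite orient_det /det !coordE; ring.
- by move=> a b; rewrite /det !coordE; ring.
- exact: det0l.
Qed.

(** The force at u, read off the indexed edges: the two orientations of an edge
    contribute with opposite signs. *)
Lemma star_edges s u z :
  \sum_(i \in [set: edge_id]) weight s i z * ((src i == u)%:R - (tgt i == u)%:R) =
  det (star s u) (z - p u).
Proof.
rewrite -star_det (reindex_fsbig _ _ _ _ (ends_bij u)).
rewrite -[LHS](@fsbig_widen _ _ _ _ (ends u)) //; last first.
  move=> i [_ ni] /=; have [e|_] := eqVneq (src i) u; first by case: ni; left.
  have [e|_] := eqVneq (tgt i) u; first by case: ni; right.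
  by rewrite subrr mulr0.
apply: eq_fsbigr => i; rewrite in_setE /weight /other => hi.
case: hi => e; rewrite -e ?eqxx ?tgt_neq_src ?(eq_sym (src i)) ?tgt_neq_src.
  by rewrite subr0 mulr1.
rewrite sub0r mulrN1 (set2C (tgt i)) [orient (p (tgt i)) _ _]orientC; ring.
Qed.

(** Summation by parts: the sum equals the sum over u of tau u times the moment of
    [star s u]. *)
Lemma coboundary0 s z (tau : V -> R) : (forall u, star s u = 0) ->
  finite_set [set u | tau u != 0] ->
  \sum_(i \in [set: edge_id]) weight s i z * (tau (src i) - tau (tgt i)) = 0.
Proof.
move=> s0 ft; pose r := fset_set [set u | tau u != 0].
have tauE w : tau w = \sum_(u <- r) tau u * (w == u)%:R.
  have [wr|nr] := boolP (w \in r).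
    rewrite (bigD1_seq w) //= eqxx mulr1 big1 ?addr0 // => u uw.
    by rewrite eq_sym (negbTE uw) mulr0.
  rewrite big_seq big1.
    move: nr; rewrite in_fset_set // notin_setE /= => /negP/negPn/eqP //.
  by move=> u ur; have [e|_] := eqVneq w u; [rewrite e ur in nr|rewrite mulr0].
have key (l : seq V) : fin_supp (fun i => weight s i z * \sum_(u <- l) tau u *
      ((src i == u)%:R - (tgt i == u)%:R)) /\
    \sum_(i \in [set: edge_id]) (weight s i z * \sum_(u <- l) tau u *
      ((src i == u)%:R - (tgt i == u)%:R)) = 0.
  elim: l => [|u l [fl IH]].
    split; last by rewrite fsbig1 // => i _; rewrite big_nil mulr0.
    by apply: (@fin_suppW _ _ set0) => // i; rewrite big_nil mulr0 eqxx.
  pose f i := tau u * (weight s i z * ((src i == u)%:R - (tgt i == u)%:R)).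
  have E i : weight s i z * (\sum_(u <- u :: l) tau u * ((src i == u)%:R - (tgt i == u)%:R))
     = f i + weight s i z * \sum_(u <- l) tau u * ((src i == u)%:R - (tgt i == u)%:R).
    by rewrite big_cons /f; ring.
  have ff : fin_supp f.
    apply: (@fin_suppW _ _ (ends u)); first exact: ends_finite.
    move=> i; rewrite /f; have [e|_] := eqVneq (src i) u; first by left.
    have [e|_] := eqVneq (tgt i) u; first by right.
    by rewrite subrr !mulr0 eqxx.
  split.
    have -> : (fun i => weight s i z * (\sum_(u <- u :: l) tau u *
      ((src i == u)%:R - (tgt i == u)%:R))) = (fun i => f i + weight s i z *
      \sum_(u <- l) tau u * ((src i == u)%:R - (tgt i == u)%:R)) by apply/funext.
    exact: fin_suppD.
  transitivity (\sum_(i \in [set: edge_id]) (f i + weight s i z * \sum_(u <- l) tau u *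
      ((src i == u)%:R - (tgt i == u)%:R))); first by apply: eq_fsbigr => i _; exact: E.
  rewrite fsumD // IH addr0 /f fsumZ star_edges s0.
  by rewrite det0l mulr0.
have [_ kr] := key r; rewrite -[RHS]kr; apply: eq_fsbigr => i _; congr (_ * _).
rewrite (tauE (src i)) (tauE (tgt i)) -sumrB; apply: eq_bigr => u _; ring.
Qed.

End Equilibrium.

(** * The stress of a lifting is in equilibrium *)

Section LiftingEquilibrium.
Variables (R : realType) (V : choiceType) (Gamma : zmodType).
Variable F : periodic_framework R V Gamma.
Variable D : fundamental_data F.
Variables h1 h2 : Gamma.
Hypothesis hB : is_Z2_basis h1 h2.

Local Notation act := (fw_act F).
Local Notation p := (fw_p F).
Local Notation pi := (fw_pi F).
Local Notation skel := (skeleton F).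
Local Notation src := (@src R V Gamma F D).
Local Notation tgt := (@tgt R V Gamma F D).
Local Notation edge_id := (edge_id D).
Local Notation weight := (@weight R V Gamma F D).
Local Notation phi := (@phi R V Gamma F h1 h2).
Local Notation area := (@area R V Gamma F h1 h2).
Local Notation jump := (@jump R V Gamma F D h1 h2).
Local Notation star := (@star R V Gamma F).

Implicit Types (a b c d q x y z : plane R) (k r t e : R) (u v w : V) (i j : edge_id).
Implicit Types (s : set V -> R) (g : Gamma) (H : plane R -> R).

(** Winding number of the triangle abc about a vertex, in lattice coordinates. *)
Definition winding_vertex a b c v : R := winding (phi a) (phi b) (phi c) (phi (p v)).

Lemma winding_vertex_out a b c v M :
  (M < `|(phi (p v)).1 - (phi a).1| \/ M < `|(phi (p v)).2 - (phi a).2|) ->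
  `|(phi b).1 - (phi a).1| <= M -> `|(phi b).2 - (phi a).2| <= M ->
  `|(phi c).1 - (phi a).1| <= M -> `|(phi c).2 - (phi a).2| <= M -> winding_vertex a b c v = 0.
Proof. exact: winding_out. Qed.

Lemma winding_vertex_finite a b c : finite_set [set v | winding_vertex a b c v != 0].
Proof.
pose M := `|(phi b).1 - (phi a).1| + `|(phi b).2 - (phi a).2| +
  (`|(phi c).1 - (phi a).1| + `|(phi c).2 - (phi a).2|).
have := vertices_finite D hB (M + (`|(phi a).1| + `|(phi a).2|)).
apply: sub_finite_set => v /= tv.
have n1 := normr_ge0 ((phi b).1 - (phi a).1); have n2 := normr_ge0 ((phi b).2 - (phi a).2).
have n3 := normr_ge0 ((phi c).1 - (phi a).1); have n4 := normr_ge0 ((phi c).2 - (phi a).2).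
have m1 := normr_ge0 (phi a).1; have m2 := normr_ge0 (phi a).2.
have {tv} [t1 t2] : `|(phi (p v)).1 - (phi a).1| <= M /\ `|(phi (p v)).2 - (phi a).2| <= M.
  have [B1 B2 C1 C2] : [/\ `|(phi b).1 - (phi a).1| <= M, `|(phi b).2 - (phi a).2| <= M,
      `|(phi c).1 - (phi a).1| <= M & `|(phi c).2 - (phi a).2| <= M].
    by split; rewrite /M; lra.
  split; rewrite leNgt; apply: contraNN tv => h; apply/eqP;
    apply: (@winding_vertex_out _ _ _ _ M) => //.
    by left.
  by right.
split.
- have := ler_normD ((phi (p v)).1 - (phi a).1) (phi a).1; rewrite subrK; lra.
- have := ler_normD ((phi (p v)).2 - (phi a).2) (phi a).2; rewrite subrK; lra.
Qed.

Lemma jump_triangle s a b c z :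
  jump s a b z + jump s b c z + jump s c a z =
  - Num.sg area *
    \sum_(i \in [set: edge_id]) weight s i z * (winding_vertex a b c (src i) - winding_vertex a b c (tgt i)).
Proof.
have X a' b' : fin_supp (fun i => weight s i z * crossing h1 h2 a' b' i).
  by apply: fin_suppM; exact: crossing_fin_supp.
rewrite /jump -!fsumD //; last exact: fin_suppD.
rewrite -fsumZ; apply: eq_fsbigr => i _.
by rewrite /winding_vertex -cross_triangle /crossing; ring.
Qed.

(** Path independence of the jumps of an equilibrium stress. *)
Lemma jump_triangle0 s a b c z : (forall u, star s u = 0) ->
  jump s a b z + jump s b c z = jump s a c z.
Proof.
move=> s0; have := jump_triangle s a b c z.
rewrite coboundary0 ?mulr0 //; last exact: winding_vertex_finite.
by rewrite (jump_anti D h1 h2 s a c) => /eqP; rewrite subr_eq0 => /eqP.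
Qed.

Definition vertex_code (c : 'I_(fd_n D) * (int * int)) : V :=
  act (latt h1 h2 c.2.1 c.2.2) (fd_rep c.1).

Lemma vertex_codeP v : exists l, v = vertex_code l.
Proof.
have [l [[g ->] _]] := @fd_repP _ _ _ _ D v.
by have [m [n ->]] := lattP hB g; exists (l, (m, n)).
Qed.

(** The skeleton lies on countably many lines, so it can be avoided together with two
    further lines for each vertex. *)
Lemma generic_point (n n' : V -> plane R) (c c' : V -> R) x e :
  (forall v, n v <> 0) -> (forall v, n' v <> 0) -> 0 < e ->
  exists y, [/\ ball x e y, ~ skel y, forall v, dotp (n v) y <> c v &
    forall v, dotp (n' v) y <> c' v].
Proof.
move=> n0 n'0 e0.
pose K := ('I_(fd_m D) * (int * int) +
  ('I_(fd_n D) * (int * int) + 'I_(fd_n D) * (int * int)))%type.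
pose ix (l : 'I_(fd_m D) * (int * int)) : edge_id := (l.1, latt h1 h2 l.2.1 l.2.2).
pose N (l : K) : plane R := match l with
  | inl i => perp (p (tgt (ix i)) - p (src (ix i)))
  | inr (inl v) => n (vertex_code v) | inr (inr v) => n' (vertex_code v) end.
pose C (l : K) : R := match l with
  | inl i => dotp (perp (p (tgt (ix i)) - p (src (ix i)))) (p (src (ix i)))
  | inr (inl v) => c (vertex_code v) | inr (inr v) => c' (vertex_code v) end.
have N0 l : N l <> 0.
  case: l => [i|[v|v]] //= E.
  have /eqP := edge_vec_neq0 (adj_src_tgt (ix i)); apply.
  by move: E => /= [E1 E2]; apply: eq_plane => //; apply/eqP; rewrite -oppr_eq0; apply/eqP.
have [y xy hy] := avoid_lines C x N0 e0.
exists y; split=> //.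
- move=> /(skeletonE D)[[b g] iy]; have [m [k gE]] := lattP hB g.
  apply: (hy (inl (b, (m, k)))); rewrite /= /ix /= -gE.
  have := orient_segment iy; rewrite orientE /dotp /perp /=; lra.
- by move=> v; have [l ->] := vertex_codeP v; exact: (hy (inr (inl l))).
- by move=> v; have [l ->] := vertex_codeP v; exact: (hy (inr (inr l))).
Qed.

Lemma perp_neq0 a : a <> 0 -> perp a <> 0.
Proof.
move=> a0 [E1 E2]; apply: a0; apply: eq_plane => //.
by apply/eqP; rewrite -oppr_eq0; apply/eqP.
Qed.

(** The points to avoid lie on the lines joining a or b to the vertices. *)
Lemma generic_lines a b x e : ~ skel a -> ~ skel b -> 0 < e ->
  exists y, [/\ ball x e y, ~ skel y, forall t v, a + t *: (y - a) <> p v &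
    forall t v, b + t *: (y - b) <> p v].
Proof.
move=> na nb e0.
have N a' v : ~ skel a' -> perp (p v - a') <> 0.
  move=> nc; apply: perp_neq0 => /eqP; rewrite subr_eq0 => /eqP E.
  by apply: nc; rewrite -E; exact: vertex_skeleton.
have [y [xy ny h h']] := @generic_point (fun v => perp (p v - a)) (fun v => perp (p v - b))
  (fun v => dotp (perp (p v - a)) a) (fun v => dotp (perp (p v - b)) b) x e
  (fun v => N _ v na) (fun v => N _ v nb) e0.
exists y; split=> // t v E; [apply: (h v)|apply: (h' v)];
  by rewrite -E /dotp /perp !coordE /=; ring.
Qed.

Lemma off_skeleton x e : 0 < e -> exists2 y, ball x e y & ~ skel y.
Proof.
move=> e0; have n0 (v : V) : (1, 0) <> 0 :> plane R by move=> [] /eqP; rewrite oner_eq0.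
have [y [? ? _ _]] := generic_point (fun=> 0) (fun=> 0) x n0 n0 e0.
by exists y.
Qed.

Lemma dist_le (x y k l r M : R) : `|x - k| <= r -> `|y - l| <= r ->
  - M + 2 * r <= l - k -> l - k <= M - 2 * r -> `|y - x| <= M.
Proof. rewrite !ler_norml => /andP[? ?] /andP[? ?] ? ?; apply/andP; split; lra. Qed.

Section Lifting.
Hypothesis NC : noncrossing F.
Variables (H : plane R -> R) (s : set V -> R).
Hypotheses (lH : is_lifting F H) (iH : induced_stress F H s).

Lemma crossing_segment a b L L' z : ~ skel a -> ~ skel b ->
  (forall t v, a + t *: (b - a) <> p v) -> germ H a L -> germ H b L' ->
  L' z - L z = jump s a b z.
Proof.
move=> na nb h ga gb.
have ea : a + 0 *: (b - a) = a by rewrite scale0r addr0.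
have eb : a + 1 *: (b - a) = b by rewrite scale1r addrC subrK.
have := @crossing_formula _ _ _ F D h1 h2 hB NC H s a (b - a) lH iH h 0 1.
rewrite ea eb => /(_ na nb _ _ ga gb z); exact.
Qed.

(** Only finitely many vertices lie in a bounded region, and distinct vertices are
    placed at distinct points. *)
Lemma isolated_vertex u : exists2 e, 0 < e & forall v,
  `|(phi (p v)).1 - (phi (p u)).1| <= e -> `|(phi (p v)).2 - (phi (p u)).2| <= e -> v = u.
Proof.
pose M := `|(phi (p u)).1| + `|(phi (p u)).2| + 1.
pose S := [set v | in_box F h1 h2 M (p v)].
have fS : finite_set S by exact: vertices_finite.
pose P e v := `|(phi (p v)).1 - (phi (p u)).1| <= e ->
  `|(phi (p v)).2 - (phi (p u)).2| <= e -> v = u.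
have N : \forall e \near (0 : R)^'+, (\bigcap_(v in [set` fset_set S]) [set e | P e v]) e.
  apply: filter_bigI => v _; have [->|vu] := eqVneq v u; first by near=> e.
  have d0 : 0 < `|(phi (p v)).1 - (phi (p u)).1| + `|(phi (p v)).2 - (phi (p u)).2|.
    rewrite lt_neqAle addr_ge0 // andbT eq_sym paddr_eq0 // !normr_eq0 !subr_eq0.
    apply: contra vu => /andP[/eqP e1 /eqP e2]; apply/eqP; apply: (p_inj NC).
    by apply: (phi_inj hB); exact: (eq_plane e1 e2).
  near=> e => /= e1 e2; exfalso.
  have : e < (`|(phi (p v)).1 - (phi (p u)).1| + `|(phi (p v)).2 - (phi (p u)).2|) / 2.
    by near: e; apply: nbhs_right_lt; lra.
  lra.
have [e [[e0 e1] he]] : exists e, (0 < e /\ e <= 1) /\ forall v, S v -> P e v.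
  have N0 : \forall e \near (0 : R)^'+, 0 < e by exact: nbhs_right_gt.
  have N1 : \forall e \near (0 : R)^'+, e <= 1 by exact: nbhs_right_le.
  have [e [[e1 e2] h]] := filter_ex (filterI (filterI N0 N1) N).
  exists e; split=> // v Sv; apply: (h v); rewrite /= in_fset_set //; exact: mem_set.
exists e => // v h h'; apply: he => //.
have m1 := normr_ge0 (phi (p u)).1; have m2 := normr_ge0 (phi (p u)).2.
split; rewrite /M.
- have := ler_normD ((phi (p v)).1 - (phi (p u)).1) (phi (p u)).1; rewrite subrK; lra.
- have := ler_normD ((phi (p v)).2 - (phi (p u)).2) (phi (p u)).2; rewrite subrK; lra.
Unshelve. all: by end_near. Qed.

(** A triangle with two vertices below U, to its left and to its right, and the third
    one above it. The third vertex may be on either side of the vertical through U;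
    in each case exactly one of the two upper sides is met by the upward ray. *)
Lemma winding_around (U A B C : plane R) e : 0 < e ->
  `|A.1 - (U.1 - e)| <= e / 8 -> `|A.2 - (U.2 - e)| <= e / 8 ->
  `|B.1 - (U.1 + e)| <= e / 8 -> `|B.2 - (U.2 - e)| <= e / 8 ->
  `|C.1 - U.1| <= e / 8 -> `|C.2 - (U.2 + 2 * e)| <= e / 8 -> winding A B C U = -1.
Proof.
move=> e0; rewrite !ler_norml.
move=> /andP[a1 a2] /andP[a3 a4] /andP[b1 b2] /andP[b3 b4] /andP[c1 c2] /andP[c3 c4].
rewrite /winding under_high; [|lra|lra].
have o1 : 0 < orient B C U.
  rewrite orientE.
  have -> : (C.1 - B.1) * (U.2 - B.2) - (C.2 - B.2) * (U.1 - B.1) =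
    (B.1 - U.1) * (C.2 - B.2) - (B.1 - C.1) * (U.2 - B.2) by ring.
  have : 7 / 8 * e * (7 / 8 * 3 * e) <= (B.1 - U.1) * (C.2 - B.2).
    by apply: ler_pM; lra.
  have : (B.1 - C.1) * (U.2 - B.2) <= 5 / 4 * e * (9 / 8 * e).
    by apply: ler_pM; lra.
  have : 0 < e * e by rewrite mulr_gt0.
  lra.
have o2 : 0 < orient C A U.
  rewrite orientE.
  have -> : (A.1 - C.1) * (U.2 - C.2) - (A.2 - C.2) * (U.1 - C.1) =
    (C.1 - A.1) * (C.2 - U.2) - (C.1 - U.1) * (C.2 - A.2) by ring.
  have : 3 / 4 * e * (15 / 8 * e) <= (C.1 - A.1) * (C.2 - U.2).
    by apply: ler_pM; lra.
  have : (C.1 - U.1) * (C.2 - A.2) <= 1 / 8 * e * (13 / 4 * e).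
    have [h|h] := leP 0 (C.1 - U.1); first by apply: ler_pM; lra.
    have h3 : 0 < e * e by rewrite mulr_gt0.
    have : (C.1 - U.1) * (C.2 - A.2) <= 0 by rewrite nmulr_rle0 //; lra.
    lra.
  have : 0 < e * e by rewrite mulr_gt0.
  lra.
have sB : (B.1 <= U.1) = false by apply/negbTE; rewrite -ltNge; lra.
have sA : (A.1 <= U.1) = true by lra.
have [h|/negbTE h] := boolP (C.1 <= U.1).
  have s1 : slabl B C U.1 = -1 by rewrite /slabl sB h sub0r.
  have s2 : slabl C A U.1 = 0 by rewrite /slabl sA h subrr.
  by rewrite /under s1 s2 !mulN1r mul0r oppr_lt0 o1 addr0 add0r.
have s1 : slabl B C U.1 = 0 by rewrite /slabl sB h subrr.
have s2 : slabl C A U.1 = -1 by rewrite /slabl sA h sub0r.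
by rewrite /under s1 s2 !mulN1r mul0r oppr_lt0 o2 addr0 add0r.
Qed.

Lemma near_inverse_phi k l e : 0 < e -> exists x r, 0 < r /\
  forall y, ball x r y -> `|(phi y).1 - k| <= e /\ `|(phi y).2 - l| <= e.
Proof.
move=> e0; pose x := k *: pi h1 + l *: pi h2.
have xU : phi x = (k, l).
  have A := area_neq0 F hB.
  rewrite /area /det in A; apply: eq_plane; rewrite /x /phi /area /det !coordE /=;
    by field; exact: A.
have /nbhs_ballP[r /= r0 h] := near_phi F h1 h2 x e0.
exists x, r; split=> // y /h h'.
have -> : k = (phi x).1 by rewrite xU.
by have -> : l = (phi x).2 by rewrite xU.
Qed.

(** The jumps of a lifting around a triangle cancel. If the triangle encloses u and no
    other vertex, their sum is also the moment of [star s u] up to sign. *)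
Lemma lifting_star0 u : star s u = 0.
Proof.
have [e e0 iso] := isolated_vertex u.
(* the triangle has a height of about 3 d: a box of size 4 d about its first vertex
   contains it, and that vertex is within 2 d of u *)
pose d := e / 8; have d0 : 0 < d by rewrite /d; lra.
pose U := phi (p u).
have d8 : 0 < d / 8 by lra.
have [xa [ra [ra0 ha]]] := near_inverse_phi (U.1 - d) (U.2 - d) d8.
have [xb [rb [rb0 hb]]] := near_inverse_phi (U.1 + d) (U.2 - d) d8.
have [xc [rc [rc0 hc]]] := near_inverse_phi U.1 (U.2 + 2 * d) d8.
have [a /ha[a1 a2] na] := off_skeleton xa ra0.
have [b [/hb[b1 b2] nb ab _]] := generic_lines xb na na rb0.
have [c [/hc[c1 c2] nc ac bc]] := generic_lines xc na nb rc0.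
have [La ga] := lifting_germ D lH na.
have [Lb gb] := lifting_germ D lH nb.
have [Lc gc] := lifting_germ D lH nc.
have tu : winding_vertex a b c u = -1 by apply: (winding_around d0).
have [B1 B2 C1 C2] : [/\ `|(phi b).1 - (phi a).1| <= 4 * d,
    `|(phi b).2 - (phi a).2| <= 4 * d, `|(phi c).1 - (phi a).1| <= 4 * d &
    `|(phi c).2 - (phi a).2| <= 4 * d].
  by split; [apply: (dist_le a1 b1)|apply: (dist_le a2 b2)|apply: (dist_le a1 c1)|
    apply: (dist_le a2 c2)]; lra.
have tv v : v != u -> winding_vertex a b c v = 0.
  move=> vu; have [h|h] : e < `|(phi (p v)).1 - U.1| \/ e < `|(phi (p v)).2 - U.2|.
  - have [h|h] := leP `|(phi (p v)).1 - U.1| e; last by left.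
    have [h'|h'] := leP `|(phi (p v)).2 - U.2| e; last by right.
    by rewrite (iso _ h h') eqxx in vu.
  - apply: (@winding_vertex_out _ _ _ _ (4 * d)) => //; left.
    rewrite ltNge; apply: contraTN h => k; rewrite -leNgt.
    by move: k a1; rewrite !ler_norml /d; lra.
  - apply: (@winding_vertex_out _ _ _ _ (4 * d)) => //; right.
    rewrite ltNge; apply: contraTN h => k; rewrite -leNgt.
    by move: k a2; rewrite !ler_norml /d; lra.
have E z : det (star s u) (z - p u) = 0.
  have ca t v : c + t *: (a - c) <> p v.
    move=> k; apply: (ac (1 - t) v); rewrite -k.
    by apply: eq_plane; rewrite !coordE; ring.
  have J : jump s a b z + jump s b c z + jump s c a z = 0.
    rewrite -(crossing_segment z na nb ab ga gb) -(crossing_segment z nb nc bc gb gc).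
    rewrite -(crossing_segment z nc na ca gc ga); ring.
  have A0 := area_neq0 F hB; move: J; rewrite jump_triangle => /eqP.
  rewrite mulf_eq0 oppr_eq0 sgr_eq0 (negbTE A0) /= => /eqP J.
  rewrite -(star_edges D) -[RHS]oppr0 -[in RHS]J -fsumN.
  have T v : winding_vertex a b c v = - (v == u)%:R.
    by have [->|vu] := eqVneq v u; rewrite ?tu ?tv ?oppr0.
  by apply: eq_fsbigr => i _; rewrite !T; ring.
have E1 := E (p u + (1, 0)); have E2 := E (p u + (0, 1)).
move: E1 E2; rewrite !(addrC (p u)) !addrK /det /= => E1 E2.
by apply: eq_plane => /=; lra.
Qed.

End Lifting.
End LiftingEquilibrium.

(** * Change of gradient along a period *)

Section Telescoping.
Variable R : realType.
Implicit Types (k l r t : R) (u v : plane R).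

Lemma sum_telescope (h : nat -> R) n : \sum_(j < n) (h j.+1 - h j) = h n - h 0%N.
Proof.
elim: n => [|n IH]; first by rewrite big_ord0 subrr.
by rewrite big_ord_recr /= IH; ring.
Qed.

Definition centered (N j : nat) : int := j%:Z - N%:Z.

Lemma centeredS N j : ((centered N j.+1)%:~R = (centered N j)%:~R + 1 :> R).
Proof. by rewrite /centered !rmorphB /= -!pmulrn -natr1; ring. Qed.

(** In a row of translates, the crossings of the vertical rays telescope: the rays from
    the two ends of the unit segment see the same row up to one step, and each endpoint
    of the translated segment passes once under or over the unit segment. *)
Lemma row_cross (Q U W : plane R) r N :
  `|Q.1 - U.1| <= N%:R -> `|Q.1 - W.1| <= N%:R ->
  \sum_(j < N.*2.+1) cross Q (Q + (1, 0)) (U + ((centered N j)%:~R, r)) (W + ((centered N j)%:~R, r))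
  = (U.2 + r < Q.2)%R%:R - (W.2 + r < Q.2)%R%:R.
Proof.
rewrite !ler_norml => /andP[u1 u2] /andP[w1 w2].
have e0 : (centered N 0)%:~R = - N%:R :> R by rewrite /centered sub0r rmorphN.
have eN : (centered N N.*2.+1)%:~R = N%:R + 1 :> R.
  rewrite /centered (_ : _ - _ = (N.+1)%:Z); last by lia.
  by rewrite -pmulrn -natr1.
have und (T : plane R) : `|Q.1 - T.1| <= N%:R ->
    \sum_(j < N.*2.+1) under Q (Q + (1, 0)) (T + ((centered N j)%:~R, r)) = (T.2 + r < Q.2)%R%:R.
  rewrite ler_norml => /andP[t1 t2].
  pose h j : R := (Q.1 + 1 <= T.1 + (centered N j)%:~R)%R%:R.
  have E (j : 'I_(N.*2.+1)) : under Q (Q + (1, 0)) (T + ((centered N j)%:~R, r)) =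
      (T.2 + r < Q.2)%R%:R * (h j.+1 - h j).
    rewrite /under /slabl orientE !coordE /= /h centeredS.
    have -> : (Q.1 + 1 <= T.1 + ((centered N j)%:~R + 1)) = (Q.1 <= T.1 + (centered N j)%:~R).
      by rewrite addrA lerD2r.
    case: (leP Q.1 (T.1 + (centered N j)%:~R)) => c1;
      case: (leP (Q.1 + 1) (T.1 + (centered N j)%:~R)) => c2;
      rewrite ?subrr ?mul0r ?mulr0 ?subr0 ?mul1r ?mulr1 //; last by exfalso; lra.
    by congr ((nat_of_bool _)%:R); apply/idP/idP; lra.
  rewrite (eq_bigr _ (fun j _ => E j)) -mulr_sumr sum_telescope /h e0 eN.
  rewrite (_ : (_ <= T.1 + (N%:R + 1)) = true); last by lra.
  rewrite (_ : (_ <= T.1 - N%:R) = false); last by apply/negbTE; rewrite -ltNge; lra.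
  by rewrite subr0 mulr1.
pose h j := over (U + ((centered N j)%:~R, r)) (W + ((centered N j)%:~R, r)) (Q + (1, 0)).
have E (j : 'I_(N.*2.+1)) : over (U + ((centered N j)%:~R, r)) (W + ((centered N j)%:~R, r)) Q = h j.+1.
  rewrite /h /over /slabr !orientE !coordE /= centeredS.
  by rewrite !addrA !ltrD2r; congr (_ * (nat_of_bool (0 < _ * _))%:R); ring.
rewrite /cross big_split sumrB /= !und ?ler_norml ?u1 ?w1 // [X in _ + X](_ : _ = 0) ?addr0 //.
under eq_bigr => j _ do rewrite E -/(h j).
rewrite sum_telescope /h e0 eN /over /slabr !coordE /=.
have -> : (U.1 + (N%:R + 1) < Q.1 + 1) = false by apply/negbTE; rewrite -leNgt; lra.
have -> : (W.1 + (N%:R + 1) < Q.1 + 1) = false by apply/negbTE; rewrite -leNgt; lra.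
have -> : (U.1 - N%:R < Q.1 + 1) = true by lra.
have -> : (W.1 - N%:R < Q.1 + 1) = true by lra.
by rewrite !subrr !mul0r subrr.
Qed.

(** For integers m between -N and N, the condition k + m < l says that m is below the
    ceiling of l - k. *)
Lemma count_centered k l N : `|l - k| <= N%:R ->
  \sum_(j < N.*2.+1) (k + (centered N j)%:~R < l)%R%:R = N%:R + (Num.ceil (l - k))%:~R :> R.
Proof.
rewrite ler_norml => /andP[b1 b2].
have E (j : nat) : (k + (centered N j)%:~R < l) = (centered N j < Num.ceil (l - k)).
  by rewrite -ltrBrDl ceil_gt_int.
have c1 : - N%:Z <= Num.ceil (l - k).
  by rewrite -(ler_int R) rmorphN /=; apply: le_trans (ceil_ge _).
have c2 : Num.ceil (l - k) <= N%:Z by rewrite ceil_le_int.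
have [n nE] : exists n : nat, Num.ceil (l - k) = n%:Z - N%:Z.
  exists (absz (Num.ceil (l - k) + N%:Z)); lia.
have nN : (n <= N.*2)%N by lia.
have -> : N%:R + (Num.ceil (l - k))%:~R = n%:R :> R.
  by rewrite nE rmorphB /= -!pmulrn; ring.
under eq_bigr => j _ do rewrite E nE /centered ltrD2r ltz_nat.
rewrite -natr_sum; congr (_%:R).
have -> : forall M, (n <= M)%N -> (\sum_(j < M) (j < n))%N = n; last by lia.
  elim=> [|M IH]; first by rewrite leqn0 big_ord0 => /eqP ->.
  rewrite big_ord_recr /= leq_eqVlt => /orP[/eqP nM|nM].
    rewrite nM ltnSn (eq_bigr (fun=> 1%N)) ?sum1_card ?card_ord ?addn1 // => j _.
    by rewrite ltnS ltnW.
  by rewrite IH // ltnNge -ltnS nM addn0.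
by [].
Qed.

End Telescoping.

Section LatticeSum.
Variables (R : realType) (V : choiceType) (Gamma : zmodType).
Variable F : periodic_framework R V Gamma.
Variable D : fundamental_data F.
Variables h1 h2 : Gamma.
Hypothesis hB : is_Z2_basis h1 h2.
Variables m1 m2 : 'I_(fd_m D) -> int.

Local Notation act := (fw_act F).
Local Notation p := (fw_p F).
Local Notation pi := (fw_pi F).
Local Notation src := (@src R V Gamma F D).
Local Notation tgt := (@tgt R V Gamma F D).
Local Notation edge_id := (edge_id D).
Local Notation weight := (@weight R V Gamma F D).
Local Notation phi := (@phi R V Gamma F h1 h2).
Local Notation area := (@area R V Gamma F h1 h2).
Local Notation jump := (@jump R V Gamma F D h1 h2).
Local Notation star := (@star R V Gamma F).
Local Notation latt := (latt h1 h2).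

Hypothesis endE : forall b, fd_end b = act (latt (m1 b) (m2 b)) (fd_rep (fd_tgt b)).

Implicit Types (q x y z : plane R) (k l : 'I_(fd_n D)) (u v w : V) (i j : edge_id) (b : 'I_(fd_m D)).
Implicit Types (s : set V -> R) (g : Gamma).

Lemma rep_inj : injective (@fd_rep _ _ _ _ D).
Proof.
move=> k l E; have [k0 [_ kU]] := @fd_repP _ _ _ _ D (fd_rep k).
rewrite -(kU k); last by exists 0; rewrite fw_act0.
by apply: kU; exists 0; rewrite fw_act0.
Qed.

Lemma rep_orbit g k l : act g (@fd_rep _ _ _ _ D k) = fd_rep l -> k = l /\ g = 0.
Proof.
move=> E; have [k0 [_ kU]] := @fd_repP _ _ _ _ D (fd_rep l).
have kl : k = l.
  by rewrite -(kU k); [apply: kU; exists 0; rewrite fw_act0|exists g].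
split=> //; apply: (@act_eq _ _ _ F _ _ (fd_rep l)).
by rewrite fw_act0 -kl E kl.
Qed.

Definition orbit_vector b : plane R := p (fd_end b) - p (fd_rep (fd_src b)).

(** Gradient part of the affine terms of the edges in an orbit; it is the same for all
    of them when the stress is invariant. *)
Definition orbit_force s b y : R := orbit_stress s b * det (orbit_vector b) y.

Section InvariantStress.
Variable s : set V -> R.
Hypotheses (inv : invariant_stress F s) (s0 : forall u, star s u = 0).

Lemma stress_orbit b g : s [set src (b, g); tgt (b, g)] = orbit_stress s b.
Proof.
rewrite /src /tgt /= -act_pair inv //.
by exists (fd_rep (fd_src b)), (fd_end b); split=> //; exact: fd_edge_adj.
Qed.

Lemma weight_orbit_force i z : weight s i z - weight s i 0 = orbit_force s i.1 z.
Proof.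
case: i => b g; rewrite /weight stress_orbit /orbit_force /orbit_vector /=.
rewrite /src /tgt /= !fw_equivariant !orientE /det !coordE /=; ring.
Qed.

(** Equilibrium at the representative of a vertex orbit, regrouped by edge orbits: an
    orbit has one edge that starts there for each source in the vertex orbit, and one
    that ends there for each target. *)
Lemma orbit_balance k y :
  \sum_b orbit_force s b y * ((fd_src b == k)%:R - (fd_tgt b == k)%:R) = 0.
Proof.
pose u := fd_rep k.
pose f1 i := orbit_force s i.1 y * (src i == u)%:R.
pose f2 i := orbit_force s i.1 y * (tgt i == u)%:R.
have E1 : \sum_(i \in [set: edge_id]) f1 i = \sum_b orbit_force s b y * (fd_src b == k)%:R.
  rewrite (@fsum_fin _ _ _ (fun b : 'I_(fd_m D) => (b, 0 : Gamma))).
  - apply: eq_bigr => b _; rewrite /f1 /src /= fw_act0; congr (_ * (nat_of_bool _)%:R).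
    by apply/eqP/eqP => [/rep_inj|->].
  - by move=> b b' [].
  - move=> [b g]; rewrite /f1 /src /=; have [e|_] := eqVneq (act g (fd_rep (fd_src b))) u.
      by case: (rep_orbit e) => _ ->; exists b.
    by rewrite mulr0 eqxx.
have E2 : \sum_(i \in [set: edge_id]) f2 i = \sum_b orbit_force s b y * (fd_tgt b == k)%:R.
  rewrite (@fsum_fin _ _ _ (fun b : 'I_(fd_m D) => (b, - latt (m1 b) (m2 b)))).
  - apply: eq_bigr => b _; rewrite /f2 /tgt /= endE -fw_actD addNr fw_act0.
    by congr (_ * (nat_of_bool _)%:R); apply/eqP/eqP => [/rep_inj|->].
  - by move=> b b' [].
  - move=> [b g]; rewrite /f2 /tgt /= endE -fw_actD.
    have [e|_] := eqVneq (act (g + latt (m1 b) (m2 b)) (fd_rep (fd_tgt b))) u.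
      have [_ gE] := rep_orbit e.
      by exists b; congr (_, _); apply/eqP; rewrite -addr_eq0 gE.
    by rewrite mulr0 eqxx.
have fs z : fin_supp (fun i => weight s i z * ((src i == u)%:R - (tgt i == u)%:R)).
  apply: fin_suppW (ends_finite D u) _ => i.
  have [e|_] := eqVneq (src i) u; first by left.
  have [e|_] := eqVneq (tgt i) u; first by right.
  by rewrite subrr !mulr0 eqxx.
have ff1 : fin_supp f1.
  apply: fin_suppW (ends_finite D u) _ => i.
  by rewrite /f1; have [e|_] := eqVneq (src i) u; [left|rewrite mulr0 eqxx].
have ff2 : fin_supp f2.
  apply: fin_suppW (ends_finite D u) _ => i.
  by rewrite /f2; have [e|_] := eqVneq (tgt i) u; [right|rewrite mulr0 eqxx].
under eq_bigr => b _ do rewrite mulrBr.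
rewrite sumrB -E1 -E2 -fsumN -fsumD //; last exact: fin_suppN.
transitivity (\sum_(i \in [set: edge_id]) (weight s i y * ((src i == u)%:R - (tgt i == u)%:R) +
   - (weight s i 0 * ((src i == u)%:R - (tgt i == u)%:R)))).
  by apply: eq_fsbigr => i _; rewrite /f1 /f2 -weight_orbit_force; ring.
rewrite fsumD //; last exact: fin_suppN.
by rewrite fsumN !star_edges s0 !det0l subrr.
Qed.

(** A function of the vertex orbits gives a coboundary, which is orthogonal to an
    equilibrium stress. *)
Lemma orbit_coboundary (f : 'I_(fd_n D) -> R) y :
  \sum_b orbit_force s b y * (f (fd_src b) - f (fd_tgt b)) = 0.
Proof.
have E l : f l = \sum_k f k * (l == k)%:R.
  rewrite (bigD1 l) //= eqxx mulr1 big1 ?addr0 // => k kl.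
  by rewrite eq_sym (negbTE kl) mulr0.
transitivity (\sum_b \sum_k f k * (orbit_force s b y * ((fd_src b == k)%:R - (fd_tgt b == k)%:R))).
  apply: eq_bigr => b _; rewrite (E (fd_src b)) (E (fd_tgt b)) -sumrB mulr_sumr.
  by apply: eq_bigr => k _; ring.
rewrite exchange_big big1 //= => k _; by rewrite -mulr_sumr orbit_balance mulr0.
Qed.

(** Sum over the edges with a translation in a box that contains the support. *)
Lemma fsum_box (f : edge_id -> R) (N : nat) :
  (forall b m n, f (b, latt m n) != 0 -> (absz m <= N)%N /\ (absz n <= N)%N) ->
  \sum_(i \in [set: edge_id]) f i =
  \sum_b \sum_(k < N.*2.+1) \sum_(j < N.*2.+1) f (b, latt (centered N j) (centered N k)).
Proof.
move=> h.
pose box (c : 'I_(fd_m D) * ('I_(N.*2.+1) * 'I_(N.*2.+1))) : edge_id :=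
  (c.1, latt (centered N c.2.2) (centered N c.2.1)).
rewrite (@fsum_fin _ _ _ box).
- rewrite -(pair_bigA _ (fun b c0 => f (box (b, c0)))); apply: eq_bigr => b _ /=.
  by rewrite -(pair_bigA _ (fun k0 l0 : 'I_(N.*2.+1) => f (box (b, (k0, l0))))).
- move=> [b [k j]] [b' [k' j']] [-> /(latt_inj hB)[e1 e2]].
  by congr (_, (_, _)); apply: val_inj; rewrite /= /centered in e1 e2 *; lia.
- move=> [b g]; have [m [n ->]] := lattP hB g => /h[hm hn].
  have B (l : int) : (absz l <= N)%N -> (absz (l + N%:Z)%R < N.*2.+1)%N /\ (0 <= l + N%:Z)%R by lia.
  have [u1 u2] := B _ hm; have [w1 w2] := B _ hn.
  exists (b, (Ordinal w1, Ordinal u1)).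
  by rewrite /box /centered /= !gez0_abs // !addrK.
Qed.

(** Summed over a lattice row by row, the crossings of the translates of an edge with
    the segment from q to q + pi h1 count the horizontal lattice lines through q that
    lie between the endpoints of the edge. For an edge of the orbit b this number is
    m2 b plus a difference of values of one function at the two vertex orbits, and the
    latter does not contribute by [orbit_coboundary]. *)
Lemma lattice_sum q z : jump s q (q + pi h1) z - jump s q (q + pi h1) 0 =
  - Num.sg area * \sum_b orbit_force s b z * (m2 b)%:~R.
Proof.
have phi1 : phi (q + pi h1) = phi q + (1, 0).
  have -> : pi h1 = pi (latt 1 0) by rewrite /latt mulr1z mulr0z addr0.
  by rewrite phiD (phi_latt _ hB).
pose f i := orbit_force s i.1 z * crossing h1 h2 q (q + pi h1) i.
have -> : jump s q (q + pi h1) z - jump s q (q + pi h1) 0 = \sum_(i \in [set: edge_id]) f i.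
  have X z' : fin_supp (fun i => weight s i z' * crossing h1 h2 q (q + pi h1) i).
    by apply: fin_suppM; exact: crossing_fin_supp.
  rewrite /jump -fsumN -fsumD //; last exact: fin_suppN.
  by apply: eq_fsbigr => i _; rewrite /f -weight_orbit_force; ring.
have [M hM] := in_box_segment F h1 h2 q (q + pi h1).
have [N0 hN0] := Seg_box D hB M.
pose a b := phi (p (fd_rep (fd_src b))); pose c b := phi (p (fd_end b)).
pose d b := phi (p (fd_rep (fd_tgt b))).
pose B : R := \sum_b (`|(phi q).1 - (a b).1| + `|(phi q).1 - (c b).1| +
  (`|(phi q).2 - (a b).2| + `|(phi q).2 - (c b).2| + `|(phi q).2 - (d b).2|)).
(* large enough for the support and for both telescoping sums *)
pose N := (N0 + (Num.trunc B).+1)%N.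
have hB' b : [/\ `|(phi q).1 - (a b).1| <= N%:R, `|(phi q).1 - (c b).1| <= N%:R,
   `|(phi q).2 - (a b).2| <= N%:R, `|(phi q).2 - (c b).2| <= N%:R & `|(phi q).2 - (d b).2| <= N%:R].
  have BN : B <= N%:R.
    rewrite /N natrD; apply: (@le_trans _ _ (Num.trunc B).+1%:R); last by rewrite lerDr.
    exact/ltW/truncnS_gt.
  have : `|(phi q).1 - (a b).1| + `|(phi q).1 - (c b).1| +
    (`|(phi q).2 - (a b).2| + `|(phi q).2 - (c b).2| + `|(phi q).2 - (d b).2|) <= B.
    by rewrite /B (bigD1 b) //= lerDl sumr_ge0 // => b' _; rewrite !addr_ge0.
  have n1 := normr_ge0 ((phi q).1 - (a b).1); have n2 := normr_ge0 ((phi q).1 - (c b).1).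
  have n3 := normr_ge0 ((phi q).2 - (a b).2); have n4 := normr_ge0 ((phi q).2 - (c b).2).
  have n5 := normr_ge0 ((phi q).2 - (d b).2).
  by move=> n6; split; lra.
rewrite (@fsum_box f N); last first.
  move=> b m n; rewrite /f mulf_eq0 negb_or => /andP[_ /(crossing_meets hB)[x [/hM bx ix]]].
  have [k1 k2] := hN0 _ _ _ _ ix bx; rewrite /N; split.
    exact: leq_trans k1 (leq_addr _ _).
  exact: leq_trans k2 (leq_addr _ _).
pose C b : R := (Num.ceil ((phi q).2 - (a b).2))%:~R - (Num.ceil ((phi q).2 - (c b).2))%:~R.
transitivity (\sum_b (orbit_force s b z * (- Num.sg area * C b))).
  apply: eq_bigr => b _.
  have [b1 b2 b3 b4 b5] := hB' b.
  under eq_bigr => k _.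
    under eq_bigr => j _ do
      rewrite /f /crossing src_latt tgt_latt phi1 !phiD !(phi_latt _ hB) mulrA /=.
    rewrite -mulr_sumr row_cross //.
    over.
  by rewrite -mulr_sumr sumrB !count_centered // -mulrA /C; ring.
have cE b : C b = ((Num.ceil ((phi q).2 - (a b).2))%:~R - (Num.ceil ((phi q).2 - (d b).2))%:~R)
   + (m2 b)%:~R.
  have dE : (c b).2 = (d b).2 + (m2 b)%:~R.
    by rewrite /c endE fw_equivariant phiD (phi_latt _ hB).
  have qE : (phi q).2 - (c b).2 = (phi q).2 - (d b).2 + (- m2 b)%:~R.
    by rewrite dE rmorphN /=; ring.
  by rewrite /C qE [Num.ceil (_ + _%:~R)]ceilDrz ?intr_int // intrKceil rmorphD /= rmorphN /=; ring.
rewrite mulr_sumr.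
pose f' l : R := (Num.ceil ((phi q).2 - (phi (p (@fd_rep _ _ _ _ D l))).2))%:~R.
transitivity (- Num.sg area * \sum_b (orbit_force s b z * (f' (fd_src b) - f' (fd_tgt b))) +
  \sum_b - Num.sg area * (orbit_force s b z * (m2 b)%:~R)).
  rewrite mulr_sumr -big_split; apply: eq_bigr => b _ /=; rewrite cE /f' /a /d; ring.
by rewrite orbit_coboundary mulr0 add0r.
Qed.

End InvariantStress.
End LatticeSum.

(** * The stress of a periodic lifting is periodic *)

Section InducedStress.
Variables (R : realType) (V : choiceType) (Gamma : zmodType).
Variable F : periodic_framework R V Gamma.
Variable D : fundamental_data F.
Hypothesis NC : noncrossing F.

Local Notation adj := (fw_adj F).
Local Notation act := (fw_act F).
Local Notation p := (fw_p F).
Local Notation pi := (fw_pi F).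
Local Notation skel := (skeleton F).

Implicit Types (a d q x y z : plane R) (k l r t e : R) (u v w : V).
Implicit Types (H L : plane R -> R) (s : set V -> R) (g : Gamma).

Lemma left_face_germ W u v H n C x : left_face F W u v -> affine_on H W n C ->
  open_segment (p u) (p v) x ->
  \forall t \near (0 : R)^'+, germ H (x + t *: perp (p v - p u)) (fun z => dotp n z + C).
Proof.
move=> [fW lW] aH ox; apply: filterS (lW _ ox) => t; exact: (face_germ D fW aH).
Qed.

Lemma parallel_perp n a : a != 0 -> dotp n a = 0 ->
  n = (dotp n (perp a) / dotp a a) *: perp a.
Proof.
move=> a0 na; have aa := dotp_gt0 a0; have aa0 : dotp a a != 0 by rewrite gt_eqF.
by apply: eq_plane; rewrite !coordE; apply: (mulIf aa0);
  rewrite mulrAC divfK //; move: na; rewrite /dotp /perp /= => na;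
  [have := congr1 ( *%R a.1) na|have := congr1 ( *%R a.2) na]; lra.
Qed.

(** The two affine functions agree along the edge, so the difference of their gradients
    is orthogonal to it. *)
Lemma stress_exists H : is_lifting F H -> exists s, induced_stress F H s.
Proof.
move=> lH; have [cH aH] := lH.
pose P u v k := exists W U nW nU CW CU, [/\ left_face F W u v, left_face F U v u,
  affine_on H W nW CW, affine_on H U nU CU & nW - nU = k *: perp (p v - p u)].
have PC u v k : P u v k -> P v u k.
  move=> [W [U [nW [nU [CW [CU [lW lU aW aU E]]]]]]].
  exists U, W, nU, nW, CU, CW; split=> //.
  by rewrite -opprB E -scalerN; congr (_ *: _); apply: eq_plane; rewrite /perp !coordE /=; ring.
have Pex u v : adj u v -> exists k, P u v k.
  move=> uv; have [W lW] := left_face_exists D NC uv.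
  have vu : adj v u by rewrite fw_sym.
  have [U lU] := left_face_exists D NC vu.
  have [nW [CW aW]] := aH _ lW.1; have [nU [CU aU]] := aH _ lU.1.
  eexists; exists W, U, nW, nU, CW, CU; split=> //.
  apply: parallel_perp; first exact: edge_vec_neq0 uv.
  have onE r : 0 < r < 1 -> dotp nW (p u + r *: (p v - p u)) + CW =
      dotp nU (p u + r *: (p v - p u)) + CU.
    move=> /andP[r0 r1].
    rewrite -(left_face_value cH lW aW); last by exists r => //=; rewrite r0.
    rewrite -(left_face_value cH lU aU) //; exists (1 - r).
      by apply/andP; split; lra.
    by apply: eq_plane; rewrite !coordE; ring.
  have := onE (1 / 2) ltac:(apply/andP; split; lra).
  have := onE (1 / 3) ltac:(apply/andP; split; lra).
  rewrite /dotp !coordE; lra.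
pose Q (e0 : set V) k := exists u v, [/\ adj u v, e0 = [set u; v] & P u v k].
exists (fun e0 : set V => xget 0 [set k | Q e0 k]) => u v uv.
have [k0 Pk0] := Pex _ _ uv.
have : exists k, Q [set u; v] k by exists k0, u, v.
move=> /(@xgetPex _ 0 [set k | Q [set u; v] k]) [u' [v' [uv' E Pk]]].
case: (set2_eq E) => -[e1 e2]; subst u' v'; first exact: Pk.
exact: PC.
Qed.

Lemma orient_left u v : adj u v -> orient (p u) (p v) (p u + perp (p v - p u)) != 0.
Proof.
move=> uv; have := orient_perp (p u) (p v) (p u) 1; rewrite scale1r => ->.
by rewrite (orient_segment (segmentl _ _)) add0r mul1r gt_eqF // dotp_gt0 // edge_vec_neq0.
Qed.

Lemma stress_unique H s s' u v : is_lifting F H -> induced_stress F H s ->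
  induced_stress F H s' -> adj u v -> s [set u; v] = s' [set u; v].
Proof.
move=> lH iH iH' uv; have vu : adj v u by rewrite fw_sym.
have [W [U [nW [nU [CW [CU [lW lU aW aU E]]]]]]] := edge_jump lH iH uv.
have [W' [U' [nW' [nU' [CW' [CU' [lW' lU' aW' aU' E']]]]]]] := edge_jump lH iH' uv.
have [t1 [g1 g1']] := filter_ex (filterI (left_face_germ lW aW (mid_open F u v))
  (left_face_germ lW' aW' (mid_open F u v))).
have [t2 [g2 g2']] := filter_ex (filterI (left_face_germ lU aU (mid_open F v u))
  (left_face_germ lU' aU' (mid_open F v u))).
apply: (mulIf (orient_left uv)).
by rewrite -E -E' (germ_uniq g1 g1') (germ_uniq g2 g2').
Qed.

Lemma affine_shift L d : affine_fun L -> affine_fun (fun z => L (z - d)).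
Proof.
move=> [n [C E]]; exists n, (C - dotp n d) => z; rewrite E /dotp !coordE; ring.
Qed.

Lemma germ_shift H q L d : (forall x, H (x + d) = H x) -> germ H q L ->
  germ H (q + d) (fun z => L (z - d)).
Proof.
move=> hd [aL hL]; split; first exact: affine_shift.
have c : y - d @[y --> q + d] --> q + d - d.
  by apply: cvgB; [exact: cvg_id|apply: cvg_cst].
rewrite addrK in c.
have N : \forall y \near q + d, H (y - d) = L (y - d) := c _ hL.
by apply: filterS N => y <-; rewrite -(hd (y - d)) subrK.
Qed.

Lemma open_segment_shift a d x y : open_segment a d x -> open_segment (a + y) (d + y) (x + y).
Proof.
by move=> [t t01 <-]; exists t => //; apply: eq_plane; rewrite !coordE; ring.
Qed.

(** Translating H by a period translates its germs on both sides of the edge. *)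
Lemma stress_invariant H s : periodic_lifting F H -> induced_stress F H s ->
  invariant_stress F s.
Proof.
move=> [lH pH] iH e g [u [v [uv ->]]]; rewrite act_pair.
have guv : adj (act g u) (act g v) by rewrite fw_act_adj.
have [W [U [nW [nU [CW [CU [lW lU aW aU E]]]]]]] := edge_jump lH iH uv.
have [W' [U' [nW' [nU' [CW' [CU' [lW' lU' aW' aU' E']]]]]]] := edge_jump lH iH guv.
have key u' v' A A' n n' C C' : left_face F A u' v' -> affine_on H A n C ->
    left_face F A' (act g u') (act g v') -> affine_on H A' n' C' ->
    forall z, dotp n' z + C' = dotp n (z - pi g) + C.
  move=> lA aA lA' aA' z.
  have ox := open_segment_shift (pi g) (mid_open F u' v').
  rewrite -!fw_equivariant in ox.
  have [t [g1 g2]] := filter_ex (filterI (left_face_germ lA aA (mid_open F u' v'))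
    (left_face_germ lA' aA' ox)).
  have g3 := germ_shift (pH ^~ g) g1.
  have pE : p u' + 2^-1 *: (p v' - p u') + t *: perp (p v' - p u') + pi g =
      p u' + 2^-1 *: (p v' - p u') + pi g + t *: perp (p (act g v') - p (act g u')).
    by apply: eq_plane; rewrite /perp !fw_equivariant !coordE /= ?coordE /=; ring.
  by rewrite pE in g3; exact: (germ_uniq g2 g3 z).
apply: (mulIf (orient_left guv)); rewrite -E'.
rewrite (key _ _ _ _ _ _ _ _ lW aW lW' aW') (key _ _ _ _ _ _ _ _ lU aU lU' aU') E.
by congr (_ * _); rewrite !orientE /perp !fw_equivariant !coordE /=; ring.
Qed.

Section Direction.
Variables h1 h2 : Gamma.
Hypothesis hB : is_Z2_basis h1 h2.
Variables m1 m2 : 'I_(fd_m D) -> int.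
Hypothesis endE : forall b, fd_end b = act (latt h1 h2 (m1 b) (m2 b)) (fd_rep (fd_tgt b)).

Lemma generic_period : exists q, ~ skel q /\ forall t v, q + t *: pi h1 <> p v.
Proof.
have l0 : perp (pi h1) <> 0.
  apply: perp_neq0 => l0; have := area_neq0 F hB.
  by rewrite /area l0 det0l eqxx.
have [q [_ nq h _]] := @generic_point _ _ _ F D h1 h2 hB (fun=> perp (pi h1))
  (fun=> perp (pi h1)) (fun v => dotp (perp (pi h1)) (p v))
  (fun v => dotp (perp (pi h1)) (p v)) 0 1 (fun=> l0) (fun=> l0) ltr01.
exists q; split=> // t v E; apply: (h v); rewrite -E /dotp /perp !coordE /=; ring.
Qed.

Lemma skel_shift q g : skel (q + pi g) -> skel q.
Proof.
move=> [[v E]|[u [v [uv [t t01 E]]]]].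
  left; exists (act (- g) v); rewrite fw_equivariant -E raddfN /= addrK //.
right; exists (act (- g) u), (act (- g) v); rewrite fw_act_adj; split=> //.
exists t => //; rewrite !fw_equivariant raddfN /=.
by apply: (addIr (pi g)); rewrite -E; apply: eq_plane; rewrite !coordE; ring.
Qed.

(** The crossing formula along a line of direction pi h1, combined with
    [lattice_sum]; subtracting the values at 0 isolates the gradients. *)
Lemma period_jump H s q L L' z : is_lifting F H -> induced_stress F H s ->
  invariant_stress F s -> ~ skel q -> (forall t v, q + t *: pi h1 <> p v) ->
  germ H q L -> germ H (q + pi h1) L' ->
  L' z - L z - (L' 0 - L 0) =
  - Num.sg (area F h1 h2) * \sum_b orbit_force s b z * (m2 b)%:~R.
Proof.
move=> lH iH inv nq h gL gL'.
have s0 u := lifting_star0 D hB NC lH iH u.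
rewrite -(lattice_sum hB endE inv s0 q z).
have nq' : ~ skel (q + pi h1) by move=> /skel_shift.
have ea : q + 0 *: pi h1 = q by rewrite scale0r addr0.
have eb : q + 1 *: pi h1 = q + pi h1 by rewrite scale1r.
have := @crossing_formula _ _ _ F D h1 h2 hB NC H s q (pi h1) lH iH h 0 1.
by rewrite ea eb => J; rewrite !(J nq nq' _ _ gL gL').
Qed.

(** For a periodic H the gradients at q and at q + pi h1 are equal. *)
Lemma lifting_orbit_sum H s z : periodic_lifting F H -> induced_stress F H s ->
  \sum_b orbit_force s b z * (m2 b)%:~R = 0.
Proof.
move=> pH iH; have [q [nq h]] := generic_period.
have [L gL] := lifting_germ D pH.1 nq.
have gL' := germ_shift (pH.2 ^~ h1) gL.
have := period_jump z pH.1 iH (stress_invariant pH iH) nq h gL gL'.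
have [n [C LE]] := gL.1.
have -> : L (z - pi h1) - L z - (L (0 - pi h1) - L 0) = 0.
  by rewrite !LE /dotp !coordE /=; ring.
move=> /esym/eqP; rewrite mulf_eq0 oppr_eq0 sgr_eq0 (negbTE (area_neq0 F hB)) /=.
by move=> /eqP.
Qed.

End Direction.

Lemma basisC (h1 h2 : Gamma) : is_Z2_basis h1 h2 -> is_Z2_basis h2 h1.
Proof.
move=> [f fK Kf]; exists (fun g => ((f g).2, (f g).1)).
- by move=> [m n] /=; have := fK (n, m); rewrite /= addrC => ->.
- by move=> g /=; rewrite addrC; exact: Kf.
Qed.

Lemma fd_endE (b : 'I_(fd_m D)) :
  fd_end b = act (latt (fd_g1 D) (fd_g2 D) (fd_c b).1 (fd_c b).2) (fd_rep (fd_tgt b)).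
Proof. by []. Qed.

Lemma fd_endEC (b : 'I_(fd_m D)) :
  fd_end b = act (latt (fd_g2 D) (fd_g1 D) (fd_c b).2 (fd_c b).1) (fd_rep (fd_tgt b)).
Proof. by rewrite fd_endE /latt addrC. Qed.

Lemma edge_vectorE (b : 'I_(fd_m D)) : edge_vector b = orbit_vector b.
Proof. by rewrite /edge_vector /orbit_vector fd_endE fw_equivariant pi_latt !scaler_int. Qed.

Lemma det_eq0 (a : plane R) : (forall z, det a z = 0) -> a = 0.
Proof.
move=> h; have := h (1, 0); have := h (0, 1); rewrite /det /= => h1 h2.
by apply: eq_plane => /=; lra.
Qed.

Lemma orbit_sum_det s (m : 'I_(fd_m D) -> int) z :
  det (\sum_b (orbit_stress s b * (m b)%:~R) *: edge_vector b) z =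
  \sum_b orbit_force s b z * (m b)%:~R.
Proof.
rewrite (big_morph (fun a => det a z) (id1 := 0) (op1 := +%R)).
- by apply: eq_bigr => b _; rewrite edge_vectorE /orbit_force /det !coordE; ring.
- by move=> a b; rewrite /det !coordE; ring.
- exact: det0l.
Qed.

Lemma lifting_periodic_stress H s : periodic_lifting F H -> induced_stress F H s ->
  periodic_stress D s.
Proof.
move=> pH iH; have hB := fd_gens D; split.
- move=> u; exact: (lifting_star0 D hB NC pH.1 iH u).
- exact: stress_invariant pH iH.
- apply: det_eq0 => z; rewrite orbit_sum_det.
  exact: (lifting_orbit_sum (basisC hB) fd_endEC z pH iH).
- apply: det_eq0 => z; rewrite orbit_sum_det.
  exact: (lifting_orbit_sum hB fd_endE z pH iH).
Qed.

End InducedStress.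

(** * The lifting of an equilibrium stress *)

Section Construction.
Variables (R : realType) (V : choiceType) (Gamma : zmodType).
Variable F : periodic_framework R V Gamma.
Variable D : fundamental_data F.
Hypothesis NC : noncrossing F.
Variables h1 h2 : Gamma.
Hypothesis hB : is_Z2_basis h1 h2.
Variable s : set V -> R.
Hypothesis s0 : forall u, @star R V Gamma F s u = 0.

Local Notation adj := (fw_adj F).
Local Notation act := (fw_act F).
Local Notation p := (fw_p F).
Local Notation pi := (fw_pi F).
Local Notation skel := (skeleton F).
Local Notation Seg := (@Seg R V Gamma F D).
Local Notation src := (@src R V Gamma F D).
Local Notation tgt := (@tgt R V Gamma F D).
Local Notation edge_id := (edge_id D).
Local Notation wgt := (weight s).
Local Notation jmp := (jump D h1 h2 s).
Local Notation xng := (crossing h1 h2).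

Implicit Types (a b c d q x y z : plane R) (k r t e : R) (u v w : V) (i j : edge_id).
Implicit Types (g : Gamma) (W U : set (plane R)).

(** The affine function of the lifting at q, normalized to vanish at the origin. *)
Definition piece q z : R := jmp 0 q z.
(** Each point is evaluated with its own affine function; no choice of faces enters,
    and the formula also covers the points of the skeleton. *)
Definition stress_lift q : R := piece q q.

Lemma pieceE a b z : piece b z = piece a z + jmp a b z.
Proof. by rewrite /piece (jump_triangle0 D hB 0 a b z s0). Qed.

Lemma affine_weight i : affine_fun (wgt i).
Proof. exact: affine_funZ (affine_orient _ _). Qed.

Lemma affine_jump a b : affine_fun (jmp a b).
Proof.
have [f fE] : exists f : edge_id -> plane R * R, forall i z, wgt i z = dotp (f i).1 z + (f i).2.
  have /choice [f fE] : forall i, exists c : plane R * R, forall z, wgt i z = dotp c.1 z + c.2.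
    by move=> i; have [n [C E]] := affine_weight i; exists (n, C).
  by exists f.
have ff := crossing_fin_supp D hB a b.
exists (\sum_(i \in [set: edge_id]) (f i).1.1 * xng a b i,
    \sum_(i \in [set: edge_id]) (f i).1.2 * xng a b i),
  (\sum_(i \in [set: edge_id]) (f i).2 * xng a b i) => z.
have M (f1 : edge_id -> R) : fin_supp (fun i => f1 i * xng a b i) by exact: fin_suppM.
rewrite /dotp /= ![_ * z.1]mulrC ![_ * z.2]mulrC -!fsumZ.
have M' k (f1 : edge_id -> R) : fin_supp (fun i => k * (f1 i * xng a b i)).
  exact: (fin_suppM (fun=> k) (M f1)).
rewrite -!fsumD; try (by [exact: M'|exact: M|apply: fin_suppD; exact: M']).
by apply: eq_fsbigr => i _; rewrite fE /dotp; ring.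
Qed.

Lemma affine_piece q : affine_fun (piece q).
Proof. exact: affine_jump. Qed.

Lemma piece_near q : ~ skel q -> \forall y \near q, ~ skel y /\ forall z, piece y z = piece q z.
Proof.
move=> nq; have : nbhs q (~` skel).
  by apply: open_nbhs_nbhs; split => //; apply: open_off_skeleton (fd_gens D).
move=> /nbhs_ballP[e e0 h]; apply/nbhs_ballP; exists e => // y qy.
split; first exact: h; move=> z; rewrite (pieceE q) jump_off ?addr0 //.
by apply: subset_trans h; apply: convex_ball => //; exact: ballxx.
Qed.

Lemma lift_germ q : ~ skel q -> germ stress_lift q (piece q).
Proof.
move=> nq; split; first exact: affine_piece.
by apply: filterS (piece_near nq) => y [_ h]; rewrite /stress_lift h.
Qed.

(** The affine function is locally constant off the skeleton, and faces are connected. *)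
Lemma piece_face W x y z : faces F W -> W x -> W y -> piece x z = piece y z.
Proof.
move=> fW Wx Wy; have [q _ WE] := fW.
pose B := [set c | W c /\ forall z, piece c z = piece x z].
suff BW : B = W by have [_ ->] : B y by rewrite BW.
have cW : connected W by rewrite -WE; exact: component_connected.
have oW := face_open D fW.
have nW c : W c -> \forall c' \near c, W c' /\ forall z, piece c' z = piece c z.
  move=> Wt; apply: filterS2 (piece_near (face_off fW Wt)) (open_nbhs_nbhs (conj oW Wt)).
  by move=> t' [_ h] ?.
apply: cW.
- by exists x.
- exists B; last by apply/seteqP; split=> [t [? ?]|t [_ ?]].
  rewrite openE => t [Wt ht]; apply: filterS (nW _ Wt) => t' [Wt' ht'].
  by split=> // z'; rewrite ht' ht.
- exists (closure B); first exact: closed_closure.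
  apply/seteqP; split=> [t bt|t [Wt ct]].
    by split; [case: bt|exact: subset_closure].
  split=> // z'; have [t' [[_ h'] [_ h]]] := ct _ (nW _ Wt).
  by rewrite -h h'.
Qed.

Lemma weight_end q i : Seg i q -> wgt i q = 0.
Proof. by move=> iq; rewrite /weight (orient_segment iq) mulr0. Qed.

Lemma sum_small (l : seq edge_id) q e : (forall i, i \in l -> Seg i q) -> 0 < e ->
  \forall y \near q, \sum_(i <- l) 4 * `|wgt i y| <= e.
Proof.
elim: l e => [|i l IH] e hl e0.
  by apply: filterE => y; rewrite big_nil ltW.
have e2 : 0 < e / 2 by lra.
have hl' j : j \in l -> Seg j q by move=> jl; apply: hl; rewrite in_cons jl orbT.
have IH' := IH (e / 2) hl' e2.
have iq : Seg i q by apply: hl; rewrite mem_head.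
have /cvgrPdist_le := affine_continuous (affine_weight i) (x := q).
have e8 : 0 < e / 8 by lra.
move=> /(_ _ e8) N; apply: filterS2 IH' N => y y1.
by rewrite weight_end // sub0r normrN big_cons; lra.
Qed.

(** Close to q only the edges through q can be crossed; their affine terms vanish at q
    and the crossing numbers are bounded. *)
Lemma jump_small q e : 0 < e -> \forall y \near q, `|jmp q y y| <= e.
Proof.
move=> e0; have [M M0 hM] := near_box F h1 h2 q.
have fT := touching_finite D hB M.
have fS : finite_set [set i | Seg i q].
  by apply: sub_finite_set fT => i iq; exists q => //; exact: (nbhs_singleton hM).
have N := near_Seg D hB q.
have Q : \forall y \near q, \sum_(i <- fset_set [set i | Seg i q]) 4 * `|wgt i y| <= e.
  by apply: sum_small => // i; rewrite in_fset_set // => /set_mem.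
have /nbhs_ballP[r r0 h] := N.
have B : nbhs q (ball q r) by exact: nbhsx_ballx.
apply: filterS2 Q B => y Qy qy; apply: le_trans Qy.
rewrite /jump.
rewrite (@fsum_set _ _ [set i | Seg i q]) //; last first.
  move=> i; rewrite mulf_eq0 negb_or => /andP[_ /(crossing_meets hB)[x [qyx ix]]].
  apply: (h x) => //; apply: (convex_ball (ballxx q r0) qy qyx).
rewrite fsbig_finite //=; apply: le_trans (ler_norm_sum _ _ _) _.
apply: ler_sum => i _; rewrite normrM mulrC ler_wpM2r //; exact: crossing_bound.
Qed.

(** Around any point q, also on the skeleton, the lifting is [piece q] plus a jump that
    tends to 0. *)
Lemma lift_continuous : continuous stress_lift.
Proof.
move=> q; apply/cvgrPdist_le => e e0.
have e2 : 0 < e / 2 by lra.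
have /cvgrPdist_le /(_ _ e2) N := affine_continuous (affine_piece q) (x := q).
apply: filterS2 N (jump_small q e2) => y y1 y2.
rewrite /stress_lift (pieceE q y y) opprD addrA.
apply: le_trans (ler_normB _ _) _; lra.
Qed.

Lemma lift_is_lifting : is_lifting F stress_lift.
Proof.
split; first exact: lift_continuous.
move=> W fW; have [q nq WE] := fW; have Wq : W q.
  by rewrite -WE; exact: connected_component_refl.
have [n [C E]] := affine_piece q; exists n, C => x Wx.
by rewrite /stress_lift (piece_face x fW Wx Wq) E.
Qed.

(** Near an interior point of an edge a short segment across it crosses no other edge. *)
Lemma edge_pieces u v x e a b z : adj u v -> open_segment (p u) (p v) x -> 0 < e ->
  (forall y i, ball x e y -> Seg i y -> [set src i; tgt i] = [set u; v]) ->
  ball x e a -> ball x e b -> segment a b x ->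
  orient (p u) (p v) a < 0 -> 0 < orient (p u) (p v) b ->
  piece b z - piece a z = s [set u; v] * orient (p u) (p v) z.
Proof.
move=> uv ox e0 h xa xb abx oa ob.
rewrite (pieceE a b) addrC addKr.
have [i iE] := edge_index D uv.
have iS : [set src i; tgt i] = [set u; v].
  by case: iE => [[-> ->]|[-> ->]] //; rewrite set2C.
rewrite (@jump_one _ _ _ _ _ _ _ s a b z i); last first.
  move=> j ji; apply/eqP; apply: contraT => /(crossing_meets hB)[y [aby jy]].
  by case: ji; apply: edge_set_inj; rewrite iS (h y) //; exact: (convex_ball xa xb).
rewrite /weight iS.
case: iE => [[e1 e2]|[e1 e2]]; rewrite e1 e2.
  by rewrite (@crossing_right_left _ _ _ _ _ _ _ hB a b i x) ?e1 ?e2 ?mulr1.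
have ox' : open_segment (p v) (p u) x.
  move: ox => [t /= /andP[t0 t1] <-]; exists (1 - t); first by apply/andP; split; lra.
  by apply: eq_plane; rewrite !coordE; ring.
rewrite crossing_anti (@crossing_right_left _ _ _ _ _ _ _ hB b a i x) ?e1 ?e2 //.
- by rewrite orientC; ring.
- by rewrite orientC; lra.
- by rewrite orientC; lra.
- by rewrite segmentC.
Qed.

Lemma lift_induced : induced_stress F stress_lift s.
Proof.
move=> u v uv; have vu : adj v u by rewrite fw_sym.
have [W lW] := left_face_exists D NC uv; have [U lU] := left_face_exists D NC vu.
have [_ aff] := lift_is_lifting.
have [nW [CW aW]] := aff _ lW.1; have [nU [CU aU]] := aff _ lU.1.
exists W, U, nW, nU, CW, CU; split=> //.
have ox := mid_open F u v; set x := (p u + _) in ox.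
have ox' : open_segment (p v) (p u) x.
  by exists 2^-1; [apply/andP; split; lra|apply: eq_plane; rewrite /x !coordE; field].
have [e e0 h] := near_edge D NC uv ox.
have hs y : ball x e y -> skel y -> segment (p u) (p v) y.
  move=> xy /(skeletonE D)[i iy]; have := set2_eq (h _ _ xy iy).
  by move=> [[<- <-]|[<- <-]] //; rewrite segmentC.
have hs' y : ball x e y -> skel y -> segment (p v) (p u) y.
  by rewrite segmentC; exact: hs.
have N1 := near_left_half uv (orient_segment (open_segmentW ox)) (ballxx x e0).
have N2 := near_left_half vu (orient_segment (open_segmentW ox')) (ballxx x e0).
have [t [[b1 a1] t0]] := filter_ex (filterI (filterI N1 N2) (nbhs_right_gt (0 : R))).
set b := x + _ in b1; set a := x + _ in a1.
have Wb := left_face_half uv lW ox e0 hs b1.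
have Ua := left_face_half vu lU ox' e0 hs' a1.
have J z : dotp nW z + CW - (dotp nU z + CU) = s [set u; v] * orient (p u) (p v) z.
  rewrite -(@edge_pieces u v x e a b z) //.
  - rewrite (germ_uniq (face_germ D lW.1 aW Wb) (lift_germ (face_off lW.1 Wb))).
    by rewrite (germ_uniq (face_germ D lU.1 aU Ua) (lift_germ (face_off lU.1 Ua))).
  - by case: a1.
  - by case: b1.
  - exists 2^-1; first by apply/andP; split; lra.
    by apply: eq_plane; rewrite /a /b /perp !coordE /= ?coordE /=; field.
  - by case: a1 => _ /=; rewrite orientC; lra.
  - by case: b1.
have J0 := J (0, 0); have J1 := J (1, 0); have J2 := J (0, 1).
move: J0 J1 J2; rewrite !orientE /dotp /perp /= => J0 J1 J2.
by apply: eq_plane; rewrite !coordE /=; lra.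
Qed.

Hypothesis inv : invariant_stress F s.

(** Translation permutes the edges within each orbit. *)
Lemma jump_shift g q q' z : jmp (q + pi g) (q' + pi g) (z + pi g) = jmp q q' z.
Proof.
pose f i : edge_id := (i.1, g + i.2).
have f_bij : set_bij [set: edge_id] [set: edge_id] f.
  split=> //.
  - by move=> [b g1] [b' g2] _ _ [-> /addrI ->].
  - by move=> [b g1] _; exists (b, g1 - g) => //; rewrite /f /= addrC subrK.
rewrite /jump (reindex_fsbig _ _ _ _ f_bij).
apply: eq_fsbigr => -[b g1] _.
have sE : src (f (b, g1)) = act g (src (b, g1)) by rewrite /src /f /= fw_actD.
have tE : tgt (f (b, g1)) = act g (tgt (b, g1)) by rewrite /tgt /f /= fw_actD.
congr (_ * _).
  rewrite /weight sE tE -act_pair inv; last first.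
    by exists (src (b, g1)), (tgt (b, g1)); split=> //; exact: adj_src_tgt.
  by congr (_ * _); rewrite !fw_equivariant !orientE !coordE; ring.
by rewrite /crossing sE tE !fw_equivariant !phiD cross_trans.
Qed.

(** Once the gradients at q and q + pi g agree, the increment by pi g is the same at all
    points, since the jumps between any two points are the same after translation. *)
Lemma increment_piece g q z q' z' : (forall z z', piece (q + pi g) z - piece q z =
    piece (q + pi g) z' - piece q z') ->
  piece (q' + pi g) (z' + pi g) - piece q' z' = piece (q + pi g) (z + pi g) - piece q z.
Proof.
move=> h; rewrite (pieceE (q + pi g) (q' + pi g)) (pieceE q q') jump_shift.
have [n [C E]] := affine_piece q.
have [n' [C' E']] := affine_piece (q + pi g).
have := h (z' + pi g) (z + pi g); rewrite !E !E' /dotp !coordE; lra.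
Qed.

End Construction.

(** * Periodicity and uniqueness of the lifting *)

Section PeriodicLiftings.
Variables (R : realType) (V : choiceType) (Gamma : zmodType).
Variable F : periodic_framework R V Gamma.
Variable D : fundamental_data F.
Hypothesis NC : noncrossing F.

Local Notation act := (fw_act F).
Local Notation pi := (fw_pi F).
Local Notation skel := (skeleton F).

Implicit Types (a b c d q x y z : plane R) (k r t e : R) (u v w : V).
Implicit Types (H L : plane R -> R) (s : set V -> R) (g : Gamma).

(** By the crossing formula the difference of the affine functions is the same at all
    points joined to a fixed one by a line that avoids the vertices. These points are
    dense. *)
Lemma same_stress_affine H H' s : is_lifting F H -> is_lifting F H' ->
  induced_stress F H s -> induced_stress F H' s ->
  exists2 L, affine_fun L & forall q, H' q = H q + L q.
Proof.
move=> lH lH' iH iH'; have hB := fd_gens D.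
have [a _ na] := off_skeleton D hB 0 (@ltr01 R).
have [La ga] := lifting_germ D lH na; have [La' ga'] := lifting_germ D lH' na.
pose L z := La' z - La z.
have aL : affine_fun L by exact: affine_funB ga'.1 ga.1.
exists L => // q; apply: contrapT => ne.
pose d z := H' z - (H z + L z).
have cd : continuous d.
  move=> z; apply: cvgB; first exact: lH'.1.
  by apply: cvgD; [exact: lH.1|exact: affine_continuous].
have dq : 0 < `|d q| by rewrite normr_gt0 subr_eq0; apply/eqP.
have /cvgrPdist_lt /(_ _ dq) /nbhs_ballP[e e0 he] := cd q.
have [b [qb nb ab _]] := generic_lines D hB q na na e0.
have [Lb gb] := lifting_germ D lH nb; have [Lb' gb'] := lifting_germ D lH' nb.
have J := crossing_segment D hB NC lH iH b na nb ab ga gb.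
have J' := crossing_segment D hB NC lH' iH' b na nb ab ga' gb'.
have := he _ qb; rewrite /= (_ : d b = 0) ?subr0 ?ltxx //.
rewrite /d (nbhs_singleton gb.2) (nbhs_singleton gb'.2) /L; lra.
Qed.

(** The gradient is orthogonal to two independent periods. *)
Lemma affine_periodic L : affine_fun L -> (forall q g, L (q + pi g) = L q) ->
  exists c : R, forall q, L q = c.
Proof.
move=> [n [C E]] h; have A := area_neq0 F (fd_gens D).
exists C => q; rewrite E.
have n1 := h 0 (fd_g1 D); have n2 := h 0 (fd_g2 D).
have z1 : n.1 * area F (fd_g1 D) (fd_g2 D) = 0.
  move: n1 n2; rewrite !E /dotp /area /det !coordE /= => n1 n2.
  have k1 : n.1 * (pi (fd_g1 D)).1 + n.2 * (pi (fd_g1 D)).2 = 0 by lra.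
  have k2 : n.1 * (pi (fd_g2 D)).1 + n.2 * (pi (fd_g2 D)).2 = 0 by lra.
  have := congr1 ( *%R (pi (fd_g2 D)).2) k1; have := congr1 ( *%R (pi (fd_g1 D)).2) k2; lra.
have z2 : n.2 * area F (fd_g1 D) (fd_g2 D) = 0.
  move: n1 n2; rewrite !E /dotp /area /det !coordE /= => n1 n2.
  have k1 : n.1 * (pi (fd_g1 D)).1 + n.2 * (pi (fd_g1 D)).2 = 0 by lra.
  have k2 : n.1 * (pi (fd_g2 D)).1 + n.2 * (pi (fd_g2 D)).2 = 0 by lra.
  have := congr1 ( *%R (pi (fd_g2 D)).1) k1; have := congr1 ( *%R (pi (fd_g1 D)).1) k2; lra.
have {}z1 : n.1 = 0 by apply: (mulIf A); rewrite z1 mul0r.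
have {}z2 : n.2 = 0 by apply: (mulIf A); rewrite z2 mul0r.
by rewrite /dotp z1 z2; ring.
Qed.

Lemma periodic_unique H H' s : periodic_lifting F H -> periodic_lifting F H' ->
  induced_stress F H s -> induced_stress F H' s -> exists c : R, forall q, H' q = H q + c.
Proof.
move=> [lH pH] [lH' pH'] iH iH'.
have [L aL E] := same_stress_affine lH lH' iH iH'.
have [q g|c cE] := affine_periodic aL.
  by have := E (q + pi g); rewrite pH pH' (E q) => /addrI.
by exists c => q; rewrite E cE.
Qed.

Lemma lifting_add H L : is_lifting F H -> affine_fun L -> is_lifting F (fun q => H q + L q).
Proof.
move=> [cH aH] aL; split.
  by move=> q; apply: cvgD; [exact: cH|exact: affine_continuous].
move=> U /aH[n [C E]]; have [n' [C' E']] := aL.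
exists (n + n'), (C + C') => q Uq; rewrite (E q Uq) E' /dotp !coordE; ring.
Qed.

Lemma induced_add H L s : induced_stress F H s -> affine_fun L ->
  induced_stress F (fun q => H q + L q) s.
Proof.
move=> iH [n' [C' E']] u v uv.
have [W [U [nW [nU [CW [CU [lW lU aW aU E]]]]]]] := iH _ _ uv.
exists W, U, (nW + n'), (nU + n'), (CW + C'), (CU + C'); split=> //.
- by move=> q Wq; rewrite (aW q Wq) E' /dotp !coordE; ring.
- by move=> q Uq; rewrite (aU q Uq) E' /dotp !coordE; ring.
- by rewrite -E; apply: eq_plane; rewrite !coordE; ring.
Qed.

(** The linear function takes the values - k1 and - k2 at the two generators. *)
Lemma make_periodic H k1 k2 : (forall q, H (q + pi (fd_g1 D)) = H q + k1) ->
  (forall q, H (q + pi (fd_g2 D)) = H q + k2) ->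
  exists2 L, affine_fun L & forall q g, H (q + pi g) + L (q + pi g) = H q + L q.
Proof.
move=> e1 e2; have hB := fd_gens D; have A := area_neq0 F hB.
pose f := phi F (fd_g1 D) (fd_g2 D).
have f1 q : f (q + pi (fd_g1 D)) = f q + (1, 0).
  have -> : pi (fd_g1 D) = pi (latt (fd_g1 D) (fd_g2 D) 1 0).
    by rewrite /latt mulr1z mulr0z addr0.
  by rewrite /f phiD (phi_latt _ hB).
have f2 q : f (q + pi (fd_g2 D)) = f q + (0, 1).
  have -> : pi (fd_g2 D) = pi (latt (fd_g1 D) (fd_g2 D) 0 1).
    by rewrite /latt mulr1z mulr0z add0r.
  by rewrite /f phiD (phi_latt _ hB).
pose L q := - (k1 * (f q).1 + k2 * (f q).2).
have aL : affine_fun L.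
  exists ((- k1 * (pi (fd_g2 D)).2 + k2 * (pi (fd_g1 D)).2) / area F (fd_g1 D) (fd_g2 D),
    (k1 * (pi (fd_g2 D)).1 - k2 * (pi (fd_g1 D)).1) / area F (fd_g1 D) (fd_g2 D)), 0 => z.
  rewrite /L /f /phi /dotp /det /=; field; exact: A.
exists L => //.
pose P g := forall q, H (q + pi g) + L (q + pi g) = H q + L q.
have P1 : P (fd_g1 D) by move=> q; rewrite e1 /L f1 !coordE /=; ring.
have P2 : P (fd_g2 D) by move=> q; rewrite e2 /L f2 !coordE /=; ring.
have P0 : P 0 by move=> q; rewrite raddf0 addr0.
have PD g g' : P g -> P g' -> P (g + g').
  by move=> h h' q; rewrite raddfD /= addrA h' h.
have PN g : P g -> P (- g).
  by move=> h q; rewrite -(h (q + pi (- g))) raddfN /= subrK.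
have PM g n : P g -> P (g *+ n).
  by move=> h; elim: n => [|n IH]; rewrite ?mulr0n ?mulrS //; exact: PD.
have PZ g (m : int) : P g -> P (g *~ m).
  by case: m => n h; [exact: PM|apply: PN; exact: PM].
move=> q g; have [m [n ->]] := lattP hB g; move: q.
by apply: PD; exact: PZ.
Qed.

(** At a generic point, [period_jump] shows that the gradient is unchanged along h1.
    The crossings are counted in a basis h1, h2 of its own, so that each generator
    can play the role of h1. *)
Lemma lift_increment h1 h2 (m1 m2 : 'I_(fd_m D) -> int) s :
  is_Z2_basis h1 h2 ->
  (forall b : 'I_(fd_m D), fd_end b = act (latt h1 h2 (m1 b) (m2 b)) (fd_rep (fd_tgt b))) ->
  periodic_stress D s ->
  (forall z, \sum_b orbit_force s b z * (m2 b)%:~R = 0) ->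
  exists k, forall q, stress_lift D (fd_g1 D) (fd_g2 D) s (q + pi h1) =
    stress_lift D (fd_g1 D) (fd_g2 D) s q + k.
Proof.
move=> hB' endE [s0 inv _ _] hs; have hB := fd_gens D.
have lL := lift_is_lifting D hB s0; have iL := lift_induced D NC hB s0.
have [q0 [nq0 h0]] := generic_period D hB'.
have nq0' : ~ skel (q0 + pi h1) by move=> /skel_shift.
pose P := piece D (fd_g1 D) (fd_g2 D) s.
have J z : P (q0 + pi h1) z - P q0 z = P (q0 + pi h1) 0 - P q0 0.
  apply/eqP; rewrite -subr_eq0; apply/eqP.
  have := period_jump NC hB' endE z lL iL inv nq0 h0
    (lift_germ D hB s0 nq0) (lift_germ D hB s0 nq0').
  by rewrite hs mulr0.
exists (P (q0 + pi h1) (0 + pi h1) - P q0 0) => q.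
have JJ z z' : P (q0 + pi h1) z - P q0 z = P (q0 + pi h1) z' - P q0 z'.
  by rewrite (J z) (J z').
have := @increment_piece _ _ _ F D _ _ hB s s0 inv h1 q0 0 q q JJ.
by rewrite /stress_lift -/P => <-; ring.
Qed.

Lemma stress_lifting s : periodic_stress D s ->
  exists2 H, periodic_lifting F H & induced_stress F H s.
Proof.
move=> ps; have [s0 inv p1 p2] := ps; have hB := fd_gens D.
have q1 z : \sum_(b < fd_m D) orbit_force s b z * (fd_c b).1%:~R = 0.
  have := orbit_sum_det s (fun b : 'I_(fd_m D) => (fd_c b).1) z.
  by rewrite p1 det0l; exact: esym.
have q2 z : \sum_(b < fd_m D) orbit_force s b z * (fd_c b).2%:~R = 0.
  have := orbit_sum_det s (fun b : 'I_(fd_m D) => (fd_c b).2) z.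
  by rewrite p2 det0l; exact: esym.
have [k1 e1] := lift_increment hB (@fd_endE _ _ _ F D) ps q2.
have [k2 e2] := lift_increment (basisC hB) (@fd_endEC _ _ _ F D) ps q1.
have [L aL pL] := make_periodic e1 e2.
eexists; last exact: (induced_add (lift_induced D NC hB s0) aL).
by split; [exact: (lifting_add (lift_is_lifting D hB s0) aL)|exact: pL].
Qed.

End PeriodicLiftings.

(** * Signs of the stress and types of folds *)

Section Signs.
Variables (R : realType) (V : choiceType) (Gamma : zmodType).
Variable F : periodic_framework R V Gamma.
Variable D : fundamental_data F.
Hypothesis NC : noncrossing F.

Local Notation adj := (fw_adj F).
Local Notation p := (fw_p F).
Local Notation skel := (skeleton F).

Implicit Types (a b c d q x y z : plane R) (k r t e : R) (u v w : V).
Implicit Types (H L : plane R -> R) (s : set V -> R).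

(** The positive part of an affine function is convex. *)
Lemma convex_fold (K : set (plane R)) H L o k : convexset K ->
  affine_fun L -> affine_fun o -> 0 <= k ->
  (forall y, K y -> H y = L y + k * Num.max 0 (o y)) -> convex_function K H.
Proof.
move=> cK [n [C LE]] [m [M oE]] k0 HE t x y; rewrite !in_setE => Kx Ky.
have cE : conv t x y = t%:num *: x + (1 - t%:num) *: y :> plane R by [].
have /andP[t0 t1] : 0 <= t%:num <= 1 by rewrite ge0 le1.
have Kc : K (t%:num *: x + (1 - t%:num) *: y).
  apply: (cK y x) => //; exists t%:num; first by rewrite /= t0 t1.
  by apply: eq_plane; rewrite !coordE; ring.
rewrite cE convRE /unstable.onem (HE _ Kc) (HE _ Kx) (HE _ Ky).
have oc : o (t%:num *: x + (1 - t%:num) *: y) = t%:num * o x + (1 - t%:num) * o y.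
  by rewrite !oE /dotp !coordE; ring.
have Lc : L (t%:num *: x + (1 - t%:num) *: y) = t%:num * L x + (1 - t%:num) * L y.
  by rewrite !LE /dotp !coordE; ring.
have mx : Num.max 0 (t%:num * o x + (1 - t%:num) * o y) <=
    t%:num * Num.max 0 (o x) + (1 - t%:num) * Num.max 0 (o y).
  have s0 : 0 <= 1 - t%:num by lra.
  rewrite ge_max; apply/andP; split.
    by rewrite addr_ge0 // mulr_ge0 // le_max lexx.
  by apply: lerD; apply: ler_wpM2l => //; rewrite le_max lexx orbT.
rewrite oc Lc; have := ler_wpM2l k0 mx; lra.
Qed.

(** The formula holds on the line of the edge itself by continuity. *)
Lemma local_fold H s u v x : is_lifting F H -> induced_stress F H s -> adj u v ->
  open_segment (p u) (p v) x ->
  exists L e, [/\ affine_fun L, 0 < e & forall y, ball x e y ->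
    H y = L y + s [set u; v] * Num.max 0 (orient (p u) (p v) y)].
Proof.
move=> lH iH uv ox; have vu : adj v u by rewrite fw_sym.
have [W [U [nW [nU [CW [CU [lW lU aW aU E]]]]]]] := edge_jump lH iH uv.
have ox' : open_segment (p v) (p u) x.
  move: ox => [t /= /andP[t0 t1] <-]; exists (1 - t); first by apply/andP; split; lra.
  by apply: eq_plane; rewrite !coordE; ring.
have [e e0 hs] := near_edge_skel D NC uv ox.
have hs' y : ball x e y -> skel y -> segment (p v) (p u) y.
  by rewrite segmentC; exact: hs.
exists (fun z => dotp nU z + CU), e; split=> //; first by exists nU, CU.
move=> y xy; have [yo|yo|yo] := ltgtP (orient (p u) (p v) y) 0.
- have Uy : U y.
    by apply: (left_face_half vu lU ox' e0 hs'); split=> //=; rewrite orientC; lra.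
  by rewrite (aU y Uy) mulr0 addr0.
- have Wy : W y by apply: (left_face_half uv lW ox e0 hs).
  by rewrite (aW y Wy); have := E y; lra.
- have Wy : \forall t \near (0 : R)^'+, W (y + t *: perp (p v - p u)).
    by apply: filterS (near_left_half uv yo xy) => t ht; exact: (left_face_half uv lW ox e0 hs).
  by rewrite (left_limit_value lH.1 aW Wy); have := E y; rewrite yo; lra.
Qed.

Lemma flat_iff H s u v : is_lifting F H -> induced_stress F H s -> adj u v ->
  s [set u; v] = 0 <-> flat_edge F H u v.
Proof.
move=> lH iH uv; have vu : adj v u by rewrite fw_sym.
have [W [U [nW [nU [CW [CU [lW lU aW aU E]]]]]]] := edge_jump lH iH uv.
split=> [s0|[W' [U' [n [C [lW' lU' aW' aU']]]]]].
  exists W, U, nU, CU; split=> // q Wq; rewrite (aW q Wq).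
  by have := E q; rewrite s0 mul0r => /eqP; rewrite subr_eq0 => /eqP.
apply: (mulIf (orient_left uv)); rewrite mul0r -E.
have [t1 [g1 g1']] := filter_ex (filterI (left_face_germ D lW aW (mid_open F u v))
  (left_face_germ D lW' aW' (mid_open F u v))).
have [t2 [g2 g2']] := filter_ex (filterI (left_face_germ D lU aU (mid_open F v u))
  (left_face_germ D lU' aU' (mid_open F v u))).
by rewrite (germ_uniq g1 g1') (germ_uniq g2 g2') subrr.
Qed.

Lemma convex_ball_fun x e H : convex_function (ball x e) H ->
  forall a b, ball x e a -> ball x e b ->
  H (2^-1 *: (a + b)) <= 2^-1 * (H a + H b).
Proof.
move=> cH a b xa xb; have h0 : 0 <= 2^-1 :> R by lra.
have h1 : 2^-1 <= 1 :> R by lra.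
have : H (2^-1 *: a + (1 - 2^-1) *: b) <= 2^-1 * H a + (1 - 2^-1) * H b.
  exact: (cH (Itv01 h0 h1) a b (mem_set xa) (mem_set xb)).
have -> : 2^-1 *: a + (1 - 2^-1) *: b = 2^-1 *: (a + b).
  by apply: eq_plane; rewrite !coordE; field.
lra.
Qed.

(** Midpoint convexity is tested across the edge: with a negative stress the average
    over the two sides is less than the value at the edge. *)
Lemma fold_not_convex H s u v x : is_lifting F H -> induced_stress F H s -> adj u v ->
  open_segment (p u) (p v) x -> convex_near H x -> 0 <= s [set u; v].
Proof.
move=> lH iH uv ox [e e0 cH].
have [L [e' [[n [C LE]] e'0 h]]] := local_fold lH iH uv ox.
have N (a : plane R) r : 0 < r -> \forall t \near (0 : R)^'+, ball x r (x + t *: a).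
  move=> r0; have N0 : \forall t \near (0 : R), ball x r (x + t *: a).
    exact: (@line_cvg0 R x a _ (nbhsx_ballx x r r0)).
  by apply: filterS N0.
pose a := perp (p v - p u).
have [t [[[[h1 h2] h3] h4] t0]] := filter_ex (filterI (filterI (filterI (filterI
  (N a e e0) (N (- a) e e0)) (N a e' e'0)) (N (- a) e' e'0)) (nbhs_right_gt (0 : R))).
have := convex_ball_fun cH h1 h2.
have -> : 2^-1 *: (x + t *: a + (x + t *: - a)) = x.
  by apply: eq_plane; rewrite !coordE; field.
rewrite (h _ (ballxx x e'0)) (h _ h3) (h _ h4) !LE.
have o0 := orient_segment (open_segmentW ox).
have P := dotp_gt0 (edge_vec_neq0 uv).
have -> : orient (p u) (p v) (x + t *: - a) = - (t * dotp (p v - p u) (p v - p u)).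
  have := orient_perp (p u) (p v) x (- t); rewrite o0 add0r mulNr => <-.
  by rewrite /a scaleNr scalerN.
rewrite orient_perp o0 add0r maxxx.
have tP : 0 < t * dotp (p v - p u) (p v - p u) by rewrite mulr_gt0.
have mN : Num.max 0 (- (t * dotp (p v - p u) (p v - p u))) = 0.
  by apply/max_idPl; rewrite oppr_le0 ltW.
rewrite (max_idPr (ltW tP)) mN.
rewrite /dotp !coordE => k.
have {}k : 0 <= s [set u; v] * (t * dotp (p v - p u) (p v - p u)) by rewrite /dotp !coordE; lra.
by rewrite pmulr_lge0 in k.
Qed.

Lemma valley_iff H s u v : is_lifting F H -> induced_stress F H s -> adj u v ->
  0 < s [set u; v] <-> ~ flat_edge F H u v /\
    exists x, open_segment (p u) (p v) x /\ convex_near H x.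
Proof.
move=> lH iH uv; split=> [spos|[nf [x [ox cH]]]].
  split; first by move=> /(flat_iff lH iH uv) s0; rewrite s0 ltxx in spos.
  have ox := mid_open F u v; exists (p u + 2^-1 *: (p v - p u)); split=> //.
  have [L [e [aL e0 h]]] := local_fold lH iH uv ox.
  exists e => //.
  exact: (convex_fold (@convex_ball _ _ _) aL (affine_orient _ _) (ltW spos) h).
rewrite lt_neqAle eq_sym (fold_not_convex lH iH uv ox cH) andbT.
by apply/eqP => s0; apply: nf; apply/(flat_iff lH iH uv).
Qed.

Lemma lifting_opp H : is_lifting F H -> is_lifting F (fun q => - H q).
Proof.
move=> [cH aH]; split; first by move=> q; apply: cvgN; exact: cH.
move=> U /aH[n [C E]]; exists (- n), (- C) => q Uq; rewrite (E q Uq) /dotp !coordE; ring.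
Qed.

Lemma induced_opp H s : induced_stress F H s ->
  induced_stress F (fun q => - H q) (fun E => - s E).
Proof.
move=> iH u v uv; have [W [U [nW [nU [CW [CU [lW lU aW aU E]]]]]]] := iH _ _ uv.
exists W, U, (- nW), (- nU), (- CW), (- CU); split=> //.
- by move=> q Wq; rewrite (aW q Wq) /dotp !coordE; ring.
- by move=> q Uq; rewrite (aU q Uq) /dotp !coordE; ring.
- by rewrite scaleNr -E opprD.
Qed.

Lemma flat_opp H u v : flat_edge F (fun q => - H q) u v -> flat_edge F H u v.
Proof.
move=> [W [U [n [C [lW lU aW aU]]]]]; exists W, U, (- n), (- C); split=> //.
- by move=> q Wq; rewrite -[LHS]opprK (aW q Wq) /dotp !coordE; ring.
- by move=> q Uq; rewrite -[LHS]opprK (aU q Uq) /dotp !coordE; ring.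
Qed.

Lemma mountain_iff H s u v : is_lifting F H -> induced_stress F H s -> adj u v ->
  s [set u; v] < 0 <-> mountain_edge F H u v.
Proof.
move=> lH iH uv.
have [V1 V2] := valley_iff (lifting_opp lH) (induced_opp iH) uv.
split=> [sneg|[nf h]].
  have [nf h] : ~ flat_edge F (fun q => - H q) u v /\
     exists x, open_segment (p u) (p v) x /\ convex_near (fun q => - H q) x.
    by apply: V1; rewrite oppr_gt0.
  by split=> //; move/(flat_iff lH iH uv) => s0; rewrite s0 ltxx in sneg.
by rewrite -oppr_gt0; apply: V2; split=> // /flat_opp.
Qed.

End Signs.

Theorem mainTheorem1 (R : realType) (V : choiceType) (Gamma : zmodType)
    (F : periodic_framework R V Gamma) (D : fundamental_data F) :
  noncrossing F -> polygonal_faces F ->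
  [/\ (* a periodic lifting induces a unique stress, which is periodic *)
      forall H : R * R -> R, periodic_lifting F H ->
        [/\ exists s : set V -> R, induced_stress F H s,
            forall s s' : set V -> R,
              induced_stress F H s -> induced_stress F H s' ->
              forall e : set V, edges F e -> s e = s' e
          & forall s : set V -> R, induced_stress F H s -> periodic_stress D s],
      (* a periodic stress is induced by a periodic lifting, determined up to
         an arbitrary additive constant *)
      forall s : set V -> R, periodic_stress D s ->
        exists H : R * R -> R,
          [/\ periodic_lifting F H, induced_stress F H s
            & forall H' : R * R -> R,
                periodic_lifting F H' /\ induced_stress F H' s <->
                exists c : R, forall q : R * R, H' q = H q + c]
    & (* stress signs and types of lifted edges *)
      forall (H : R * R -> R) (s : set V -> R),
        periodic_lifting F H -> induced_stress F H s ->
        forall u v : V, fw_adj F u v ->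
          [/\ s [set u; v]%classic < 0 <-> mountain_edge F H u v,
              0 < s [set u; v]%classic <-> valley_edge F H u v
            & s [set u; v]%classic = 0 <-> flat_edge F H u v]].
Proof.
move=> NC _; split.
- move=> H pH; split.
  + exact: (stress_exists D NC pH.1).
  + move=> s s' iH iH' _ [u [v [uv ->]]]; exact: (stress_unique D pH.1 iH iH' uv).
  + move=> s iH; exact: (lifting_periodic_stress D NC pH iH).
- move=> s ps; have [H pH iH] := stress_lifting NC ps.
  exists H; split=> // H'; split=> [[pH' iH']|[c H'E]].
    exact: (periodic_unique D NC pH pH' iH iH').
  have {H'E} -> : H' = (fun q => H q + c) by exact/funext.
  have ac : affine_fun (fun=> c : R).
    by exists 0, c => z; rewrite /dotp /= !mul0r !add0r.
  split; last exact: induced_add iH ac.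
  by split; [exact: lifting_add pH.1 ac|move=> q g; rewrite pH.2].
- move=> H s [lH _] iH u v uv; split.
  + exact: (mountain_iff D NC lH iH uv).
  + exact: (valley_iff D NC lH iH uv).
  + exact: (flat_iff D lH iH uv).
Qed.
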